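(* Let $k\in\mathbb{Z}^+$ and let $\mu$ be a non-negative finite Borel measure on $\mathbb{H}_k$. The following are equivalent: (i) $\mu$ is a Carleson measure of $A^2(\mathbb{H}_k)$; (ii) $\mathcal{B}_\mu\in L^\infty(\mathbb{H}_k)$; (iii) $T_\mu\in L^\infty(\mathbb{H}_k)$.
   Context: $\mathbb{H}_k=\{(z_1,z_2)\in\mathbb{C}^2:|z_1|^k<|z_2|<1\}$. $dV$ is Lebesgue measure, $A^2(\mathbb{H}_k)$ the holomorphic $dV$-square-integrable functions. With $s=z_1\overline{w}_1$, $t=z_2\overline{w}_2$, the Bergman kernel of $\mathbb{H}_k$ is $K(z,w)=\dfrac{p_k(s)t^2+q_k(s)t+s^kp_k(s)}{k\pi^2(1-t)^2(t-s^k)^2}$, where $p_k(s)=\sum_{j=1}^{k-1}j(k-j)s^{j-1}$ ($p_1\equiv0$) and $q_k(s)=\sum_{j=1}^k\big(j^2+(k-j)^2s^k\big)s^{j-1}$. Define $\mathcal{P}(z,w)=\dfrac{t}{(1-t)^2(t-s^k)^2}$, $T_\mu(w)=\int_{\mathbb{H}_k}\frac{|\mathcal{P}(z,w)|^2}{K(w,w)}d\mu(z)$ and $\mathcal{B}_\mu(w)=\int_{\mathbb{H}_k}\frac{|K(z,w)|^2}{K(w,w)}d\mu(z)$. $\mu$ is Carleson if there is $C>0$ with $\int|h|^2d\mu\le C\int|h|^2dV$ for all $h\in A^2(\mathbb{H}_k)$. *)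

(* Defs.v *)
From HB Require Import structures.
From mathcomp Require Import all_boot all_order all_algebra.
From mathcomp Require Import all_classical all_reals all_analysis.
From mathcomp Require Import measurable_realfun.
From mathcomp Require Import complex.
Set Implicit Arguments.
Unset Strict Implicit.
Unset Printing Implicit Defensive.
Import Order.TTheory GRing.Theory Num.Theory ComplexField.

Local Open Scope classical_set_scope.
Local Open Scope ring_scope.

Section Hartogs.
Variable R : realType.

(* C^2 identified with R^4 = (R x R) x (R x R), with its product (Borel)
   sigma-algebra; a point p encodes z1 = p.1.1 + i p.1.2, z2 = p.2.1 + i p.2.2 *)
Local Notation C2 := ((measurableTypeR R * measurableTypeR R) *
                  (measurableTypeR R * measurableTypeR R))%type.

Definition cz1 (p : C2) : R[i] := (p.1.1 +i* p.1.2)%C.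
Definition cz2 (p : C2) : R[i] := (p.2.1 +i* p.2.2)%C.

Definition dV := ((@lebesgue_measure R \x @lebesgue_measure R) \x
                  (@lebesgue_measure R \x @lebesgue_measure R))%E.

Definition cabs (z : R[i]) : R := complex.Re `|z|.

Definition Hk (k : nat) : set C2 :=
  [set p | cabs (cz1 p) ^+ k < cabs (cz2 p) < 1].

Definition holomorphic_on (D : set C2) (h : C2 -> R[i]) : Prop :=
  forall p, D p -> exists a1 a2 : R[i], forall e : R, 0 < e ->
    exists2 d : R, 0 < d & forall q : C2,
      cabs (cz1 q - cz1 p) + cabs (cz2 q - cz2 p) < d ->
      cabs (h q - h p - a1 * (cz1 q - cz1 p) - a2 * (cz2 q - cz2 p))
        <= e * (cabs (cz1 q - cz1 p) + cabs (cz2 q - cz2 p)).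

Definition A2 (k : nat) (h : C2 -> R[i]) : Prop :=
  holomorphic_on (Hk k) h /\
  (\int[dV]_(z in Hk k) ((cabs (h z)) ^+ 2)%:E < +oo)%E.

Definition pk (k : nat) (s : R[i]) : R[i] :=
  \sum_(1 <= j < k) (j * (k - j))%:R * s ^+ j.-1.
Definition qk (k : nat) (s : R[i]) : R[i] :=
  \sum_(1 <= j < k.+1) ((j ^ 2)%:R + ((k - j) ^ 2)%:R * s ^+ k) * s ^+ j.-1.

(* Bergman kernel of H_k *)
Definition Kk (k : nat) (z w : C2) : R[i] :=
  let s := cz1 z * (cz1 w)^* in
  let t := cz2 z * (cz2 w)^* in
  (pk k s * t ^+ 2 + qk k s * t + s ^+ k * pk k s) /
  (((k%:R * (pi : R) ^+ 2) +i* 0)%C * (1 - t) ^+ 2 * (t - s ^+ k) ^+ 2).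

Definition Pk (k : nat) (z w : C2) : R[i] :=
  let s := cz1 z * (cz1 w)^* in
  let t := cz2 z * (cz2 w)^* in
  t / ((1 - t) ^+ 2 * (t - s ^+ k) ^+ 2).

Definition Tmu (k : nat) (mu : set C2 -> \bar R) (w : C2) : \bar R :=
  (\int[mu]_(z in Hk k) ((cabs (Pk k z w)) ^+ 2 / complex.Re (Kk k w w))%:E)%E.

Definition Bmu (k : nat) (mu : set C2 -> \bar R) (w : C2) : \bar R :=
  (\int[mu]_(z in Hk k) ((cabs (Kk k z w)) ^+ 2 / complex.Re (Kk k w w))%:E)%E.

Definition carleson (k : nat) (mu : set C2 -> \bar R) : Prop :=
  exists2 C : R, 0 < C & forall h, A2 k h ->
    (\int[mu]_(z in Hk k) ((cabs (h z)) ^+ 2)%:E <=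
     C%:E * \int[dV]_(z in Hk k) ((cabs (h z)) ^+ 2)%:E)%E.

Definition Linfty_Hk (k : nat) (f : C2 -> \bar R) : Prop :=
  measurable_fun (Hk k) f /\
  exists M : R, {ae dV, forall w, Hk k w -> (`|f w| <= M%:E)%E}.

End Hartogs.

Notation C2 R := ((measurableTypeR R * measurableTypeR R) *
                  (measurableTypeR R * measurableTypeR R))%type.

(* Main.v *)
Require Import Defs.
From HB Require Import structures.
From mathcomp Require Import all_boot all_order all_algebra.
From mathcomp Require Import all_classical all_reals all_analysis.
From mathcomp Require Import measurable_realfun.
From mathcomp Require Import complex ring lra.
From mathcomp Require cyclic separable cyclotomic.
Set Implicit Arguments.
Unset Strict Implicit.
Unset Printing Implicit Defensive.
Import Order.TTheory GRing.Theory Num.Theory.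
Import numFieldNormedType.Exports.
Local Open Scope classical_set_scope.
Local Open Scope ring_scope.

(* Let [M] be [P] or the Bergman kernel [K].  Two estimates relate [M] to the
   unweighted space [A2]:
   - [int |M(z, w)|^2 dV(z) <= C K(w, w)], so that testing the Carleson
     inequality on [M(., w)] bounds [int |M(z, w)|^2 / K(w, w) dmu(z)];
   - [|h(z)|^2 <= C int |M(z, w)|^2 / K(w, w) |h(w)|^2 dV(w)] for [h] in [A2],
     so that integrating against [mu] and exchanging the integrals gives
     [int |h|^2 dmu <= C int |h|^2 T dV] with [T] the transform of [mu].
   The map [(a, b) |-> (a b, b^k)] sends [D x D*] onto the domain, and with
   [u = s^k / t] one has [P = 1 / (t (1 - t)^2 (1 - u)^2)].  The second estimate
   is the mean value inequality on a small polydisc around [z], where the weight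
   is at least a constant over the square of the volume.  It degenerates as
   [b -> 0]; there the weight is bounded below on the whole ring
   [1/4 <= |b'| <= 1/2] instead, and [b^k h(a b, b^k)], whose singularity at
   [b = 0] is removable because [h] is square integrable, is controlled at small
   [b] by its values on the ring. *)

(** The estimates for [K] use no reproducing property, only the factorisation K = P E / (k pi^2)
    with E a polynomial in s, t, u. E is bounded, so upper bounds pass from [P] to [K]. A lower
    bound is at hand only near nonnegative real arguments, because the coefficients of E are
    nonnegative; hence the weight is tested only where s, t, u are nearly such: on a small polydisc
    around z or, for b near 0, over a fixed ring with first coordinate near a. The map (a, b) to (a
    b, b^k) has Jacobian k b^k, and the diagonal of [K] is comparable to the bidisc kernel divided
    by |b|^(2k). The polydisc around z must avoid b = 0, which costs a factor |b|^2 of volume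
    against that kernel: this is the degeneration at b = 0. The function that replaces h there is,
    up to the factor k, its pullback times the Jacobian. Constants are irrelevant, so Cauchy's
    theory is reduced to inequalities: rectangles, a winding integral known only to have modulus
    between 4 and 16, and area integrals instead of circles. Likewise the norms of the kernels all
    come from the integral of 1 / (d^2 + x^2) over the line. *)

Section Cabs.
Variable R : realType.
Implicit Types z w : R[i].

Lemma cabsE z : cabs z = Num.sqrt (complex.Re z ^+ 2 + complex.Im z ^+ 2).
Proof. by case: z. Qed.

Lemma norm_cabs z : `|z| = (cabs z)%:C%C.
Proof. by case: z. Qed.

Lemma cabs_ge0 z : 0 <= cabs z.
Proof. by rewrite cabsE sqrtr_ge0. Qed.

Lemma cabs0 : cabs (0 : R[i]) = 0.
Proof. by rewrite /cabs normr0. Qed.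

Lemma cabs1 : cabs (1 : R[i]) = 1.
Proof. by rewrite /cabs normr1. Qed.

Lemma cabs_eq0 z : (cabs z == 0) = (z == 0).
Proof.
by rewrite -(inj_eq (@complexI R)) -norm_cabs rmorph0 normr_eq0.
Qed.

Lemma cabs_gt0 z : (0 < cabs z) = (z != 0).
Proof. by rewrite lt_def cabs_ge0 andbT cabs_eq0. Qed.

Lemma cabsM z w : cabs (z * w) = cabs z * cabs w.
Proof. by apply: complexI; rewrite rmorphM /= -!norm_cabs normrM. Qed.

Lemma cabsX z n : cabs (z ^+ n) = cabs z ^+ n.
Proof. by apply: complexI; rewrite rmorphXn /= -!norm_cabs normrX. Qed.

Lemma cabsV z : cabs z^-1 = (cabs z)^-1.
Proof. by apply: complexI; rewrite fmorphV /= -!norm_cabs normfV. Qed.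

Lemma cabs_div z w : cabs (z / w) = cabs z / cabs w.
Proof. by rewrite cabsM cabsV. Qed.

Lemma cabsD z w : cabs (z + w) <= cabs z + cabs w.
Proof. by rewrite -lecR rmorphD /= -!norm_cabs ler_normD. Qed.

Lemma cabsN z : cabs (- z) = cabs z.
Proof. by rewrite /cabs normrN. Qed.

Lemma cabsC z w : cabs (z - w) = cabs (w - z).
Proof. by rewrite -cabsN opprB. Qed.

Lemma cabsB z w : cabs (z - w) <= cabs z + cabs w.
Proof. by rewrite (le_trans (cabsD _ _))// cabsN. Qed.

Lemma cabsD_ge z w : cabs z - cabs w <= cabs (z + w).
Proof. by rewrite lerBlDr -{1}(addrK w z) (le_trans (cabsB _ _)). Qed.

Lemma cabs_tri z w y : cabs (z - y) <= cabs (z - w) + cabs (w - y).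
Proof. by rewrite -{1}(subrK w z) -addrA cabsD. Qed.

Lemma cabs_conj z : cabs (z^*) = cabs z.
Proof. by rewrite /cabs norm_conjC. Qed.

Lemma cabs_prod (I : Type) (r : seq I) (P : pred I) (F : I -> R[i]) :
  cabs (\prod_(i <- r | P i) F i) = \prod_(i <- r | P i) cabs (F i).
Proof. by elim/big_ind2 : _ => // [|x1 x2 y1 y2 <- <-]; rewrite ?cabs1 ?cabsM. Qed.

Lemma cabs_sum (I : Type) (r : seq I) (P : pred I) (F : I -> R[i]) :
  cabs (\sum_(i <- r | P i) F i) <= \sum_(i <- r | P i) cabs (F i).
Proof.
elim/big_ind2 : _ => // [|x1 x2 y1 y2 h1 h2]; first by rewrite cabs0.
by rewrite (le_trans (cabsD _ _)) ?lerD.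
Qed.

Lemma cabs_real (x : R) : cabs (x%:C)%C = `|x|.
Proof. by rewrite cabsE /= expr0n addr0 sqrtr_sqr. Qed.

Lemma cabs_nat n : cabs (n%:R : R[i]) = n%:R.
Proof. by rewrite -(rmorph_nat (real_complex R)) cabs_real ger0_norm. Qed.

Lemma cabs_Re z : `|complex.Re z| <= cabs z.
Proof.
by rewrite cabsE -sqrtr_sqr ler_sqrt ?lerDl ?sqr_ge0// addr_ge0 ?sqr_ge0.
Qed.

Lemma cabs_Im z : `|complex.Im z| <= cabs z.
Proof.
by rewrite cabsE -sqrtr_sqr ler_sqrt ?lerDr ?sqr_ge0// addr_ge0 ?sqr_ge0.
Qed.

Lemma cabs_ReIm z : cabs z <= `|complex.Re z| + `|complex.Im z|.
Proof.
case: z => a b; have -> : (a +i* b = a%:C + 'i * b%:C)%C by rewrite [LHS]complexE.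
rewrite (le_trans (cabsD _ _))// cabsM !cabs_real.
have -> : cabs ('i%C : R[i]) = 1.
  by rewrite cabsE /= expr0n add0r expr1n sqrtr1.
by rewrite mul1r /= !(mul0r, mul1r, subr0, sub0r, oppr0, mulr0, addr0, add0r).
Qed.

Lemma cabs2E z : cabs z ^+ 2 = complex.Re z ^+ 2 + complex.Im z ^+ 2.
Proof. by rewrite cabsE sqr_sqrtr// addr_ge0 ?sqr_ge0. Qed.

Lemma mulc_conj z : z * z^* = ((cabs z ^+ 2)%:C)%C.
Proof. by rewrite -normCK norm_cabs rmorphXn. Qed.

End Cabs.

(** * Complex differentiability in one and two variables *)

Section Hol.
Variables (R : realType) (T : Type) (c1 c2 : T -> R[i]).
Implicit Types f g : T -> R[i].

Definition dist (p q : T) : R := cabs (c1 q - c1 p) + cabs (c2 q - c2 p).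

Definition ccont f p := forall e : R, 0 < e ->
  exists2 d : R, 0 < d & forall q, dist p q < d -> cabs (f q - f p) <= e.

(* Holomorphy in the coordinates [c1], [c2]; a constant [c2] gives the one-variable
   notion [hol1] below. *)
Definition hol f p := exists a1 a2 : R[i], forall e : R, 0 < e ->
  exists2 d : R, 0 < d & forall q, dist p q < d ->
    cabs (f q - f p - a1 * (c1 q - c1 p) - a2 * (c2 q - c2 p)) <= e * dist p q.

Lemma dist_ge0 p q : 0 <= dist p q.
Proof. by rewrite addr_ge0 ?cabs_ge0. Qed.

Lemma ccont_near f p : ccont f p -> f p != 0 -> exists2 d : R, 0 < d &
  forall q, dist p q < d -> cabs (f p) / 2 <= cabs (f q).
Proof.
move=> cf f0; have f0' : 0 < cabs (f p) / 2 by rewrite divr_gt0 ?cabs_gt0.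
have [d d0 H] := cf _ f0'; exists d => // q /H.
have := cabs_tri (f p) (f q) 0; rewrite !subr0 (cabsC (f q) (f p)).
by move: (cabs (_ - _)) => x; lra.
Qed.

Lemma ccont_cst a p : ccont (fun=> a) p.
Proof. by move=> e e0; exists 1 => // q _; rewrite subrr cabs0 ltW. Qed.

Lemma ccontD f g p : ccont f p -> ccont g p -> ccont (fun x => f x + g x) p.
Proof.
move=> cf cg e e0; have e20 : 0 < e / 2 by rewrite divr_gt0.
have [d1 d10 H1] := cf _ e20; have [d2 d20 H2] := cg _ e20.
exists (Num.min d1 d2); first by rewrite lt_min d10.
move=> q; rewrite lt_min => /andP[/H1 h1 /H2 h2].
rewrite opprD addrACA (le_trans (cabsD _ _))//; lra.
Qed.

Lemma ccontM f g p : ccont f p -> ccont g p -> ccont (fun x => f x * g x) p.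
Proof.
move=> cf cg e e0.
set M := cabs (f p) + cabs (g p) + 1.
have M1 : 1 <= M by rewrite lerDr addr_ge0 ?cabs_ge0.
have M0 : 0 < M by rewrite (lt_le_trans _ M1).
set e1 := Num.min 1 (e / (M * 2)).
have e10 : 0 < e1 by rewrite lt_min ltr01 divr_gt0 ?mulr_gt0.
have [d1 d10 H1] := cf _ e10; have [d2 d20 H2] := cg _ e10.
exists (Num.min d1 d2); first by rewrite lt_min d10.
move=> q; rewrite lt_min => /andP[/H1 h1 /H2 h2].
have -> : f q * g q - f p * g p = (f q - f p) * (g q - g p)
  + f p * (g q - g p) + g p * (f q - f p) by ring.
apply: (@le_trans _ _ (e1 * 1 + cabs (f p) * e1 + cabs (g p) * e1)).
  rewrite (le_trans (cabsD _ _))// lerD ?cabsM ?ler_wpM2l ?cabs_ge0//.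
  rewrite (le_trans (cabsD _ _))// lerD ?cabsM ?ler_wpM2l ?cabs_ge0//.
  by rewrite ler_pM ?cabs_ge0// (le_trans h2)// ge_min lexx.
apply: (@le_trans _ _ (M * e1)); first by rewrite /M; lra.
have : e1 <= e / (M * 2) by rewrite ge_min lexx orbT.
move=> /(ler_wpM2l (ltW M0))/le_trans; apply.
by have -> : M * (e / (M * 2)) = e / 2; [field; rewrite gt_eqF|lra].
Qed.

Lemma ccontV f p : f p != 0 -> ccont f p -> ccont (fun x => (f x)^-1) p.
Proof.
move=> f0 cf e e0; have [d d0 H] := ccont_near cf f0.
have c0 : 0 < cabs (f p) by rewrite cabs_gt0.
set e1 := e * (cabs (f p) ^+ 2 / 2).
have e10 : 0 < e1 by rewrite mulr_gt0// divr_gt0// exprn_gt0.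
have [d1 d10 H1] := cf _ e10.
exists (Num.min d d1); first by rewrite lt_min d0.
move=> q; rewrite lt_min => /andP[/H h /H1 h1].
have fq0 : f q != 0 by rewrite -cabs_gt0 (lt_le_trans _ h)// divr_gt0.
have -> : (f q)^-1 - (f p)^-1 = (f p - f q) / (f q * f p).
  by field; apply/andP.
rewrite cabs_div cabsM cabsC ler_pdivrMr ?mulr_gt0 ?cabs_gt0//.
rewrite (le_trans h1)// /e1 ler_wpM2l ?(ltW e0)//.
by rewrite expr2 mulrAC ler_wpM2r// ltW.
Qed.

Lemma ccontX f p n : ccont f p -> ccont (fun x => f x ^+ n) p.
Proof.
move=> cf; elim: n => [|n IH]; first exact: ccont_cst.
by under eq_fun do rewrite exprS; exact: ccontM.
Qed.

Lemma ccont_c1 p : ccont c1 p.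
Proof.
move=> e e0; exists e => // q; rewrite /dist => H.
by rewrite ltW// (le_lt_trans _ H)// lerDl cabs_ge0.
Qed.

Lemma ccont_c2 p : ccont c2 p.
Proof.
move=> e e0; exists e => // q; rewrite /dist => H.
by rewrite ltW// (le_lt_trans _ H)// lerDr cabs_ge0.
Qed.

(* Caratheodory's form of differentiability. *)
Lemma holP f p : hol f p <-> exists g1 g2 : T -> R[i], [/\ ccont g1 p, ccont g2 p &
  exists2 d : R, 0 < d & forall q, dist p q < d ->
  f q = f p + g1 q * (c1 q - c1 p) + g2 q * (c2 q - c2 p)].
Proof.
split=> [[a1 [a2 H]]|[g1 [g2 [cg1 cg2 [d0 d00 H]]]]]; last first.
  exists (g1 p), (g2 p) => e e0.
  have [d1 d10 H1] := cg1 _ e0; have [d2 d20 H2] := cg2 _ e0.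
  exists (Num.min d0 (Num.min d1 d2)); first by rewrite !lt_min d00 d10.
  move=> q; rewrite !lt_min => /and3P[/H -> /H1 h1 /H2 h2].
  have -> : f p + g1 q * (c1 q - c1 p) + g2 q * (c2 q - c2 p) - f p -
    g1 p * (c1 q - c1 p) - g2 p * (c2 q - c2 p) =
    (g1 q - g1 p) * (c1 q - c1 p) + (g2 q - g2 p) * (c2 q - c2 p) by ring.
  rewrite (le_trans (cabsD _ _))// !cabsM /dist mulrDr.
  by rewrite lerD// ler_wpM2r ?cabs_ge0.
pose r q := f q - f p - a1 * (c1 q - c1 p) - a2 * (c2 q - c2 p).
(* The remainder is charged to whichever increment is larger; as [dist] is at most twice that
   increment, an error e / 2 in [H] costs either coefficient at most e. *)
pose b q := cabs (c2 q - c2 p) <= cabs (c1 q - c1 p).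
pose g1 q := a1 + if b q then r q / (c1 q - c1 p) else 0.
pose g2 q := a2 + if b q then 0 else r q / (c2 q - c2 p).
have r0 : r p = 0 by rewrite /r !subrr !mulr0 !subr0.
have g1p : g1 p = a1 by rewrite /g1 r0 mul0r if_same addr0.
have g2p : g2 p = a2 by rewrite /g2 r0 mul0r if_same addr0.
exists g1, g2; split.
- move=> e e0; have e20 : 0 < e / 2 by rewrite divr_gt0.
  have [d d0 Hd] := H _ e20; exists d => // q /Hd hq.
  rewrite g1p /g1 addrC addKr; case: ifPn => [bq|_]; last by rewrite cabs0 ltW.
  have [->|n0] := eqVneq (c1 q - c1 p) 0; first by rewrite invr0 mulr0 cabs0 ltW.
  rewrite cabs_div ler_pdivrMr ?cabs_gt0// (le_trans hq)//.
  rewrite -mulrA ler_wpM2l ?(ltW e0)// mulrC ler_pdivrMr// /dist.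
  by move: bq; rewrite /b; lra.
- move=> e e0; have e20 : 0 < e / 2 by rewrite divr_gt0.
  have [d d0 Hd] := H _ e20; exists d => // q /Hd hq.
  rewrite g2p /g2 addrC addKr; case: ifPn => [_|bq]; first by rewrite cabs0 ltW.
  have [->|n0] := eqVneq (c2 q - c2 p) 0; first by rewrite invr0 mulr0 cabs0 ltW.
  rewrite cabs_div ler_pdivrMr ?cabs_gt0// (le_trans hq)//.
  rewrite -mulrA ler_wpM2l ?(ltW e0)// mulrC ler_pdivrMr// /dist.
  by move: bq; rewrite /b -ltNge; lra.
- have [d d0 Hd] := H _ ltr01; exists d => // q /Hd hq.
  have : f q = f p + a1 * (c1 q - c1 p) + a2 * (c2 q - c2 p) + r q.
    by rewrite /r; ring.
  move=> ->; rewrite /g1 /g2; case: ifPn => bq.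
    have [n0|n0] := eqVneq (c1 q - c1 p) 0.
      have n0' : c2 q - c2 p = 0.
        apply/eqP; rewrite -cabs_eq0 eq_le cabs_ge0 andbT.
        by rewrite (le_trans bq)// n0 cabs0.
      have -> : r q = 0.
        apply/eqP; rewrite -cabs_eq0 eq_le cabs_ge0 andbT (le_trans hq)//.
        by rewrite mul1r /dist n0 n0' cabs0 addr0.
      by rewrite n0 n0' !mulr0 !addr0.
    by rewrite [(a1 + _) * _]mulrDl divfK//; ring.
  have n0 : c2 q - c2 p != 0.
    by rewrite -cabs_gt0 (le_lt_trans (cabs_ge0 (c1 q - c1 p)))// ltNge.
  by rewrite [(a2 + _) * _]mulrDl divfK//; ring.
Qed.

Lemma hol_ccont f p : hol f p -> ccont f p.
Proof.
move=> /holP[g1 [g2 [h1 h2 [d0 d00 H]]]] e e0.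
pose F q := g1 q * (c1 q - c1 p) + g2 q * (c2 q - c2 p).
have cF : ccont F p.
  apply: ccontD; apply: ccontM => //; apply: ccontD.
  - exact: ccont_c1.
  - exact: ccont_cst.
  - exact: ccont_c2.
  - exact: ccont_cst.
have [d d1 Hd] := cF e e0.
exists (Num.min d0 d); first by rewrite lt_min d00.
move=> q; rewrite lt_min => /andP[/H -> /Hd].
by rewrite /F !subrr !mulr0 addr0 subr0 -(addrA (f p)) (addrC (f p)) addrK.
Qed.

Lemma hol_cst a p : hol (fun=> a) p.
Proof.
exists 0, 0 => e e0; exists 1 => // q _.
by rewrite subrr !mul0r !subr0 cabs0 mulr_ge0 ?dist_ge0 ?ltW.
Qed.

Lemma hol_c1 p : hol c1 p.
Proof.
exists 1, 0 => e e0; exists 1 => // q _.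
by rewrite mul1r subrr mul0r subrr cabs0 mulr_ge0 ?dist_ge0 ?ltW.
Qed.

Lemma hol_c2 p : hol c2 p.
Proof.
exists 0, 1 => e e0; exists 1 => // q _.
by rewrite mul1r mul0r subr0 subrr cabs0 mulr_ge0 ?dist_ge0 ?ltW.
Qed.

Lemma holD f g p : hol f p -> hol g p -> hol (fun x => f x + g x) p.
Proof.
move=> /holP[f1 [f2 [cf1 cf2 [d d0 H]]]] /holP[g1 [g2 [cg1 cg2 [d' d0' H']]]].
apply/holP; exists (fun x => f1 x + g1 x), (fun x => f2 x + g2 x).
split; [exact: ccontD|exact: ccontD|].
exists (Num.min d d'); first by rewrite lt_min d0.
by move=> q; rewrite lt_min => /andP[/H -> /H' ->]; ring.
Qed.

Lemma holM f g p : hol f p -> hol g p -> hol (fun x => f x * g x) p.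
Proof.
move=> hf hg; have cf := hol_ccont hf; move: hf hg.
move=> /holP[f1 [f2 [cf1 cf2 [d d0 H]]]] /holP[g1 [g2 [cg1 cg2 [d' d0' H']]]].
apply/holP; exists (fun x => f1 x * g p + f x * g1 x),
  (fun x => f2 x * g p + f x * g2 x).
split; [by apply: ccontD; apply: ccontM => //; exact: ccont_cst|
        by apply: ccontD; apply: ccontM => //; exact: ccont_cst|].
exists (Num.min d d'); first by rewrite lt_min d0.
by move=> q; rewrite lt_min => /andP[/H fq /H' gq]; rewrite gq fq; ring.
Qed.

Lemma holV f p : f p != 0 -> hol f p -> hol (fun x => (f x)^-1) p.
Proof.
move=> f0 hf; have cf := hol_ccont hf; have [d1 d10 H1] := ccont_near cf f0.
move: hf => /holP[f1 [f2 [cf1 cf2 [d d0 H]]]].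
apply/holP; exists (fun x => - f1 x / (f x * f p)), (fun x => - f2 x / (f x * f p)).
have cV : ccont (fun x => (f x * f p)^-1) p.
  apply: ccontV; first by rewrite mulf_neq0.
  by apply: ccontM => //; exact: ccont_cst.
have cN g : ccont g p -> ccont (fun x => - g x) p.
  move=> cg; under eq_fun do rewrite -mulN1r.
  by apply: ccontM => //; exact: ccont_cst.
split; [by apply: ccontM => //; apply: cN|by apply: ccontM => //; apply: cN|].
exists (Num.min d d1); first by rewrite lt_min d0.
move=> q; rewrite lt_min => /andP[/H fq /H1 gq].
have fq0 : f q != 0 by rewrite -cabs_gt0 (lt_le_trans _ gq)// divr_gt0 ?cabs_gt0.
have E : f1 q * (c1 q - c1 p) + f2 q * (c2 q - c2 p) = f q - f p by rewrite fq; ring.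
rewrite !mulNr mulrAC [f2 q / _ * _]mulrAC -addrA -opprD -mulrDl E.
by field; apply/andP.
Qed.

Lemma holX f p n : hol f p -> hol (fun x => f x ^+ n) p.
Proof.
move=> cf; elim: n => [|n IH]; first exact: hol_cst.
by under eq_fun do rewrite exprS; exact: holM.
Qed.

Lemma holB f g p : hol f p -> hol g p -> hol (fun x => f x - g x) p.
Proof.
move=> hf hg; under eq_fun do rewrite -mulN1r.
by apply: holD => //; apply: holM => //; exact: hol_cst.
Qed.

Lemma hol_sum (I : Type) (r : seq I) (F : I -> T -> R[i]) p :
  (forall i, hol (F i) p) -> hol (fun x => \sum_(i <- r) F i x) p.
Proof.
move=> H; elim: r => [|i r IH].
  by under eq_fun do rewrite big_nil; exact: hol_cst.
by under eq_fun do rewrite big_cons; exact: holD.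
Qed.

End Hol.

Notation hol1 := (hol idfun (fun=> 0)).
Notation ccont1 := (ccont idfun (fun=> 0)).
Notation dist1 := (dist idfun (fun=> 0)).

Section HolComp.
Variables (R : realType) (T : Type) (c1 c2 : T -> R[i]).
Implicit Types (h : T -> R[i]) (g : R[i] -> T).

Lemma dist1E (z w : R[i]) : dist1 z w = cabs (w - z).
Proof. by rewrite /dist /= subr0 cabs0 addr0. Qed.

(** In Caratheodory's form the chain rule is the substitution of one identity into another; only the
    continuity of the composed coefficients has to be checked. *)
Lemma hol_comp h g z : hol c1 c2 h (g z) ->
  hol1 (fun x => c1 (g x)) z -> hol1 (fun x => c2 (g x)) z ->
  hol1 (fun x => h (g x)) z.
Proof.
move=> /holP[h1 [h2 [ch1 ch2 [d0 d00 H]]]] hg1 hg2.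
have cg : forall e : R, 0 < e -> exists2 d : R, 0 < d &
    forall x, dist1 z x < d -> dist c1 c2 (g z) (g x) < e.
  move=> e e0; have e30 : 0 < e / 3 by rewrite divr_gt0.
  have [d1 d10 H1] := hol_ccont hg1 e30.
  have [d2 d20 H2] := hol_ccont hg2 e30.
  exists (Num.min d1 d2); first by rewrite lt_min d10.
  move=> x; rewrite lt_min => /andP[/H1 + /H2]; rewrite /(dist c1).
  by move: (cabs _) (cabs _) => u v; lra.
have cc (f : T -> R[i]) : ccont c1 c2 f (g z) -> ccont1 (fun x => f (g x)) z.
  move=> cf e e0; have [d d1 Hd] := cf _ e0; have [d2 d20 Hd2] := cg _ d1.
  by exists d2 => // x /Hd2 /Hd.
move: hg1 hg2 => /holP[f1 [f2 [cf1 cf2 [df df0 Hf]]]].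
move=> /holP[k1 [k2 [ck1 ck2 [dk dk0 Hk]]]].
apply/holP; exists (fun x => h1 (g x) * f1 x + h2 (g x) * k1 x), (fun=> 0).
split.
- by apply: ccontD; apply: ccontM => //; exact: cc.
- exact: ccont_cst.
have [d d1 Hd] := cg _ d00.
exists (Num.min d (Num.min df dk)); first by rewrite !lt_min d1 df0.
move=> x; rewrite !lt_min => /and3P[/Hd xd /Hf xf /Hk xk].
by rewrite H// xf xk; ring.
Qed.

End HolComp.

(** * Cauchy's formula on rectangles *)

Section SegmentIntegral.
Variable R : realType.
Implicit Types (f g : R -> R[i]) (h : R -> R) (a b c d : R).

Definition rint h a b : R := (\int[@lebesgue_measure R]_(x in `[a, b]) h x)%R.

Definition rcont h x := forall e : R, 0 < e -> exists2 d : R, 0 < d &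
  forall y, `|y - x| < d -> `|h y - h x| <= e.

Definition rcont_on h a b := forall x, a <= x <= b -> rcont h x.

Lemma rcont_continuous h x : rcont h x -> {for x, continuous h}.
Proof.
move=> H; apply/cvgrPdist_le => e e0; have [d d0 Hd] := H _ e0.
near=> y; rewrite distrC; apply: Hd; near: y.
by apply/nbhs_ballP; exists d => //= y; rewrite /ball /= distrC.
Unshelve. all: by end_near. Qed.

Lemma rcont_integrable h a b : rcont_on h a b ->
  (@lebesgue_measure R).-integrable `[a, b] (EFin \o h).
Proof.
move=> H; apply: continuous_compact_integrable; first exact: segment_compact.
apply: continuous_in_subspaceT => x /set_mem /=; rewrite in_itv /= => xab.
exact/rcont_continuous/H.
Qed.

Lemma rint_cst k a b : a <= b -> rint (fun=> k) a b = k * (b - a).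
Proof.
move=> ab; rewrite /rint Rintegral_cst//= lebesgue_measure_itv/= lte_fin.
have [->|nab] := eqVneq a b; first by rewrite ltxx /= subrr.
by rewrite lt_neqAle nab ab /= .
Qed.

Lemma rcont_cst k a b : rcont_on (fun=> k) a b.
Proof. by move=> x _ e e0; exists 1 => // y _; rewrite subrr normr0 ltW. Qed.

Lemma le_rint h k a b : rcont_on h a b -> rcont_on k a b ->
  (forall x, a <= x <= b -> h x <= k x) -> rint h a b <= rint k a b.
Proof.
move=> ch ck hk; apply: le_Rintegral; [by []|exact: rcont_integrable|exact: rcont_integrable|].
by move=> x /=; rewrite in_itv /= => /hk.
Qed.

Lemma rint_split h a m b : a <= m -> m <= b -> rcont_on h a b ->
  rint h a b = rint h a m + rint h m b.
Proof.
move=> am mb ch; have := @Rintegral_itvB R h (BLeft a) (BRight b) m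
  (rcont_integrable ch).
rewrite !bnd_simp => /(_ am mb) E; apply/eqP; rewrite addrC -subr_eq; apply/eqP.
rewrite [LHS]E Rintegral_itv_obnd_cbnd//.
apply: integrableS (rcont_integrable ch) => //=.
by apply: subset_itvr; rewrite bnd_simp.
Qed.

Definition ccontR := @ccont R R (real_complex R) (fun=> 0).

Lemma ccontRP f x : ccontR f x <-> forall e : R, 0 < e -> exists2 d : R, 0 < d &
  forall y, `|y - x| < d -> cabs (f y - f x) <= e.
Proof.
by split=> H e e0; have [d d0 Hd] := H e e0; exists d => // y yx; apply: Hd;
  move: yx; rewrite /dist subr0 cabs0 addr0 -rmorphB cabs_real.
Qed.

Definition scont f a b := forall x, a <= x <= b -> ccontR f x.

Lemma scont_Re f a b : scont f a b -> rcont_on (fun x => complex.Re (f x)) a b.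
Proof.
move=> H x /H/ccontRP cf e e0; have [d d0 Hd] := cf _ e0; exists d => // y /Hd.
by apply: le_trans; have := cabs_Re (f y - f x); case: (f y) (f x) => ? ? [].
Qed.

Lemma scont_Im f a b : scont f a b -> rcont_on (fun x => complex.Im (f x)) a b.
Proof.
move=> H x /H/ccontRP cf e e0; have [d d0 Hd] := cf _ e0; exists d => // y /Hd.
by apply: le_trans; have := cabs_Im (f y - f x); case: (f y) (f x) => ? ? [].
Qed.

Lemma scont_cabs f a b : scont f a b -> rcont_on (fun x => cabs (f x)) a b.
Proof.
move=> H x /H/ccontRP cf e e0; have [d d0 Hd] := cf _ e0; exists d => // y /Hd.
apply: le_trans; rewrite ler_norml.
have := cabs_tri (f y) (f x) 0; have := cabs_tri (f x) (f y) 0.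
by rewrite !subr0 (cabsC (f x) (f y)); lra.
Qed.

Definition cint f a b : R[i] :=
  (rint (fun x => complex.Re (f x)) a b +i* rint (fun x => complex.Im (f x)) a b)%C.

Lemma cintD f g a b : scont f a b -> scont g a b ->
  cint (fun x => f x + g x) a b = cint f a b + cint g a b.
Proof.
move=> cf cg; rewrite /cint.
have E x : f x + g x = ((complex.Re (f x) + complex.Re (g x)) +i*
  (complex.Im (f x) + complex.Im (g x)))%C by case: (f x) (g x) => ? ? [].
under eq_fun do rewrite E /=.
under [in X in Complex _ X]eq_fun do rewrite E /=.
rewrite /rint !RintegralD//; apply: rcont_integrable;
  by [exact: scont_Re|exact: scont_Im].
Qed.

Lemma rintZ k h a b : rcont_on h a b -> rint (fun x => k * h x) a b = k * rint h a b.
Proof. by move=> ch; rewrite /rint RintegralZl//; exact: rcont_integrable. Qed.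

Lemma rintB h k a b : rcont_on h a b -> rcont_on k a b ->
  rint (fun x => h x - k x) a b = rint h a b - rint k a b.
Proof. by move=> ch ck; rewrite /rint RintegralB//; exact: rcont_integrable. Qed.

Lemma rintD h k a b : rcont_on h a b -> rcont_on k a b ->
  rint (fun x => h x + k x) a b = rint h a b + rint k a b.
Proof. by move=> ch ck; rewrite /rint RintegralD//; exact: rcont_integrable. Qed.

Lemma rcontZ k h a b : rcont_on h a b -> rcont_on (fun x => k * h x) a b.
Proof.
move=> H x /H ch e e0; have k0 : 0 < `|k| + 1 by rewrite ltr_wpDl.
have [d d0 Hd] := ch (e / (`|k| + 1)) (divr_gt0 e0 k0).
exists d => // y /Hd hy; rewrite -mulrBr normrM.
apply: (@le_trans _ _ ((`|k| + 1) * `|h y - h x|)).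
  by rewrite ler_wpM2r// lerDl.
by rewrite mulrC -ler_pdivlMr.
Qed.

Lemma scont_cst (k : R[i]) a b : scont (fun=> k) a b.
Proof. by move=> x _; exact: ccont_cst. Qed.

Lemma scontB f g a b : scont f a b -> scont g a b -> scont (fun x => f x - g x) a b.
Proof.
move=> cf cg x xab; apply: ccontD; first exact: cf.
rewrite [X in ccont _ _ X](_ : _ = fun x => -1 * g x); last first.
  by apply/funext => y; rewrite mulN1r.
by apply: (@ccontM _ _ _ _ (fun=> -1) g); [exact: ccont_cst|exact: cg].
Qed.

Lemma cintZ k f a b : scont f a b -> cint (fun x => k * f x) a b = k * cint f a b.
Proof.
move=> cf; rewrite /cint; case: k => k l.
have E x : (k +i* l)%C * f x = ((k * complex.Re (f x) - l * complex.Im (f x)) +i*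
  (k * complex.Im (f x) + l * complex.Re (f x)))%C by case: (f x).
under eq_fun do rewrite E /=.
under [in X in Complex _ X]eq_fun do rewrite E /=.
have cR := scont_Re cf; have cI := scont_Im cf.
by rewrite rintB ?rintD ?rintZ//; exact: rcontZ.
Qed.

Lemma cintB f g a b : scont f a b -> scont g a b ->
  cint (fun x => f x - g x) a b = cint f a b - cint g a b.
Proof.
move=> cf cg; under eq_fun do rewrite -mulN1r.
rewrite cintD ?cintZ ?mulN1r// => x xab.
by apply: (@ccontM _ _ _ _ (fun=> -1) g); [exact: ccont_cst|exact: cg].
Qed.

Lemma cint_cst k a b : a <= b -> cint (fun=> k) a b = k * ((b - a)%:C)%C.
Proof.
move=> ab; rewrite /cint !rint_cst//; case: k => k l /=.
by rewrite /GRing.mul /= !mulr0 subr0 add0r.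
Qed.

Lemma cint_split f a m b : a <= m -> m <= b -> scont f a b ->
  cint f a b = cint f a m + cint f m b.
Proof.
move=> am mb cf; rewrite /cint (rint_split am mb (scont_Re cf)).
by rewrite (rint_split am mb (scont_Im cf)).
Qed.

(** The factor 2 is the price of bounding the real and imaginary parts separately. *)
Lemma cint_le f (g : R -> R) a b : scont f a b -> rcont_on g a b ->
  (forall x, a <= x <= b -> cabs (f x) <= g x) ->
  cabs (cint f a b) <= 2 * rint g a b.
Proof.
move=> cf cg fg; rewrite (le_trans (cabs_ReIm _))//=.
suff H h : rcont_on h a b -> (forall x, a <= x <= b -> `|h x| <= cabs (f x)) ->
    `|rint h a b| <= rint g a b.
  rewrite mulrDl !mul1r lerD//; apply: H; by
    [exact: scont_Re|exact: scont_Im|move=> x _; exact: cabs_Re|move=> x _; exact: cabs_Im].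
move=> ch hf; rewrite ler_norml -(mulN1r (rint g _ _)) -rintZ//.
have hg x : a <= x <= b -> `|h x| <= g x.
  by move=> xab; rewrite (le_trans (hf _ xab))// fg.
apply/andP; split; apply: le_rint => //; try exact: rcontZ; move=> x /hg;
  by rewrite ler_norml ?mulN1r => /andP[].
Qed.

Lemma cint_ML f M a b : a <= b -> scont f a b ->
  (forall x, a <= x <= b -> cabs (f x) <= M) ->
  cabs (cint f a b) <= 2 * (M * (b - a)).
Proof.
move=> ab cf fM; rewrite -rint_cst//; apply: cint_le => //; exact: rcont_cst.
Qed.

End SegmentIntegral.

(** * Goursat's theorem and Cauchy's formula *)

Section Goursat.
Variable R : realType.
Implicit Types (f g : R[i] -> R[i]) (a b c d : R) (z : R[i]).
Local Open Scope complex_scope.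

Definition rect a b c d z := (a <= complex.Re z <= b) && (c <= complex.Im z <= d).

(** The counterclockwise integral of f dz: all sides are parametrized increasingly, whence the minus
    signs on the top and left sides, and dz = i dy on the vertical ones. *)
Definition oint f a b c d : R[i] :=
  cint (fun x => f (x +i* c)) a b - cint (fun x => f (x +i* d)) a b +
  'i * (cint (fun y => f (b +i* y)) c d - cint (fun y => f (a +i* y)) c d).

Lemma ccont_hor f c x : ccont1 f (x +i* c) -> ccontR (fun x => f (x +i* c)) x.
Proof.
move=> cf; apply/ccontRP => e e0; have [d d0 Hd] := cf _ e0.
exists d => // y yx; apply: Hd; rewrite dist1E.
have -> : (y +i* c) - (x +i* c) = (y - x)%:C by simpc.
by rewrite cabs_real.
Qed.

Lemma ccont_ver f c y : ccont1 f (c +i* y) -> ccontR (fun y => f (c +i* y)) y.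
Proof.
move=> cf; apply/ccontRP => e e0; have [d d0 Hd] := cf _ e0.
exists d => // x xy; apply: Hd; rewrite dist1E.
have -> : (c +i* x) - (c +i* y) = 0 +i* (x - y) by simpc.
by rewrite cabsE /= expr0n add0r sqrtr_sqr.
Qed.

(* continuity on the boundary of the rectangle *)
Definition bcont f a b c d := [/\ scont (fun x => f (x +i* c)) a b,
  scont (fun x => f (x +i* d)) a b, scont (fun y => f (b +i* y)) c d &
  scont (fun y => f (a +i* y)) c d].

Lemma rect_bcont f a b c d : a <= b -> c <= d ->
  (forall z, rect a b c d z -> ccont1 f z) -> bcont f a b c d.
Proof.
move=> ab cd H; split=> x /andP[h1 h2]; first [apply: ccont_hor|apply: ccont_ver];
  by apply: H; rewrite /rect /= h1 h2 ?lexx ?ab ?cd.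
Qed.

Lemma oint_hsplit f a m b c d : a <= m -> m <= b -> bcont f a b c d ->
  oint f a b c d = oint f a m c d + oint f m b c d.
Proof.
move=> am mb [h1 h2 _ _]; rewrite /oint (cint_split am mb h1) (cint_split am mb h2).
ring.
Qed.

Lemma oint_vsplit f a b c m d : c <= m -> m <= d -> bcont f a b c d ->
  oint f a b c d = oint f a b c m + oint f a b m d.
Proof.
move=> am mb [_ _ h1 h2]; rewrite /oint (cint_split am mb h1) (cint_split am mb h2).
ring.
Qed.

Lemma ointB f g a b c d : bcont f a b c d -> bcont g a b c d ->
  oint (fun z => f z - g z) a b c d = oint f a b c d - oint g a b c d.
Proof.
move=> [? ? ? ?] [? ? ? ?]; rewrite /oint !cintB//; ring.
Qed.

Lemma ointZ k f a b c d : bcont f a b c d ->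
  oint (fun z => k * f z) a b c d = k * oint f a b c d.
Proof. by move=> [? ? ? ?]; rewrite /oint !cintZ//; ring. Qed.

Lemma cabs_i : cabs ('i : R[i]) = 1.
Proof. by rewrite cabsE /= expr0n add0r expr1n sqrtr1. Qed.

Lemma oint_le f a b c d B1 B2 B3 B4 :
  cabs (cint (fun x => f (x +i* c)) a b) <= B1 ->
  cabs (cint (fun x => f (x +i* d)) a b) <= B2 ->
  cabs (cint (fun y => f (b +i* y)) c d) <= B3 ->
  cabs (cint (fun y => f (a +i* y)) c d) <= B4 ->
  cabs (oint f a b c d) <= B1 + B2 + B3 + B4.
Proof.
move=> h1 h2 h3 h4; rewrite /oint (le_trans (cabsD _ _))// -(addrA (B1 + B2)) lerD//.
  by rewrite (le_trans (cabsB _ _))// lerD.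
by rewrite cabsM cabs_i mul1r (le_trans (cabsB _ _))// lerD.
Qed.

Lemma oint_ML f M a b c d : a <= b -> c <= d -> bcont f a b c d ->
  (forall x, a <= x <= b -> cabs (f (x +i* c)) <= M /\ cabs (f (x +i* d)) <= M) ->
  (forall y, c <= y <= d -> cabs (f (a +i* y)) <= M /\ cabs (f (b +i* y)) <= M) ->
  cabs (oint f a b c d) <= 4 * (M * (b - a)) + 4 * (M * (d - c)).
Proof.
move=> ab cd [? ? ? ?] H1 H2.
have -> : 4 * (M * (b - a)) + 4 * (M * (d - c)) = 2 * (M * (b - a)) +
  2 * (M * (b - a)) + 2 * (M * (d - c)) + 2 * (M * (d - c)) by ring.
by apply: oint_le; apply: cint_ML => // x; by [case/H1|case/H2].
Qed.

(** Opposite sides are paired: the difference of A + B z across a pair is constant, the two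
    constants cancel in the contour integral, and only the error of the approximation is left to
    estimate. *)
Lemma oint_affine_approx f a b c d (A B : R[i]) (M : R) : a <= b -> c <= d ->
  (forall z, rect a b c d z -> ccont1 f z) ->
  (forall z, rect a b c d z -> cabs (f z - (A + B * z)) <= M) ->
  cabs (oint f a b c d) <= 4 * M * ((b - a) + (d - c)).
Proof.
move=> ab cd cf H; have [s1 s2 s3 s4] := rect_bcont ab cd cf.
have E : oint f a b c d =
    cint (fun x => (f (x +i* c) - f (x +i* d)) - B * (0 +i* (c - d))) a b +
    'i * cint (fun y => (f (b +i* y) - f (a +i* y)) - B * (b - a)%:C) c d.
  rewrite (cintB (scontB s1 s2) (@scont_cst _ _ _ _)) (cintB (scontB s3 s4) (@scont_cst _ _ _ _)).
  rewrite !cintB// !cint_cst// /oint.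
  suff : B * (0 +i* (c - d)) * (b - a)%:C + 'i * (B * (b - a)%:C * (d - c)%:C) = 0.
    by move=> E; rewrite (mulrBr 'i _ (B * _ * _)) [RHS]addrACA -opprD E subr0.
  rewrite mulrCA -!mulrA -mulrDr; apply/eqP; rewrite mulf_eq0; apply/orP; right.
  by rewrite eq_complex /=; apply/andP; split; apply/eqP; ring.
rewrite E.
have -> : 4 * M * (b - a + (d - c)) = 2 * (2 * M * (b - a)) + 2 * (2 * M * (d - c)).
  by ring.
rewrite (le_trans (cabsD _ _))// lerD ?cabsM ?cabs_i ?mul1r//.
  apply: cint_ML => //; first exact: (scontB (scontB s1 s2) (@scont_cst _ _ _ _)).
  move=> x /andP[ax xb].
  have -> : f (x +i* c) - f (x +i* d) - B * (0 +i* (c - d)) =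
      (f (x +i* c) - (A + B * (x +i* c))) - (f (x +i* d) - (A + B * (x +i* d))).
    have -> : 0 +i* (c - d) = (x +i* c) - (x +i* d) by simpc.
    by ring.
  rewrite (le_trans (cabsB _ _))// mulrDl !mul1r.
  by apply: lerD; apply: H; rewrite /rect /= ax xb !lexx cd.
apply: cint_ML => //; first exact: (scontB (scontB s3 s4) (@scont_cst _ _ _ _)).
move=> y /andP[cy yd].
have -> : f (b +i* y) - f (a +i* y) - B * (b - a)%:C =
    (f (b +i* y) - (A + B * (b +i* y))) - (f (a +i* y) - (A + B * (a +i* y))).
  have -> : (b - a)%:C = (b +i* y) - (a +i* y) by simpc.
  by ring.
rewrite (le_trans (cabsB _ _))// mulrDl !mul1r.
by apply: lerD; apply: H; rewrite /rect /= cy yd !lexx ab.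
Qed.

Record rectangle := Rectangle { lft : R; rgt : R; bot : R; top : R }.

Definition rin (r : rectangle) := rect (lft r) (rgt r) (bot r) (top r).
Definition semiper r := (rgt r - lft r) + (top r - bot r).
Definition oin f r := oint f (lft r) (rgt r) (bot r) (top r).
Definition wf r := lft r <= rgt r /\ bot r <= top r.

Definition half_of (r s : rectangle) := [/\ wf s, lft r <= lft s, rgt s <= rgt r,
  bot r <= bot s & top s <= top r] /\ semiper s = semiper r / 2.

(** Halving the semiperimeter divides [e * semiper r ^+ 2] by 4, so if all four quarters violated
    the strict inequality, their sum would too. *)
Lemma rect_quarter f r e : wf r -> (forall z, rin r z -> ccont1 f z) ->
  e * semiper r ^+ 2 < cabs (oin f r) ->
  exists2 s, half_of r s & e * semiper s ^+ 2 < cabs (oin f s).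
Proof.
case: r => a b c d [/= ab cd]; rewrite /rin /semiper /oin /= => cf H.
set m := (a + b) / 2; set n := (c + d) / 2.
have am : a <= m by rewrite /m; lra.
have mb : m <= b by rewrite /m; lra.
have cn : c <= n by rewrite /n; lra.
have nd : n <= d by rewrite /n; lra.
apply: contrapT => K.
have small s : half_of (Rectangle a b c d) s ->
    cabs (oin f s) <= e * (semiper s) ^+ 2.
  by move=> hs; rewrite leNgt; apply/negP => es; apply: K; exists s.
have bc a' b' c' d' : a <= a' -> a' <= b' -> b' <= b -> c <= c' -> c' <= d' ->
    d' <= d -> bcont f a' b' c' d'.
  move=> h1 h2 h3 h4 h5 h6; apply: rect_bcont => // z /andP[/andP[k1 k2] /andP[k3 k4]].
  by apply: cf; apply/andP; split; apply/andP; split; lra.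
have ea : b - m = (b - a) / 2 by rewrite /m; lra.
have eb : m - a = (b - a) / 2 by rewrite /m; lra.
have ec : d - n = (d - c) / 2 by rewrite /n; lra.
have ed : n - c = (d - c) / 2 by rewrite /n; lra.
have h s : wf s -> a <= lft s -> rgt s <= b -> c <= bot s -> top s <= d ->
    rgt s - lft s = (b - a) / 2 -> top s - bot s = (d - c) / 2 ->
    cabs (oin f s) <= e * ((b - a + (d - c)) / 2) ^+ 2.
  move=> w h1 h2 h3 h4 h5 h6.
  have E : semiper s = (b - a + (d - c)) / 2 by rewrite /semiper h5 h6 -mulrDl.
  by rewrite -E; apply: small; split; [split|exact: E].
have := h (Rectangle a m c n) (conj am cn) (lexx _) mb (lexx _) nd eb ed.
have := h (Rectangle a m n d) (conj am nd) (lexx _) mb cn (lexx _) eb ec.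
have := h (Rectangle m b c n) (conj mb cn) am (lexx _) (lexx _) nd ea ed.
have := h (Rectangle m b n d) (conj mb nd) am (lexx _) cn (lexx _) ea ec.
rewrite /oin /= => h1 h2 h3 h4; move: H; apply/negP; rewrite -leNgt.
rewrite (oint_hsplit am mb (bc _ _ _ _ (lexx _) ab (lexx _) (lexx _) cd (lexx _))).
rewrite (oint_vsplit cn nd (bc _ _ _ _ (lexx _) am mb (lexx _) cd (lexx _))).
rewrite (oint_vsplit cn nd (bc _ _ _ _ am mb (lexx _) (lexx _) cd (lexx _))).
rewrite (le_trans (cabsD _ _))// (le_trans (lerD (cabsD _ _) (cabsD _ _)))//.
have -> : e * (b - a + (d - c)) ^+ 2 = 4 * (e * ((b - a + (d - c)) / 2) ^+ 2).
  by field.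
by rewrite -[4]/(2 + 2)%:R natrD mulrDl mulrDl mul1r !lerD.
Qed.

Lemma goursat f a b c d : a <= b -> c <= d ->
  (forall z, rect a b c d z -> hol1 f z) -> oint f a b c d = 0.
Proof.
move=> ab cd hf.
have cf z : rect a b c d z -> ccont1 f z by move=> zr; apply: hol_ccont (hf _ zr).
apply/eqP; rewrite -cabs_eq0; apply: contrapT => /negP n0.
pose r0 := Rectangle a b c d.
set S := semiper r0.
have S0 : 0 <= S by rewrite /S /semiper /=; lra.
have o0 : 0 < cabs (oin f r0) by rewrite lt_def n0 cabs_ge0.
(* The [+ 1] keeps the denominator positive for a degenerate rectangle and makes the initial
   inequality strict. *)
set e := cabs (oin f r0) / (S ^+ 2 + 1).
have e0 : 0 < e by rewrite divr_gt0// ltr_wpDl ?sqr_ge0.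
have He : e * S ^+ 2 < cabs (oin f r0).
  by rewrite /e mulrAC ltr_pdivrMr ?ltr_wpDl ?sqr_ge0// ltr_pM2l// ltrDl.
pose K r := [/\ wf r, lft r0 <= lft r, rgt r <= rgt r0, bot r0 <= bot r &
  top r <= top r0] /\ e * semiper r ^+ 2 < cabs (oin f r).
have K0 : K r0 by split => //; split.
have step r : exists s, K r -> half_of r s /\ K s.
  have [kr|nk] := pselect (K r); last by exists r.
  case: (kr) => -[wr l1 l2 l3 l4] hr.
  have cfr z : rin r z -> ccont1 f z.
    move=> /andP[/andP[k1 k2] /andP[k3 k4]]; apply: cf.
    move: l1 l2 l3 l4 => /= l1 l2 l3 l4.
    by move: k1 k2 k3 k4 l1 l2 l3 l4; clear => *; apply/andP; split; apply/andP; split; lra.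
  have [s hs es] := rect_quarter wr cfr hr; exists s => _; split => //.
  case: hs => -[ws m1 m2 m3 m4] _; split => //; split => //.
  - exact: le_trans l1 m1.
  - exact: le_trans m2 l2.
  - exact: le_trans l3 m3.
  - exact: le_trans m4 l4.
have [nx Hnx] := choice step.
pose r n := iter n nx r0.
have Kr n : K (r n) by elim: n => // n IH; have [] := Hnx _ IH.
have hr n : half_of (r n) (r n.+1) by have [] := Hnx _ (Kr n).
have wr n : wf (r n) by have [[]] := Kr n.
have nest n m : (n <= m)%N -> [/\ lft (r n) <= lft (r m), rgt (r m) <= rgt (r n),
    bot (r n) <= bot (r m) & top (r m) <= top (r n)].
  move=> /subnK <-; elim: (m - n)%N => [|j [i1 i2 i3 i4]]; first by rewrite add0n.
  have [[_ j1 j2 j3 j4] _] := hr (j + n)%N; rewrite addSn; split.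
  - exact: le_trans i1 j1.
  - exact: le_trans j2 i2.
  - exact: le_trans i3 j3.
  - exact: le_trans j4 i4.
have cross n m : lft (r n) <= rgt (r m) /\ bot (r n) <= top (r m).
  have [i1 i2 i3 i4] := nest _ _ (leq_maxl n m).
  have [j1 j2 j3 j4] := nest _ _ (leq_maxr n m).
  have [w1 w2] := wr (maxn n m); split.
    exact: le_trans (le_trans i1 w1) j2.
  exact: le_trans (le_trans i3 w2) j4.
have supP (u v : rectangle -> R) : (forall n m, u (r n) <= v (r m)) ->
    forall n, u (r n) <= sup (range (u \o r)) <= v (r n).
  move=> uv n.
  have hs : has_sup (range (u \o r)).
    split; first by exists (u (r 0%N)), 0%N.
    by exists (v (r 0%N)) => _ [m _ <-]; exact: uv.
  apply/andP; split; first by apply: ub_le_sup; [case: hs|exists n].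
  by apply: ge_sup; [case: hs|move=> _ [m _ <-] /=].
(* The common point of the nested rectangles: the supremum of their lower left corners, which
   [cross] keeps below every upper right corner. *)
pose p := sup (range (lft \o r)) +i* sup (range (bot \o r)).
have pr n : rin (r n) p.
  rewrite /rin /rect /= (supP lft rgt) ?(supP bot top)//.
    by move=> k l; have [] := cross k l.
  by move=> k l; have [] := cross k l.
have [A [A2 HA]] := hf p (pr 0%N).
(* The constant 4 of [oint_affine_approx] times e / 5 stays below e. *)
have e50 : 0 < e / 5 by rewrite divr_gt0.
have [del del0 Hdel] := HA _ e50.
have semi n : semiper (r n) = S / 2 ^+ n.
  elim: n => [|n IH]; first by rewrite expr0 divr1.
  by have [_ ->] := hr n; rewrite IH exprSr invfM mulrA.
have [n Hn] : exists n, S / 2 ^+ n < del.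
  exists (Num.bound (S / del)).
  rewrite ltr_pdivrMr ?exprn_gt0// mulrC -ltr_pdivrMr//.
  exact: upper_nthrootP.
have [[wn l1 l2 l3 l4]] := (Kr n); apply/negP; rewrite -leNgt.
have dz z : rin (r n) z -> cabs (z - p) <= semiper (r n).
  move: (pr n) => /andP[/andP[k1 k2] /andP[k3 k4]] /andP[/andP[m1 m2] /andP[m3 m4]].
  rewrite (le_trans (cabs_ReIm _))// /semiper.
  have -> : complex.Re (z - p) = complex.Re z - complex.Re p by case: (z) (p) => ? ? [].
  have -> : complex.Im (z - p) = complex.Im z - complex.Im p by case: (z) (p) => ? ? [].
  move: k1 k2 k3 k4 m1 m2 m3 m4 l1 l2 l3 l4; clear => *.
  by rewrite lerD// ler_norml; apply/andP; split; lra.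
case: wn => wn1 wn2.
apply: (@le_trans _ _ (4 * (e / 5 * semiper (r n)) * semiper (r n))); last first.
  have := mulr_ge0 (ltW e0) (sqr_ge0 (semiper (r n))).
  have -> : 4 * (e / 5 * semiper (r n)) * semiper (r n) =
    4 / 5 * (e * semiper (r n) ^+ 2) by field.
  by move: (e * _) => E; lra.
apply: (@oint_affine_approx _ _ _ _ _ (f p - A * p) A) => // z zr.
  apply: cf; move: zr => /andP[/andP[k1 k2] /andP[k3 k4]].
  move: l1 l2 l3 l4 => /= l1 l2 l3 l4.
  by move: k1 k2 k3 k4 l1 l2 l3 l4; clear => *; apply/andP; split; apply/andP; split; lra.
have -> : f z - (f p - A * p + A * z) = f z - f p - A * (z - p) - A2 * (0 - 0) by ring.
have dzn : dist1 p z < del by rewrite dist1E (le_lt_trans (dz _ zr))// semi.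
rewrite (le_trans (Hdel _ dzn))// ler_wpM2l ?(ltW e50)// dist1E; exact: dz.
Qed.

Lemma oint_annulus f (p : R[i]) a b c d x0 x1 y0 y1 :
  a <= x0 -> x0 < complex.Re p < x1 -> x1 <= b ->
  c <= y0 -> y0 < complex.Im p < y1 -> y1 <= d ->
  (forall z, rect a b c d z -> z != p -> hol1 f z) ->
  oint f a b c d = oint f x0 x1 y0 y1.
Proof.
move=> ax /andP[xp px] xb cy /andP[yp py] yd hf.
have E (z : R[i]) : complex.Re z != complex.Re p \/ complex.Im z != complex.Im p -> z != p.
  by move=> H; rewrite eq_complex negb_and; apply/orP.
have hf' z : rect a b c d z ->
    complex.Re z != complex.Re p \/ complex.Im z != complex.Im p -> hol1 f z.
  by move=> zr /E; exact: hf.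
have G a' b' c' d' : a <= a' -> a' <= b' -> b' <= b -> c <= c' -> c' <= d' -> d' <= d ->
    (b' < complex.Re p \/ complex.Re p < a') \/ (d' < complex.Im p \/ complex.Im p < c') ->
    oint f a' b' c' d' = 0.
  move=> h1 h2 h3 h4 h5 h6 H; apply: goursat => // z /andP[/andP[k1 k2] /andP[k3 k4]].
  apply: hf'; first by apply/andP; split; apply/andP; split; lra.
  case: H => [H|H]; [left|right]; apply/eqP => Ez; move: H; rewrite -Ez => -[]; lra.
have B a' b' c' d' : a <= a' -> a' <= b' -> b' <= b -> c <= c' -> c' <= d' -> d' <= d ->
    a' < complex.Re p < b' -> c' < complex.Im p < d' -> bcont f a' b' c' d'.
  move=> h1 h2 h3 h4 h5 h6 /andP[q1 q2] /andP[q3 q4].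
  split=> x /andP[k1 k2]; first [apply: ccont_hor|apply: ccont_ver];
    apply: hol_ccont; apply: hf'; rewrite ?/rect /=;
    move: h1 h2 h3 h4 h5 h6 q1 q2 q3 q4 k1 k2; clear => *;
    try (by apply/andP; split; apply/andP; split; lra);
    by [right; apply/eqP; lra|left; apply/eqP; lra].
have o1 : x0 <= x1 by lra.
have o2 : y0 <= y1 by lra.
have o3 : a <= b by lra.
have o4 : c <= d by lra.
have o5 : x0 <= b by lra.
have o6 : y0 <= d by lra.
have o7 : a <= x1 by lra.
have o8 : c <= y1 by lra.
have p1 : a < complex.Re p < b by lra.
have p2 : c < complex.Im p < d by lra.
have p3 : x0 < complex.Re p < b by lra.
have p4 : x0 < complex.Re p < x1 by lra.
have p5 : y0 < complex.Im p < d by lra.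
rewrite (oint_hsplit ax o5)//; last by apply: B => //; lra.
rewrite G//; last by left; left.
rewrite add0r (oint_hsplit o1 xb)//; last by apply: B => //; lra.
rewrite [X in _ + X]G//; last by left; right.
rewrite addr0 (oint_vsplit cy o6)//; last by apply: B => //; lra.
rewrite G//; last by right; left.
rewrite add0r (oint_vsplit o2 yd)//; last by apply: B => //; lra.
by rewrite [X in _ + X]G ?addr0//; right; right.
Qed.

Lemma hol1_id z : hol1 (fun z => z) z.
Proof. exact: (@hol_c1 R R[i] idfun (fun=> 0) z). Qed.

Lemma hol1_subV z p : z != p -> hol1 (fun w => (w - p)^-1) z.
Proof.
move=> zp; apply: holV; first by rewrite subr_eq0.
by apply: holB; [exact: hol1_id|exact: hol_cst].
Qed.

(** Only the order of magnitude of 2 pi i is extracted. On a square of half side e centred at p,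
    each side contributes to the imaginary part an integral of e / (t^2 + e^2), at least 1 / (2 e)
    over a length 2 e, hence at least 1. The upper bound is the trivial estimate with |z - p| at
    least e. *)
Lemma oint_subV_lower a b c d (p : R[i]) : a < complex.Re p < b ->
  c < complex.Im p < d -> 4 <= cabs (oint (fun z => (z - p)^-1) a b c d) <= 16.
Proof.
case: p => x0 y0 /= /andP[ax xb] /andP[cy yd].
set e := Num.min (Num.min (x0 - a) (b - x0)) (Num.min (y0 - c) (d - y0)).
have e0 : 0 < e by rewrite !lt_min !subr_gt0 ax xb cy yd.
have [e1 e2 e3 e4] : [/\ e <= x0 - a, e <= b - x0, e <= y0 - c & e <= d - y0].
  by split; rewrite !ge_min lexx ?orbT.
rewrite (@oint_annulus _ (x0 +i* y0) a b c d (x0 - e) (x0 + e) (y0 - e) (y0 + e)) /=;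
  try lra; last by move=> z _ zp; exact: hol1_subV.
set f := fun z : R[i] => _.
have cf z : z != x0 +i* y0 -> ccont1 f z by move=> zp; apply/hol_ccont/hol1_subV.
have [s1 s2 s3 s4] : bcont f (x0 - e) (x0 + e) (y0 - e) (y0 + e).
  by split=> x _; first [apply: ccont_hor|apply: ccont_ver]; apply: cf;
    rewrite eq_complex /= negb_and; apply/orP; by [right; apply/eqP; lra|left; apply/eqP; lra].
have fE x y : f (x +i* y) = ((x - x0) / ((x - x0) ^+ 2 + (y - y0) ^+ 2)) -i*
    ((y - y0) / ((x - x0) ^+ 2 + (y - y0) ^+ 2)) by [].
have fN x y : cabs (f (x +i* y)) = (Num.sqrt ((x - x0) ^+ 2 + (y - y0) ^+ 2))^-1.
  by rewrite /f cabsV cabsE.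
have le_half (t : R) : x0 - e <= t + x0 <= x0 + e -> t ^+ 2 <= e ^+ 2.
  by move=> /andP[h1 h2]; rewrite -ler_sqrt ?sqr_ge0// !sqrtr_sqr (gtr0_norm e0) ler_norml; lra.
have bd (t : R) : - e <= t <= e -> 1 / (2 * e) <= e / (t ^+ 2 + e ^+ 2).
  move=> /andP[h1 h2].
  have te : t ^+ 2 <= e ^+ 2 by apply: le_half; lra.
  have p0 : 0 < t ^+ 2 + e ^+ 2 by rewrite ltr_wpDl ?sqr_ge0 ?exprn_gt0.
  by rewrite ler_pdivlMr// mulrC mulrA ler_pdivrMr ?mulr_gt0//; lra.
apply/andP; split; last first.
  apply: (@le_trans _ _ (4 * (e^-1 * (x0 + e - (x0 - e))) + 4 * (e^-1 * (y0 + e - (y0 - e))))).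
    have sq (t : R) : (Num.sqrt (t ^+ 2 + e ^+ 2))^-1 <= e^-1.
      rewrite lef_pV2 ?posrE ?sqrtr_gt0 ?ltr_wpDl ?sqr_ge0 ?exprn_gt0//.
      by rewrite -[leLHS](gtr0_norm e0) -sqrtr_sqr ler_sqrt ?ltr_wpDl ?sqr_ge0 ?exprn_gt0 ?addr_ge0 ?sqr_ge0// lerDr sqr_ge0.
    apply: oint_ML => //; try lra; move=> x xe; rewrite !fN.
      have -> : y0 - e - y0 = - e by ring.
      have -> : y0 + e - y0 = e by ring.
      by rewrite sqrrN; split; exact: sq.
    have -> : x0 - e - x0 = - e by ring.
    have -> : x0 + e - x0 = e by ring.
    by rewrite sqrrN addrC; split; exact: sq.
  have -> : x0 + e - (x0 - e) = 2 * e by ring.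
  have -> : y0 + e - (y0 - e) = 2 * e by ring.
  have -> : e^-1 * (2 * e) = 2 by field; rewrite gt_eqF.
  by lra.
have key : 4 <= complex.Im (oint f (x0 - e) (x0 + e) (y0 - e) (y0 + e)).
  have r1 h u : rcont_on h (u - e) (u + e) ->
      (forall x, u - e <= x <= u + e -> 1 / (2 * e) <= h x) -> 1 <= rint h (u - e) (u + e).
    move=> ch H; have -> : 1 = rint (fun=> 1 / (2 * e)) (u - e) (u + e).
      by rewrite rint_cst; [field; rewrite gt_eqF|lra].
    by apply: le_rint => //; exact: rcont_cst.
  have h1 : 1 <= rint (fun x => complex.Im (f (x +i* (y0 - e)))) (x0 - e) (x0 + e).
    apply: r1; first exact: scont_Im.
    move=> x xe; rewrite fE /=.
    have -> : y0 - e - y0 = - e by ring.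
    by rewrite mulNr opprK sqrrN; apply: bd; lra.
  have h2 : rint (fun x => complex.Im (f (x +i* (y0 + e)))) (x0 - e) (x0 + e) <= - 1.
    rewrite -lerN2 opprK -mulN1r -rintZ; last exact: scont_Im.
    apply: r1; first by apply/rcontZ/scont_Im.
    move=> x xe; rewrite fE /=.
    have -> : y0 + e - y0 = e by ring.
    by rewrite mulN1r opprK; apply: bd; lra.
  have h3 : 1 <= rint (fun y => complex.Re (f ((x0 + e) +i* y))) (y0 - e) (y0 + e).
    apply: r1; first exact: scont_Re.
    move=> x xe; rewrite fE /=.
    have -> : x0 + e - x0 = e by ring.
    by rewrite addrC; apply: bd; lra.
  have h4 : rint (fun y => complex.Re (f ((x0 - e) +i* y))) (y0 - e) (y0 + e) <= - 1.
    rewrite -lerN2 opprK -mulN1r -rintZ; last exact: scont_Re.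
    apply: r1; first by apply/rcontZ/scont_Re.
    move=> x xe; rewrite fE /=.
    have -> : x0 - e - x0 = - e by ring.
    by rewrite mulN1r mulNr opprK sqrrN addrC; apply: bd; lra.
  by rewrite /oint /cint /=; lra.
by rewrite (le_trans key)// (le_trans (ler_norm _))// cabs_Im.
Qed.

(** The size e of the square is fixed before M, so M may be of the order 1 / e: a singularity where
    (z - p) f(z) tends to 0 contributes nothing in the limit. *)
Lemma oint_shrink f (p : R[i]) a b c d (del : R) : a < complex.Re p < b ->
  c < complex.Im p < d -> (forall z, rect a b c d z -> z != p -> hol1 f z) ->
  0 < del -> exists2 e : R, 0 < e <= del & forall M,
  (forall z, rect a b c d z -> e <= cabs (z - p) <= 2 * e -> cabs (f z) <= M) ->
  cabs (oint f a b c d) <= 16 * (M * e).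
Proof.
case: p => x0 y0 /= /andP[ax xb] /andP[cy yd] hf del0.
set e := Num.min del (Num.min (Num.min (x0 - a) (b - x0)) (Num.min (y0 - c) (d - y0))).
have e0 : 0 < e by rewrite !lt_min !subr_gt0 ax xb cy yd del0.
have [e1 e2 e3 e4] : [/\ e <= x0 - a, e <= b - x0, e <= y0 - c & e <= d - y0].
  by split; rewrite !ge_min lexx ?orbT.
exists e; first by rewrite e0 ge_min lexx.
move=> M HM.
rewrite (@oint_annulus _ (x0 +i* y0) a b c d (x0 - e) (x0 + e) (y0 - e) (y0 + e)) /=;
  try lra; last by [].
have cf z : rect a b c d z -> z != x0 +i* y0 -> ccont1 f z.
  by move=> zr zp; apply/hol_ccont/hf.
have bc : bcont f (x0 - e) (x0 + e) (y0 - e) (y0 + e).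
  split=> x /andP[h1 h2]; first [apply: ccont_hor|apply: ccont_ver]; apply: cf;
    move: h1 h2 e0 e1 e2 e3 e4; clear => *;
    try (by apply/andP => /=; split; apply/andP; split; lra);
    rewrite eq_complex /= negb_and; apply/orP; by [right; apply/eqP; lra|left; apply/eqP; lra].
have -> : 16 * (M * e) = 4 * (M * (x0 + e - (x0 - e))) + 4 * (M * (y0 + e - (y0 - e))).
  by ring.
have bd (u v : R) : `|u| <= e -> `|v| <= e -> e <= `|u| \/ e <= `|v| ->
    e <= cabs (u +i* v) <= 2 * e.
  move=> h1 h2 h3; apply/andP; split.
    by case: h3 => /le_trans; apply; [exact: (cabs_Re (u +i* v))|exact: (cabs_Im (u +i* v))].
  by rewrite (le_trans (cabs_ReIm _))//=; lra.
have E (x y : R) : (x +i* y) - (x0 +i* y0) = (x - x0) +i* (y - y0) by simpc.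
apply: oint_ML => //; try (by move: e0; clear; lra); move=> x /andP[h1 h2]; split; apply: HM;
  try (by move: h1 h2 e0 e1 e2 e3 e4; clear => *; apply/andP => /=; split; apply/andP; split; lra);
  rewrite E; apply: bd;
  move: h1 h2 e0; clear; rewrite ?ler_norml ?ler_normr => h1 h2 e0;
  (try by lra); by [right; lra|left; lra].
Qed.

(** Over a square of size r around p, the integral of (f z - f p) / (z - p) is at most a constant
    times the supremum of |f - f p|, which tends to 0 by continuity, while excision makes it
    independent of r. *)
Lemma cauchy_formula f (p : R[i]) a b c d : a < complex.Re p < b -> c < complex.Im p < d ->
  (forall z, rect a b c d z -> hol1 f z) ->
  oint (fun z => f z / (z - p)) a b c d = f p * oint (fun z => (z - p)^-1) a b c d.
Proof.
move=> pa pc hf.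
have pr : rect a b c d p.
  by apply/andP; split; [case/andP: pa|case/andP: pc] => *; apply/andP; split; exact: ltW.
pose g z := f z / (z - p) - f p * (z - p)^-1.
have hV z : z != p -> hol1 (fun z => (z - p)^-1) z by exact: hol1_subV.
have h1 z : rect a b c d z -> z != p -> hol1 (fun z => f z / (z - p)) z.
  by move=> zr zp; apply: holM; [exact: hf|exact: hV].
have h2 z : z != p -> hol1 (fun z => f p * (z - p)^-1) z.
  by move=> zp; apply: holM; [exact: hol_cst|exact: hV].
have hg z : rect a b c d z -> z != p -> hol1 g z.
  by move=> zr zp; apply: holB; [exact: h1|exact: h2].
have bc (k : R[i] -> R[i]) : (forall z, rect a b c d z -> z != p -> hol1 k z) -> bcont k a b c d.
  move=> hk; move/andP: pa => [pa1 pa2]; move/andP: pc => [pc1 pc2].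
  split=> x /andP[k1 k2]; first [apply: ccont_hor|apply: ccont_ver];
    apply: hol_ccont; apply: hk;
    try (by apply/andP => /=; split; apply/andP; split; lra);
    rewrite eq_complex /= negb_and; apply/orP;
    by [right; apply/eqP; lra|left; apply/eqP; lra].
apply/eqP; rewrite -subr_eq0 -ointZ; last by apply: bc => z _; exact: hV.
rewrite -ointB; [|exact: bc|by apply: bc => z _; exact: h2].
rewrite -cabs_eq0 eq_le cabs_ge0 andbT; apply/ler_addgt0Pr => e e0; rewrite add0r.
have e160 : 0 < e / 16 by rewrite divr_gt0.
have [del del0 Hdel] := hol_ccont (hf _ pr) e160.
have [r /andP[r0 rdel] Hr] := oint_shrink pa pc hg (divr_gt0 del0 (ltr0n _ 3)).
have -> : e = 16 * (e / 16 / r * r) by rewrite divfK ?gt_eqF//; field.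
apply: Hr => z zr /andP[z1 z2].
have zp : 0 < cabs (z - p) by rewrite (lt_le_trans r0).
rewrite /g -mulrBl cabs_div ler_pdivrMr//.
apply: (@le_trans _ _ (e / 16)).
  by apply: Hdel; rewrite dist1E (le_lt_trans z2)//; lra.
by rewrite mulrAC ler_pdivlMr// ler_wpM2l ?(ltW e160).
Qed.

Lemma cauchy_le f (p : R[i]) a b c d : a < complex.Re p < b -> c < complex.Im p < d ->
  (forall z, rect a b c d z -> hol1 f z) ->
  4 * cabs (f p) <= cabs (oint (fun z => f z / (z - p)) a b c d).
Proof.
move=> pa pc hf; rewrite cauchy_formula// cabsM mulrC ler_wpM2l ?cabs_ge0//.
by case/andP: (oint_subV_lower pa pc).
Qed.

End Goursat.

(** * Measurability of continuous functions *)

Section ContinuousMeasurable.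
Variable R : realType.

(** The preimage of a ray is the union of those sets [B i] on which f stays in the ray, and the
    index type is countable. *)
Lemma base_measurable_fun d (T : measurableType d) (I : countType) (B : I -> set T)
    (D : set T) (f : T -> R) : measurable D -> (forall i, measurable (B i)) ->
  (forall x (e : R), D x -> 0 < e -> exists i, B i x /\
    forall y, D y -> B i y -> `|f y - f x| < e) ->
  measurable_fun D f.
Proof.
move=> mD mB H; apply: (measurability _ (RGenOInfty.measurableE R)) => //.
move=> _ [_ [a ->] <-].
pose P i := forall y, D y -> B i y -> a < f y.
pose U n := if @unpickle I n is Some i then (if `[< P i >] then B i else set0) else set0.
have -> : D `&` f @^-1` `]a, +oo[ = D `&` \bigcup_n U n.
  apply/seteqP; split => x [Dx]; rewrite /= ?in_itv/= ?andbT.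
    move=> ax; split => //; have fa : 0 < f x - a by rewrite subr_gt0.
    have [i [Bx Hi]] := H _ _ Dx fa.
    exists (pickle i) => //; rewrite /U pickleK.
    rewrite asboolT// => y Dy By; have := Hi _ Dy By; rewrite ltr_norml; lra.
  case=> n _; rewrite /U; case: unpickle => // i.
  by case: asboolP => // Pi Bx; split => //; exact: Pi.
apply: measurableI => //; apply: bigcupT_measurable => n; rewrite /U.
case: unpickle => // i; case: asboolP => // _; exact: mB.
Qed.

Local Notation mR := (measurableTypeR R).

Definition box2 (i : rat * rat * rat) : set (mR * mR) :=
  [set p | `|p.1 - ratr i.1.1| < ratr i.2 /\ `|p.2 - ratr i.1.2| < ratr i.2].

Lemma measurable_near (c r : R) : measurable [set x : mR | `|x - c| < r].
Proof.
rewrite (_ : [set _ | _] = `]c - r, c + r[%classic); first exact: measurable_itv.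
by apply/seteqP; split => x /=; rewrite in_itv/= ltr_norml; lra.
Qed.

Lemma measurable_box2 i : measurable (box2 i).
Proof.
rewrite (_ : box2 i = [set x | `|x - ratr i.1.1| < ratr i.2] `*`
  [set x | `|x - ratr i.1.2| < ratr i.2]); last by apply/seteqP; split => x.
by apply: measurableX; exact: measurable_near.
Qed.

Lemma box2_base (x : mR * mR) (del : R) : 0 < del -> exists i, box2 i x /\
  forall y, box2 i y -> `|y.1 - x.1| < del /\ `|y.2 - x.2| < del.
Proof.
move=> d0.
have d2 : 0 < del / 2 by rewrite divr_gt0.
have [r] := rat_in_itvoo d2; rewrite in_itv/= => /andP[r0 rd].
have near (c : R) : exists q : rat, `|c - ratr q| < ratr r.
  have cc : c < c + ratr r by rewrite ltrDl.
  have [q] := rat_in_itvoo cc; rewrite in_itv/= => /andP[q1 q2].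
  by exists q; rewrite ltr_norml; lra.
have [q1 h1] := near x.1; have [q2 h2] := near x.2.
exists (q1, q2, r); split; first by split.
move=> y [/= k1 k2]; move: h1 h2 k1 k2; rewrite !ltr_norml => h1 h2 k1 k2.
by split; lra.
Qed.

Lemma continuous2_measurable (D : set (mR * mR)) (f : mR * mR -> R) : measurable D ->
  (forall x (e : R), D x -> 0 < e -> exists2 del, 0 < del & forall y, D y ->
     `|y.1 - x.1| < del -> `|y.2 - x.2| < del -> `|f y - f x| < e) ->
  measurable_fun D f.
Proof.
move=> mD H; apply: (base_measurable_fun mD measurable_box2) => x e Dx e0.
have [del d0 Hd] := H _ _ Dx e0; have [i [Bx Bi]] := box2_base x d0.
by exists i; split => // y Dy /Bi[? ?]; exact: Hd.
Qed.

Lemma continuous4_measurable (D : set (C2 R)) (f : C2 R -> R) : measurable D ->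
  (forall x (e : R), D x -> 0 < e -> exists2 del, 0 < del & forall y, D y ->
     `|y.1.1 - x.1.1| < del -> `|y.1.2 - x.1.2| < del ->
     `|y.2.1 - x.2.1| < del -> `|y.2.2 - x.2.2| < del -> `|f y - f x| < e) ->
  measurable_fun D f.
Proof.
move=> mD H.
pose B i := box2 i.1 `*` box2 i.2.
have mB i : measurable (B i) by apply: measurableX; exact: measurable_box2.
apply: (base_measurable_fun mD mB) => x e Dx e0.
have [del d0 Hd] := H _ _ Dx e0.
have [i [Bx1 Bi1]] := box2_base x.1 d0.
have [j [Bx2 Bi2]] := box2_base x.2 d0.
exists (i, j); split => // y Dy [/Bi1[? ?] /Bi2[? ?]]; exact: Hd.
Qed.

Lemma ccont2_measurable (D : set (mR * mR)) (f : R[i] -> R[i]) : measurable D ->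
  (forall p, D p -> ccont1 f (p.1 +i* p.2)%C) ->
  measurable_fun D (fun p => cabs (f (p.1 +i* p.2)%C)).
Proof.
move=> mD H; apply: continuous2_measurable => // x e Dx e0.
have e20 : 0 < e / 2 by rewrite divr_gt0.
have [del d0 Hd] := H _ Dx _ e20.
exists (del / 2); first by rewrite divr_gt0.
move=> y Dy h1 h2.
have : cabs (f (y.1 +i* y.2)%C - f (x.1 +i* x.2)%C) <= e / 2.
  apply: Hd; rewrite dist1E (le_lt_trans (cabs_ReIm _))//=; lra.
have := cabs_tri (f (y.1 +i* y.2)%C) (f (x.1 +i* x.2)%C) 0.
have := cabs_tri (f (x.1 +i* x.2)%C) (f (y.1 +i* y.2)%C) 0.
rewrite !subr0 (cabsC (f (x.1 +i* x.2)%C) (f (y.1 +i* y.2)%C)) ltr_norml; lra.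
Qed.

Lemma hol_measurable (D : set (C2 R)) (h : C2 R -> R[i]) : measurable D ->
  holomorphic_on D h -> measurable_fun D (fun p => cabs (h p)).
Proof.
move=> mD H; apply: continuous4_measurable => // x e Dx e0.
have e20 : 0 < e / 2 by rewrite divr_gt0.
have [del d0 Hd] : exists2 d, 0 < d & forall q, dist (@cz1 R) (@cz2 R) x q < d ->
    cabs (h q - h x) <= e / 2 := hol_ccont (H _ Dx) e20.
exists (del / 4); first by rewrite divr_gt0.
move=> y Dy h1 h2 h3 h4.
have : cabs (h y - h x) <= e / 2.
  apply: Hd; rewrite /dist; have := cabs_ReIm (cz1 y - cz1 x).
  by have := cabs_ReIm (cz2 y - cz2 x); rewrite /cz1 /cz2 /=; lra.
have := cabs_tri (h y) (h x) 0; have := cabs_tri (h x) (h y) 0.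
rewrite !subr0 (cabsC (h x) (h y)) ltr_norml; lra.
Qed.

End ContinuousMeasurable.

(** * Removable singularities and the mean value inequality *)

Section MeanValue.
Variable R : realType.
Implicit Types (f g : R[i] -> R[i]) (a b c d : R) (z : R[i]).
Local Open Scope complex_scope.

Definition bnd a b c d z := rect a b c d z &&
  [|| complex.Re z == a, complex.Re z == b, complex.Im z == c | complex.Im z == d].

Lemma bndP a b c d (P : R[i] -> Prop) : a <= b -> c <= d ->
  (forall z, bnd a b c d z -> P z) ->
  (forall x, a <= x <= b -> P (x +i* c) /\ P (x +i* d)) /\
  (forall y, c <= y <= d -> P (a +i* y) /\ P (b +i* y)).
Proof.
by move=> ab cd H; split=> x /andP[h1 h2]; split; apply: H;
  rewrite /bnd /rect /= h1 h2 ?ab ?cd !eqxx ?lexx ?orbT.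
Qed.

Lemma bnd_bcont f a b c d : a <= b -> c <= d ->
  (forall z, bnd a b c d z -> ccont1 f z) -> bcont f a b c d.
Proof.
move=> ab cd /(bndP ab cd)[H1 H2]; split=> x xab;
  first [apply: ccont_hor|apply: ccont_ver]; by [case: (H1 _ xab)|case: (H2 _ xab)].
Qed.

Lemma bnd_ML f M a b c d : a <= b -> c <= d -> bcont f a b c d ->
  (forall z, bnd a b c d z -> cabs (f z) <= M) ->
  cabs (oint f a b c d) <= 4 * (M * (b - a)) + 4 * (M * (d - c)).
Proof. by move=> ab cd bc /(bndP ab cd)[H1 H2]; exact: oint_ML. Qed.

Lemma bnd_ext f g a b c d : a <= b -> c <= d ->
  (forall z, bnd a b c d z -> f z = g z) -> oint f a b c d = oint g a b c d.
Proof.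
move=> ab cd /(bndP ab cd)[H1 H2].
have E (u v : R -> R[i]) k l : (forall x, k <= x <= l -> u x = v x) -> cint u k l = cint v k l.
  move=> uv; rewrite /cint /rint; congr (_ +i* _); apply: eq_Rintegral => x;
    by rewrite inE/= in_itv/= => /uv ->.
by rewrite /oint; congr (_ - _ + 'i * (_ - _)); apply: E => x; by [case/H1|case/H2].
Qed.

Lemma ointD f g a b c d : bcont f a b c d -> bcont g a b c d ->
  oint (fun z => f z + g z) a b c d = oint f a b c d + oint g a b c d.
Proof. by move=> [? ? ? ?] [? ? ? ?]; rewrite /oint !cintD//; ring. Qed.

(** z^2 F extends to 0 with value and derivative 0, so Cauchy's formula applies to it. Expanding z^2
    / (z - p) = z + p + p^2 / (z - p) leaves the integrals of z F and of F next to the Cauchy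
    integral of F, and both vanish. The Cauchy integral is at most 32 M since |z - p| is at least r
    / 2 on the boundary, and the winding integral is at least 4: hence 8 M, without constructing the
    extension of F. *)
Lemma removable_bound (F : R[i] -> R[i]) (r M : R) : 0 < r ->
  (forall z, rect (- r) r (- r) r z -> z != 0 -> hol1 F z) ->
  (forall e : R, 0 < e -> exists2 d : R, 0 < d &
    forall z, z != 0 -> cabs z < d -> cabs z * cabs (F z) <= e) ->
  (forall z, rect (- r) r (- r) r z -> r <= cabs z -> cabs (F z) <= M) ->
  forall z, z != 0 -> cabs z <= r / 2 -> cabs (F z) <= 8 * M.
Proof.
move=> r0 hF F0 FM.
have rr : - r <= r by lra.
have bndr z : bnd (- r) r (- r) r z -> rect (- r) r (- r) r z /\ r <= cabs z.
  case/andP => zr zb; split => //.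
  case/or4P: zb => /eqP E.
  - by rewrite (le_trans _ (cabs_Re z))// E normrN ler_norm.
  - by rewrite (le_trans _ (cabs_Re z))// E ler_norm.
  - by rewrite (le_trans _ (cabs_Im z))// E normrN ler_norm.
  - by rewrite (le_trans _ (cabs_Im z))// E ler_norm.
have M0 : 0 <= M.
  have br : rect (- r) r (- r) r (r +i* r) by rewrite /rect /= lexx rr.
  apply: le_trans (cabs_ge0 _) (FM _ br _).
  by rewrite (le_trans _ (cabs_Re _))//= ler_norm.
pose G z := z ^+ 2 * F z.
have hG z : rect (- r) r (- r) r z -> hol1 G z.
  move=> zr; have [->|z0] := eqVneq z 0; last first.
    by apply: holM; [apply: holX; exact: hol1_id|exact: hF].
  exists 0, 0 => e e0; have [d d0 Hd] := F0 _ e0; exists d => // q.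
  rewrite dist1E subr0 => qd; rewrite !mul0r !subr0 /G expr0n /= mul0r subr0.
  have [->|q0] := eqVneq q 0; first by rewrite expr0n mul0r cabs0 mulr0.
  rewrite cabsM cabsX expr2 -mulrA mulrC.
  by rewrite ler_wpM2r ?cabs_ge0//; exact: Hd.
have small z : cabs z <= r / 2 -> - r < complex.Re z < r /\ - r < complex.Im z < r.
  move=> zr; have := cabs_Re z; have := cabs_Im z; rewrite !ler_norml; split; lra.
have bz z : bnd (- r) r (- r) r z -> z != 0.
  by case/bndr => _ zr; rewrite -cabs_gt0 (lt_le_trans r0).
have bF : bcont F (- r) r (- r) r.
  apply: bnd_bcont => // z zb; apply: hol_ccont; apply: hF; last exact: bz.
  by case/bndr: zb.
have bzz p z : cabs p <= r / 2 -> bnd (- r) r (- r) r z -> r / 2 <= cabs (z - p).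
  move=> pr /bndr[_ rz]; have := cabs_tri z p 0; rewrite !subr0; lra.
have bzp p z : cabs p <= r / 2 -> bnd (- r) r (- r) r z -> z != p.
  move=> pr zb; rewrite -subr_eq0 -cabs_gt0 (lt_le_trans _ (bzz _ _ pr zb))//.
  by rewrite divr_gt0.
have bFp p : cabs p <= r / 2 -> bcont (fun z => F z / (z - p)) (- r) r (- r) r.
  move=> pr; apply: bnd_bcont => // z zb; apply: hol_ccont; apply: holM.
    by apply: hF; [case/bndr: zb|exact: bz].
  by apply: hol1_subV; exact: bzp zb.
have bM k : (forall z, bnd (- r) r (- r) r z -> hol1 k z) ->
    bcont (fun z => k z * F z) (- r) r (- r) r.
  move=> hk; apply: bnd_bcont => // z zb; apply: hol_ccont; apply: holM; first exact: hk.
  by apply: hF; [case/bndr: zb|exact: bz].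
have LFp p : cabs p <= r / 2 -> cabs (oint (fun z => F z / (z - p)) (- r) r (- r) r) <= 32 * M.
  move=> pr; have -> : 32 * M = 4 * (M / (r / 2) * (r - - r)) + 4 * (M / (r / 2) * (r - - r)).
    by field; rewrite gt_eqF.
  apply: bnd_ML => //; first exact: bFp.
  move=> z zb; rewrite cabs_div; apply: ler_pM; rewrite ?invr_ge0 ?cabs_ge0//.
    by case/bndr: (zb) => ? ?; exact: FM.
  rewrite lef_pV2 ?posrE ?divr_gt0// ?bzz// (lt_le_trans _ (bzz _ _ pr zb))//.
  by rewrite divr_gt0.
have zF0 : oint (fun z => z * F z) (- r) r (- r) r = 0.
  have r20 : 0 <= r / 2 by lra.
  have [|s1 s2] := small 0; first by rewrite cabs0.
  have := cauchy_formula s1 s2 hG; rewrite {2}/G expr0n !mul0r => <-.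
  apply: bnd_ext => // z /bz z0; rewrite /G subr0; field; exact: z0.
have key (p : R[i]) : p != 0 -> cabs p <= r / 2 ->
    p * F p * oint (fun z => (z - p)^-1) (- r) r (- r) r =
    oint F (- r) r (- r) r + p * oint (fun z => F z / (z - p)) (- r) r (- r) r.
  move=> p0 pr; have [s1 s2] := small _ pr.
  apply: (mulfI p0); transitivity (G p * oint (fun z => (z - p)^-1) (- r) r (- r) r).
    by rewrite /G; ring.
  rewrite -(cauchy_formula s1 s2 hG) -[LHS]subr0 -zF0 mulrDr mulrA.
  rewrite -(ointZ p bF) -(ointZ (p * p) (bFp _ pr)).
  rewrite -ointB; last 2 first.
  - apply: bnd_bcont => // z zb; apply: hol_ccont; apply: holM.
      by apply: hG; case/bndr: zb.
    by apply: hol1_subV; exact: bzp zb.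
  - by apply: bM => z _; exact: hol1_id.
  rewrite -ointD; last 2 first.
  - by apply: bM => z _; exact: hol_cst.
  - apply: bnd_bcont => // z zb; apply: hol_ccont; apply: holM; first exact: hol_cst.
    apply: holM; first by apply: hF; [case/bndr: zb|exact: bz].
    by apply: hol1_subV; exact: bzp zb.
  apply: bnd_ext => // z zb; rewrite /G.
  by field; rewrite subr_eq0; exact: bzp zb.
have lowc p : cabs p <= r / 2 ->
    4 <= cabs (oint (fun z => (z - p)^-1) (- r) r (- r) r) <= 16.
  by move=> /small[s1 s2]; exact: oint_subV_lower.
(* Let p tend to 0 through positive reals t in [key]: t F(t) tends to 0 by hypothesis, and the other
   term is at most 32 M t. *)
have oF0 : oint F (- r) r (- r) r = 0.
  apply/eqP; rewrite -cabs_eq0 eq_le cabs_ge0 andbT; apply/ler_addgt0Pr => e e0.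
  rewrite add0r; have e20 : 0 < e / 32 by rewrite divr_gt0.
  have [d d0 Hd] := F0 _ e20.
  set t := Num.min (Num.min (d / 2) (r / 2)) (e / (64 * (M + 1))).
  have M1 : 0 < M + 1 by lra.
  have t0 : 0 < t by rewrite !lt_min !divr_gt0// mulr_gt0.
  have [t1 t2 t3] : [/\ t <= d / 2, t <= r / 2 & t <= e / (64 * (M + 1))].
    by split; rewrite !ge_min lexx ?orbT.
  have tE : cabs (t%:C) = t by rewrite cabs_real gtr0_norm.
  have tn0 : t%:C != 0 by rewrite -cabs_gt0 tE.
  have := key _ tn0; rewrite tE => /(_ t2) /esym /(canRL (addrK _)) ->.
  rewrite (le_trans (cabsB _ _))// !cabsM tE.
  have -> : e = e / 32 * 16 + e / (64 * (M + 1)) * (32 * (M + 1)).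
    by field; rewrite gt_eqF.
  apply: lerD.
    apply: ler_pM; rewrite ?mulr_ge0 ?cabs_ge0 ?(ltW t0)//.
      by rewrite -{1}tE Hd// tE; lra.
    by have := lowc t%:C; rewrite tE => /(_ t2)/andP[].
  apply: ler_pM; rewrite ?mulr_ge0 ?cabs_ge0 ?(ltW t0)//.
  by rewrite (le_trans (LFp _ _)) ?tE//; lra.
move=> p p0 pr; have := key _ p0 pr; rewrite oF0 add0r -mulrA => /(mulfI p0) E.
have := LFp _ pr; rewrite -E cabsM; have /andP[h1 _] := lowc _ pr.
move=> H; have := ler_wpM2l (cabs_ge0 (F p)) h1; lra.
Qed.


Lemma rint_subset (h : R -> R) a b c d : a <= c -> c <= d -> d <= b ->
  rcont_on h a b -> (forall x, 0 <= h x) -> rint h c d <= rint h a b.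
Proof.
move=> ac cd db ch h0.
have ch' : rcont_on h c b by move=> x /andP[h1 h2]; apply: ch; rewrite h2 (le_trans ac h1).
rewrite (rint_split ac (le_trans cd db) ch) (rint_split cd db ch').
have p k l : 0 <= rint h k l by apply: Rintegral_ge0 => x _; exact: h0.
by have := p a c; have := p d b; lra.
Qed.

(** The sides are extended to full chords of the square, so that each term depends on the position
    of one side only and the four positions can be chosen independently. On the sides 1 / |z - p| is
    at most 2 / r; with the 2 of [cint_le] this gives 4 / r, and the 4 cancels against the winding
    integral. *)
Lemma cauchy_le_cross f (p : R[i]) (r a b c d : R) : 0 < r ->
  let x0 := complex.Re p in let y0 := complex.Im p in
  (forall z, rect (x0 - r) (x0 + r) (y0 - r) (y0 + r) z -> hol1 f z) ->
  x0 - r <= a <= x0 - r / 2 -> x0 + r / 2 <= b <= x0 + r ->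
  y0 - r <= c <= y0 - r / 2 -> y0 + r / 2 <= d <= y0 + r ->
  cabs (f p) * r <= rint (fun y => cabs (f (a +i* y))) (y0 - r) (y0 + r) +
    rint (fun y => cabs (f (b +i* y))) (y0 - r) (y0 + r) +
    rint (fun x => cabs (f (x +i* c))) (x0 - r) (x0 + r) +
    rint (fun x => cabs (f (x +i* d))) (x0 - r) (x0 + r).
Proof.
case: p => x0 y0 r0 /= hf /andP[a1 a2] /andP[b1 b2] /andP[c1 c2] /andP[d1 d2].
have r20 : 0 < r / 2 by rewrite divr_gt0.
have hfs z : rect a b c d z -> hol1 f z.
  move=> /andP[/andP[k1 k2] /andP[k3 k4]]; apply: hf.
  by apply/andP; split; apply/andP; split; lra.
have pa : a < complex.Re (x0 +i* y0) < b by rewrite /=; apply/andP; split; lra.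
have pc : c < complex.Im (x0 +i* y0) < d by rewrite /=; apply/andP; split; lra.
have C := cauchy_le pa pc hfs.
have ab : a <= b by lra.
have cd : c <= d by lra.
pose g z := f z / (z - (x0 +i* y0)).
have bf : bcont f a b c d by apply: rect_bcont => // z /hfs; exact: hol_ccont.
have gE (u v : R) : r / 2 <= `|u - x0| \/ r / 2 <= `|v - y0| ->
    cabs (g (u +i* v)) <= 2 / r * cabs (f (u +i* v)).
  move=> H; rewrite /g cabs_div mulrC ler_wpM2r ?cabs_ge0//.
  have E : r / 2 <= cabs ((u +i* v) - (x0 +i* y0)).
    have := cabs_Re ((u +i* v) - (x0 +i* y0)); have := cabs_Im ((u +i* v) - (x0 +i* y0)).
    by rewrite /= => h1 h2; case: H => /le_trans; apply.
  rewrite (_ : 2 / r = (r / 2)^-1); last by rewrite invf_div.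
  by rewrite lef_pV2 ?posrE// (lt_le_trans r20).
have bg : bcont g a b c d.
  apply: bnd_bcont => // z /andP[zr zb]; apply: hol_ccont; apply: holM; first exact: hfs.
  apply: hol1_subV; rewrite eq_complex negb_and /=; apply/orP.
  by case/or4P: zb => /eqP ->; [left|left|right|right]; apply/eqP; lra.
have [f1 f2 f3 f4] := bf; have [g1 g2 g3 g4] := bg.
have cc1 k : x0 - r <= k <= x0 + r -> rcont_on (fun y => cabs (f (k +i* y))) (y0 - r) (y0 + r).
  move=> kk; apply: scont_cabs => y yy; apply: ccont_ver; apply: hol_ccont; apply: hf.
  by rewrite /rect /= kk yy.
have cc2 k : y0 - r <= k <= y0 + r -> rcont_on (fun x => cabs (f (x +i* k))) (x0 - r) (x0 + r).
  move=> kk; apply: scont_cabs => y yy; apply: ccont_hor; apply: hol_ccont; apply: hf.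
  by rewrite /rect /= kk yy.
have H (k l k' l' : R) (u : R -> R[i]) (v : R -> R) :
    k' <= k -> k <= l -> l <= l' -> scont u k l ->
    rcont_on v k' l' -> (forall x, 0 <= v x) ->
    (forall x, k <= x <= l -> cabs (u x) <= 2 / r * v x) ->
    cabs (cint u k l) <= 4 / r * rint v k' l'.
  move=> kk kl ll cu cv v0 uv.
  have cv' : rcont_on v k l.
    by move=> x /andP[x1 x2]; apply: cv; rewrite (le_trans kk x1) (le_trans x2 ll).
  apply: (@le_trans _ _ (2 * rint (fun x => 2 / r * v x) k l)).
    by apply: cint_le => //; exact: rcontZ.
  rewrite rintZ// mulrA (_ : 2 * (2 / r) = 4 / r); last by field; rewrite gt_eqF.
  by rewrite ler_wpM2l ?divr_ge0 ?(ltW r0)//; exact: rint_subset.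
have B1 : cabs (cint (fun x => g (x +i* c)) a b) <=
    4 / r * rint (fun x => cabs (f (x +i* c))) (x0 - r) (x0 + r).
  apply: H => //; [apply: cc2; clear -c1 c2 d1 d2 r20; lra|by move=> x; exact: cabs_ge0|].
  by move=> x _; apply: gE; right; rewrite distrC ler_normr; lra.
have B2 : cabs (cint (fun x => g (x +i* d)) a b) <=
    4 / r * rint (fun x => cabs (f (x +i* d))) (x0 - r) (x0 + r).
  apply: H => //; [apply: cc2; clear -c1 c2 d1 d2 r20; lra|by move=> x; exact: cabs_ge0|].
  by move=> x _; apply: gE; right; rewrite ler_normr; lra.
have B3 : cabs (cint (fun y => g (b +i* y)) c d) <=
    4 / r * rint (fun y => cabs (f (b +i* y))) (y0 - r) (y0 + r).
  apply: H => //; [apply: cc1; clear -a1 a2 b1 b2 r20; lra|by move=> x; exact: cabs_ge0|].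
  by move=> x _; apply: gE; left; rewrite ler_normr; lra.
have B4 : cabs (cint (fun y => g (a +i* y)) c d) <=
    4 / r * rint (fun y => cabs (f (a +i* y))) (y0 - r) (y0 + r).
  apply: H => //; [apply: cc1; clear -a1 a2 b1 b2 r20; lra|by move=> x; exact: cabs_ge0|].
  by move=> x _; apply: gE; left; rewrite distrC ler_normr; lra.
have := le_trans C (oint_le B1 B2 B3 B4).
rewrite -!mulrDr -mulrA ler_pM2l// mulrC -ler_pdivlMr// => /le_trans; apply.
by rewrite le_eqVlt; apply/orP; left; apply/eqP; congr (_ / r); ring.
Qed.

Local Open Scope ereal_scope.

Local Notation leb := (@lebesgue_measure R).
Local Notation mR := (measurableTypeR R).

Definition square (p : R[i]) (r : R) : set (mR * mR) :=
  [set q | `|q.1 - complex.Re p| <= r /\ `|q.2 - complex.Im p| <= r]%R.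

Lemma squareE p r : square p r =
  `[(complex.Re p - r)%R, (complex.Re p + r)%R]%classic `*`
  `[(complex.Im p - r)%R, (complex.Im p + r)%R]%classic.
Proof.
by apply/seteqP; split => -[x y]; rewrite /square /= !in_itv/= !ler_distl.
Qed.

Lemma measurable_square p r : measurable (square p r).
Proof. by rewrite squareE; apply: measurableX; exact: measurable_itv. Qed.

Lemma integral_lower (disp : measure_display) (T : measurableType disp) (mu : {measure set T -> \bar R})
   (A : set T) (F : T -> \bar R) (X : R) : measurable A -> (0 <= X)%R ->
  measurable_fun setT F -> (forall x, 0 <= F x) -> (forall x, A x -> X%:E <= F x) ->
  X%:E * mu A <= \int[mu]_x F x.
Proof.
move=> mA X0 mF F0 AF; rewrite -integral_cst//.
apply: (@le_trans _ _ (\int[mu]_(x in A) F x)).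
  apply: ge0_le_integral => //; exact: measurable_funTS.
exact: ge0_subset_integral.
Qed.

(** Let X = |f p| r / 4. If on one of the four outer bands of width r / 2 every chord along the band
    has integral at least X, Tonelli on that band gives X r / 2 = |f p| r^2 / 8. Otherwise each band
    contains a chord with integral below X, and these four contradict [cauchy_le_cross]. *)
Lemma mean_value_square f (p : R[i]) (r : R) : (0 < r)%R ->
  (forall q, square p r q -> hol1 f (q.1 +i* q.2)) ->
  (cabs (f p))%:E <= (8 / r ^+ 2)%:E *
    \int[leb \x leb]_(q in square p r) (cabs (f (q.1 +i* q.2)))%:E.
Proof.
move=> r0 hf.
set x0 := complex.Re p; set y0 := complex.Im p.
have hfr z : rect (x0 - r)%R (x0 + r)%R (y0 - r)%R (y0 + r)%R z -> hol1 f z.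
  case: z => x y zr; apply: (hf (x, y)); rewrite squareE; move: zr => /andP[h1 h2].
  by split; rewrite /= in_itv.
pose g (q : mR * mR) : \bar R := (cabs (f (q.1 +i* q.2)))%:E.
pose gQ := g \_ (square p r).
have mQ := measurable_square p r.
have mg : measurable_fun setT gQ.
  apply/(measurable_restrictT _ mQ)/measurable_EFinP.
  by apply: ccont2_measurable => // q /hf; exact: hol_ccont.
have g0 q : 0 <= gQ q by rewrite /gQ patchE; case: ifP => // _; rewrite lee_fin cabs_ge0.
rewrite integral_mkcond -/g -/gQ.
set J := \int[_]_q _.
pose X := (cabs (f p) * r / 4)%R.
have X0 : (0 <= X)%R by rewrite /X divr_ge0// mulr_ge0 ?cabs_ge0 ?ltW.
suff H : X%:E * (r / 2)%:E <= J.
  apply: (@le_trans _ _ ((8 / r ^+ 2)%:E * (X%:E * (r / 2)%:E))).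
    rewrite -!EFinM lee_fin /X le_eqVlt; apply/orP; left; apply/eqP.
    by field; rewrite gt_eqF.
  by rewrite lee_pmul2l// lte_fin divr_gt0// exprn_gt0.
have itvr (u v : R) : (v - u = r / 2)%R -> (u <= v)%R -> leb `[u, v]%classic = (r / 2)%:E.
  move=> E uv; rewrite lebesgue_measure_itv/= lte_fin -EFinB E.
  by rewrite (_ : (u < v)%R = true)//; rewrite -subr_gt0 E divr_gt0.
have ro (u v : R) (h : R -> R) : rcont_on h u v -> (rint h u v)%:E = \int[leb]_(x in `[u, v]) (h x)%:E.
  move=> ch; rewrite /rint /Rintegral fineK//; apply: integrable_fin_num => //.
  exact: rcont_integrable.
pose L x := rint (fun y => cabs (f (x +i* y))) (y0 - r) (y0 + r).
pose M y := rint (fun x => cabs (f (x +i* y))) (x0 - r) (x0 + r).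
have cL x : (x0 - r <= x <= x0 + r)%R -> rcont_on (fun y => cabs (f (x +i* y))) (y0 - r)%R (y0 + r)%R.
  move=> xx; apply: scont_cabs => y yy; apply: ccont_ver; apply: hol_ccont.
  by apply: hfr; rewrite /rect /= xx yy.
have cM y : (y0 - r <= y <= y0 + r)%R -> rcont_on (fun x => cabs (f (x +i* y))) (x0 - r)%R (x0 + r)%R.
  move=> yy; apply: scont_cabs => x xx; apply: ccont_hor; apply: hol_ccont.
  by apply: hfr; rewrite /rect /= xx yy.
have LE x : (x0 - r <= x <= x0 + r)%R -> \int[leb]_y gQ (x, y) = (L x)%:E.
  move=> xx; rewrite /L ro; last exact: cL.
  rewrite [RHS]integral_mkcond; apply: eq_integral => y _; rewrite /gQ !patchE /g /=.
  have -> : ((x, y) \in square p r) = (y \in `[(y0 - r)%R, (y0 + r)%R]%classic).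
    apply/idP/idP; rewrite !inE squareE => ins; first by case: ins.
    by split => //=; rewrite in_itv /= xx.
  by [].
have ME y : (y0 - r <= y <= y0 + r)%R -> \int[leb]_x gQ (x, y) = (M y)%:E.
  move=> yy; rewrite /M ro; last exact: cM.
  rewrite [RHS]integral_mkcond; apply: eq_integral => x _; rewrite /gQ !patchE /g /=.
  have -> : ((x, y) \in square p r) = (x \in `[(x0 - r)%R, (x0 + r)%R]%classic).
    apply/idP/idP; rewrite !inE squareE => ins; first by case: ins.
    by split => //=; rewrite in_itv /= yy.
  by [].
have HL u v : (x0 - r <= u)%R -> (u <= v)%R -> (v <= x0 + r)%R -> (v - u = r / 2)%R ->
    (forall x, (u <= x <= v)%R -> (X <= L x)%R) -> X%:E * (r / 2)%:E <= J.
  move=> h1 h2 h3 h4 H; rewrite /J fubini_tonelli1// -(itvr _ _ h4 h2).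
  apply: integral_lower => //.
  - exact: measurable_fun_fubini_tonelli_F.
  - by move=> x; apply: integral_ge0.
  - move=> x; rewrite /= in_itv/= => /andP[k1 k2]; rewrite /fubini_F LE ?lee_fin ?H ?k1//.
    by rewrite (le_trans h1 k1) (le_trans k2 h3).
have HM u v : (y0 - r <= u)%R -> (u <= v)%R -> (v <= y0 + r)%R -> (v - u = r / 2)%R ->
    (forall x, (u <= x <= v)%R -> (X <= M x)%R) -> X%:E * (r / 2)%:E <= J.
  move=> h1 h2 h3 h4 H.
  rewrite /J fubini_tonelli1// fubini_tonelli// -(itvr _ _ h4 h2).
  apply: integral_lower => //.
  - exact: measurable_fun_fubini_tonelli_G.
  - by move=> x; apply: integral_ge0.
  - move=> x; rewrite /= in_itv/= => /andP[k1 k2]; rewrite ME ?lee_fin ?H ?k1//.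
    by rewrite (le_trans h1 k1) (le_trans k2 h3).
have dich (u v : R) (N : R -> R) : (forall x, (u <= x <= v)%R -> (X <= N x)%R) \/
    exists2 x, (u <= x <= v)%R & (N x < X)%R.
  have [?|/existsNP[x /not_implyP[xx /negP]]] := pselect (forall x, (u <= x <= v)%R -> (X <= N x)%R).
    by left.
  by rewrite -ltNge => ?; right; exists x.
have [|[a a1 a2]] := dich (x0 - r)%R (x0 - r / 2)%R L; first by apply: HL; lra.
have [|[b b1 b2]] := dich (x0 + r / 2)%R (x0 + r)%R L; first by apply: HL; lra.
have [|[c c1 c2]] := dich (y0 - r)%R (y0 - r / 2)%R M; first by apply: HM; lra.
have [|[d d1 d2]] := dich (y0 + r / 2)%R (y0 + r)%R M; first by apply: HM; lra.
have := cauchy_le_cross r0 hfr a1 b1 c1 d1; rewrite -/(L a) -/(L b) -/(M c) -/(M d).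
move=> S4; exfalso; move: a2 b2 c2 d2 S4; rewrite /X; lra.
Qed.

End MeanValue.

(** * Holomorphic roots *)

Lemma ccont_sum (R : realType) (T I : Type) (c1 c2 : T -> R[i]) (r : seq I)
    (F : I -> T -> R[i]) p :
  (forall i, ccont c1 c2 (F i) p) -> ccont c1 c2 (fun x => \sum_(i <- r) F i x) p.
Proof.
move=> H; elim: r => [|i r IH].
  by under eq_fun do rewrite big_nil; exact: ccont_cst.
by under eq_fun do rewrite big_cons; exact: ccontD.
Qed.

Section Root.
Variable R : realType.
Implicit Types (x y z w : R[i]).

(** The cofactor of x - y in x^k - y^k. Near (1, 1) it is close to k, hence nonzero, which makes the
    root close to 1 unique and differentiable. *)
Definition cross_sum k x y : R[i] := \sum_(i < k) x ^+ (k.-1 - i) * y ^+ i.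

Lemma cabs_le2 x (e : R) : e <= 1 -> cabs (x - 1) <= e -> cabs x <= 2.
Proof.
by move=> e1 H; have := cabs_tri x 1 0; rewrite !subr0 cabs1; lra.
Qed.

Lemma cabs_subX1 x (e : R) n : e <= 1 -> cabs (x - 1) <= e ->
  cabs (x ^+ n - 1) <= e * (n%:R * 2 ^+ n).
Proof.
move=> e1 H; rewrite subrX1 cabsM ler_pM ?cabs_ge0// (le_trans (cabs_sum _ _ _))//.
rewrite mulrC mulr_natr -[X in _ *+ X]card_ord -sumr_const.
apply: ler_sum => i _; rewrite cabsX (le_trans (lerXn2r _ _ _ (cabs_le2 e1 H))) ?nnegrE ?cabs_ge0//.
by rewrite ler_weXn2l ?ler1n// ltnW.
Qed.

(** The value of e puts each of the k terms within 1/2 of 1: a power is off by at most e k 2^k, and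
    a product of two powers by at most 2 * 2^k times that. *)
Lemma cross_sum_near k x y (e : R) : (0 < k)%N -> e = (k%:R * 4 ^+ k.+1)^-1 ->
  cabs (x - 1) <= e -> cabs (y - 1) <= e -> k%:R / 2 <= cabs (cross_sum k x y).
Proof.
move=> k0 eE xe ye.
have K1 : 1 <= k%:R :> R by rewrite ler1n.
have F1 : 1 <= 4 ^+ k.+1 :> R by rewrite exprn_ege1// ler1n.
have kf0 : 0 < k%:R * 4 ^+ k.+1 :> R by rewrite mulr_gt0// ?exprn_gt0// ltr0n.
have e0 : 0 < e by rewrite eE invr_gt0.
have e1 : e <= 1 by rewrite eE invf_le1// -[leLHS]mulr1 ler_pM.
have term (i : 'I_k) : cabs (x ^+ (k.-1 - i) * y ^+ i - 1) <= 1 / 2.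
  set a := (k.-1 - i)%N; have ak : (a <= k)%N by rewrite /a (leq_trans (leq_subr _ _))// leq_pred.
  have ik : (i <= k)%N by rewrite ltnW.
  have -> : x ^+ a * y ^+ i - 1 = x ^+ a * (y ^+ i - 1) + (x ^+ a - 1) by ring.
  have B n (z : R[i]) : (n <= k)%N -> cabs (z - 1) <= e -> cabs (z ^+ n - 1) <= e * (k%:R * 2 ^+ k).
    move=> nk ze; rewrite (le_trans (cabs_subX1 n e1 ze))// ler_wpM2l ?(ltW e0)//.
    by rewrite ler_pM ?ler_nat// ler_weXn2l ?ler1n.
  have X : cabs (x ^+ a) <= 2 ^+ k.
    rewrite cabsX (le_trans (lerXn2r _ _ _ (cabs_le2 e1 xe))) ?nnegrE ?cabs_ge0//.
    by rewrite ler_weXn2l ?ler1n.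
  rewrite (le_trans (cabsD _ _))// cabsM.
  apply: (@le_trans _ _ (2 ^+ k * (e * (k%:R * 2 ^+ k)) + 2 ^+ k * (e * (k%:R * 2 ^+ k)))).
    apply: lerD; first by rewrite ler_pM ?cabs_ge0// B.
    rewrite (le_trans (B _ _ ak xe))// ler_peMl ?exprn_ege1 ?ler1n//.
    by rewrite mulr_ge0 ?(ltW e0)// mulr_ge0 ?ler0n// exprn_ge0.
  rewrite le_eqVlt; apply/orP; left; apply/eqP.
  rewrite eE (_ : 4 ^+ k.+1 = 4 * (2 ^+ k * 2 ^+ k)); last first.
    by rewrite -exprMn exprS; congr (_ * _ ^+ _); rewrite -natrM.
  have t0 : 2 ^+ k != 0 :> R by rewrite expf_neq0.
  by field; rewrite t0 pnatr_eq0 -lt0n.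
have -> : cross_sum k x y = k%:R + \sum_(i < k) (x ^+ (k.-1 - i) * y ^+ i - 1).
  by rewrite sumrB sumr_const card_ord addrC subrK.
have := cabsD_ge k%:R (\sum_(i < k) (x ^+ (k.-1 - i) * y ^+ i - 1)).
rewrite cabs_nat => H; apply: le_trans H.
suff : cabs (\sum_(i < k) (x ^+ (k.-1 - i) * y ^+ i - 1)) <= k%:R / 2 by lra.
rewrite (le_trans (cabs_sum _ _ _))//.
have -> : k%:R / 2 = \sum_(i < k) (1 / 2) :> R.
  by rewrite sumr_const card_ord -[RHS]mulr_natl div1r.
by apply: ler_sum => i _; exact: term.
Qed.

(** The product of |x - 1| over the k roots x of X^k - w is |w - 1|, so not all factors can exceed
    e. *)
Lemma root_near k w (e : R) : (0 < k)%N -> 0 <= e -> cabs (w - 1) <= e ^+ k ->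
  exists2 x, x ^+ k = w & cabs (x - 1) <= e.
Proof.
move=> k0 e0 we; apply: contrapT => H.
have sz : size ('X^k - w%:P : {poly R[i]}) = k.+1 by rewrite size_XnsubC.
have [s ps] := closed_field_poly_normal ('X^k - w%:P : {poly R[i]}).
have lc : lead_coef ('X^k - w%:P : {poly R[i]}) = 1.
  by rewrite lead_coefDl ?lead_coefXn// size_opp size_polyXn (leq_ltn_trans (size_polyC_leq1 _)).
rewrite lc scale1r in ps.
have szs : size s = k by move: sz; rewrite ps size_prod_XsubC => -[].
have roots x : x \in s -> x ^+ k = w.
  rewrite -root_prod_XsubC -ps /root !hornerE.
  by rewrite subr_eq0 => /eqP.
have : cabs (w - 1) = \prod_(x <- s) cabs (x - 1).
  have := congr1 (fun p : {poly R[i]} => p.[1]) ps.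
  rewrite !hornerE expr1n horner_prod cabsC => ->; rewrite cabs_prod.
  by apply: eq_bigr => x _; rewrite !hornerE cabsC.
have : e ^+ k < \prod_(x <- s) cabs (x - 1).
  have: {in s, forall x, e < cabs (x - 1)}.
    by move=> x xs; rewrite ltNge; apply/negP => xe; apply: H; exists x => //; exact: roots.
  rewrite -szs; move: k0; rewrite -szs; elim: (s) => // x [|y s'] IH _ Hs.
    by rewrite big_seq1 expr1 Hs// mem_head.
  rewrite big_cons exprS ltr_pM ?exprn_ge0//; first by rewrite Hs// mem_head.
  by apply: IH => // u us; apply: Hs; rewrite inE us orbT.
by move=> h1 h2; move: h1; rewrite -h2 ltNge we.
Qed.

(** Roots chosen separately at each point already form a holomorphic branch: rho w' - rho w equals
    (w' - w) divided by [cross_sum], whose modulus is at least 1/2. This gives a Lipschitz bound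
    first, and then Caratheodory's form with the inverse of [cross_sum] as continuous
    coefficient. *)
Lemma local_root k (eta : R) : (0 < k)%N -> 0 < eta ->
  exists2 c : R, 0 < c & exists rho : R[i] -> R[i], rho 1 = 1 /\
  forall w, cabs (w - 1) < c -> [/\ rho w ^+ k = w, cabs (rho w - 1) <= eta & hol1 rho w].
Proof.
move=> k0 eta0; set e0 := (k%:R * 4 ^+ k.+1 : R)^-1; set e := Num.min eta e0.
have kf0 : 0 < k%:R * 4 ^+ k.+1 :> R by rewrite mulr_gt0// ?exprn_gt0// ltr0n.
have e_gt0 : 0 < e by rewrite lt_min eta0 invr_gt0.
have [e1 e2] : e <= eta /\ e <= e0 by rewrite !ge_min !lexx orbT.
have R1 w : exists x, cabs (w - 1) <= e ^+ k -> x ^+ k = w /\ cabs (x - 1) <= e.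
  have [H|H] := pselect (cabs (w - 1) <= e ^+ k); last by exists 0.
  by have [x] := root_near k0 (ltW e_gt0) H; exists x.
have [rho Hrho] := choice R1.
have S w w' : cabs (w - 1) <= e ^+ k -> cabs (w' - 1) <= e ^+ k ->
    (rho w' - rho w) * cross_sum k (rho w') (rho w) = w' - w.
  move=> /Hrho[h1 _] /Hrho[h2 _]; transitivity (rho w' ^+ k - rho w ^+ k); last by rewrite h1 h2.
  by rewrite subrXX.
have Sl w w' : cabs (w - 1) <= e ^+ k -> cabs (w' - 1) <= e ^+ k ->
    1 / 2 <= cabs (cross_sum k (rho w') (rho w)).
  move=> /Hrho[_ h1] /Hrho[_ h2].
  have := @cross_sum_near k (rho w') (rho w) e0 k0 erefl (le_trans h2 e2) (le_trans h1 e2).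
  by apply: le_trans; rewrite ler_wpM2r// ler1n.
have Sn w w' : cabs (w - 1) <= e ^+ k -> cabs (w' - 1) <= e ^+ k ->
    cross_sum k (rho w') (rho w) != 0.
  by move=> h1 h2; rewrite -cabs_gt0 (lt_le_trans _ (Sl _ _ h1 h2))//; lra.
have one : cabs (1 - 1 : R[i]) <= e ^+ k by rewrite subrr cabs0 exprn_ge0 ?ltW.
exists (e ^+ k); first exact: exprn_gt0.
exists rho; split.
  have [h1 h2] := Hrho _ one.
  apply/eqP; rewrite -subr_eq0; apply/eqP.
  have one' : cabs (1 - 1 : R[i]) <= e0 by rewrite subrr cabs0 ltW// invr_gt0.
  have L := @cross_sum_near k (rho 1) 1 e0 k0 erefl (le_trans h2 e2) one'.
  have Z : (rho 1 - 1) * cross_sum k (rho 1) 1 = 0.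
    transitivity (rho 1 ^+ k - 1 ^+ k); last by rewrite h1 expr1n subrr.
    by rewrite subrXX.
  move/eqP: Z; rewrite mulf_eq0 => /orP[/eqP//|/eqP Z].
  by move: L; rewrite Z cabs0 pmulr_lle0 ?invr_gt0// lern0 => /eqP kz; rewrite kz in k0.
move=> w wc; have [h1 h2] := Hrho _ (ltW wc); split => //; first exact: le_trans h2 e1.
have d0 : 0 < e ^+ k - cabs (w - 1) by rewrite subr_gt0.
have near w' : dist1 w w' < e ^+ k - cabs (w - 1) -> cabs (w' - 1) <= e ^+ k.
  by rewrite dist1E; have := cabs_tri w' w 1; lra.
have cr : ccont1 rho w.
  move=> t t0; exists (Num.min (e ^+ k - cabs (w - 1)) (t / 2)).
    by rewrite lt_min d0 divr_gt0.
  move=> w'; rewrite lt_min => /andP[/near w'e]; rewrite dist1E => wt.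
  have := congr1 (@cabs R) (S _ _ (ltW wc) w'e); rewrite cabsM.
  have := Sl _ _ (ltW wc) w'e => L E.
  have := ler_wpM2l (cabs_ge0 (rho w' - rho w)) L; rewrite E; lra.
apply/holP; exists (fun w' => (cross_sum k (rho w') (rho w))^-1), (fun=> 0); split.
- apply: (@ccontV _ _ _ _ (fun w' => cross_sum k (rho w') (rho w))).
    by apply: Sn; exact: ltW.
  apply: ccont_sum => i; by apply: ccontM; [exact: ccontX|exact: ccont_cst].
- exact: ccont_cst.
exists (e ^+ k - cabs (w - 1)) => // w' /near w'e /=.
by rewrite mul0r addr0 -(S _ _ (ltW wc) w'e) mulrC mulfK ?Sn ?(ltW wc)// addrC subrK.
Qed.

End Root.

(** * Lebesgue measure on C^2 *)

Section ProductSigmaFinite.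
Local Open Scope ereal_scope.
Context (d1 d2 : measure_display) (T1 : measurableType d1) (T2 : measurableType d2).
Context (R : realType).
Variable m1 : {sigma_finite_measure set T1 -> \bar R}.
Variable m2 : {sigma_finite_measure set T2 -> \bar R}.

Lemma sigma_finite_product : sigma_finite setT (m1 \x m2).
Proof.
have /sigma_finiteP[F [TF ndF Foo]] := sigma_finiteT m1.
have /sigma_finiteP[G [TG ndG Goo]] := sigma_finiteT m2.
exists (fun n => F n `*` G n).
  apply/seteqP; split => // -[x y] _.
  have [n _ Fx] : (\bigcup_n F n) x by rewrite -TF.
  have [m _ Gy] : (\bigcup_n G n) y by rewrite -TG.
  exists (maxn n m) => //; split.
    by move: Fx; apply/subsetPset/ndF; rewrite leq_maxl.
  by move: Gy; apply/subsetPset/ndG; rewrite leq_maxr.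
move=> n; have [mF fF] := Foo n; have [mG fG] := Goo n.
by split; [exact: measurableX|rewrite product_measure1E// lte_mul_pinfty// ge0_fin_numE].
Qed.

End ProductSigmaFinite.

Section LebesgueC2.
Variable R : realType.
Local Notation mR := (measurableTypeR R).
Local Notation leb := (@lebesgue_measure R).

(* [leb \x leb] itself carries no canonical sigma-finite structure. *)
Definition leb2 : set (mR * mR) -> \bar R := (leb \x leb)%E.
HB.instance Definition _ := Measure.copy leb2 (leb \x leb)%E.
HB.instance Definition _ := Measure_isSigmaFinite.Build _ _ _ leb2 (@sigma_finite_product _ _ _ _ R leb leb).

Definition leb4 : set (C2 R) -> \bar R := (leb2 \x leb2)%E.
HB.instance Definition _ := Measure.copy leb4 (leb2 \x leb2)%E.
HB.instance Definition _ := Measure_isSigmaFinite.Build _ _ _ leb4 (@sigma_finite_product _ _ _ _ R leb2 leb2).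

Lemma dVE : @dV R = leb4. Proof. by []. Qed.

Lemma integral_dV_mkcond (D : set (C2 R)) (f : C2 R -> \bar R) :
  (\int[@dV R]_(w in D) f w = \int[@dV R]_w (f \_ D) w)%E.
Proof. rewrite dVE. exact: integral_mkcond. Qed.
Lemma integral_dV (f : C2 R -> \bar R) : measurable_fun setT f -> (forall w, 0 <= f w)%E ->
  (\int[@dV R]_w f w = \int[leb2]_y \int[leb2]_x f (x, y))%E.
Proof.
move=> mf f0.
transitivity (\int[leb2]_x \int[leb2]_y f (x, y))%E.
   rewrite dVE. exact: fubini_tonelli1.
exact: fubini_tonelli.
Qed.
End LebesgueC2.

(** * Measurability of complex-valued functions *)

Section ComplexMeasurable.
Variables (R : realType) (d : measure_display) (T : measurableType d).
Implicit Types f g : T -> R[i].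

Definition cmeasurable f := measurable_fun setT (fun x => complex.Re (f x)) /\
  measurable_fun setT (fun x => complex.Im (f x)).

Lemma cmeasurable_cst k : cmeasurable (fun=> k).
Proof. by split; exact: measurable_cst. Qed.

Lemma cmeasurableD f g : cmeasurable f -> cmeasurable g ->
  cmeasurable (fun x => f x + g x).
Proof.
have E x : f x + g x = ((complex.Re (f x) + complex.Re (g x)) +i*
  (complex.Im (f x) + complex.Im (g x)))%C by case: (f x) (g x) => ? ? [].
move=> [f1 f2] [g1 g2]; split.
  by under eq_fun do rewrite E /=; exact: measurable_funD.
by under eq_fun do rewrite E /=; exact: measurable_funD.
Qed.

Lemma cmeasurableM f g : cmeasurable f -> cmeasurable g ->
  cmeasurable (fun x => f x * g x).
Proof.
have E x : f x * g x =
  ((complex.Re (f x) * complex.Re (g x) - complex.Im (f x) * complex.Im (g x)) +i*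
  (complex.Re (f x) * complex.Im (g x) + complex.Im (f x) * complex.Re (g x)))%C.
  by case: (f x) (g x) => ? ? [].
move=> [f1 f2] [g1 g2]; split.
  by under eq_fun do rewrite E /=; apply: measurable_funB; exact: measurable_funM.
by under eq_fun do rewrite E /=; apply: measurable_funD; exact: measurable_funM.
Qed.

Lemma cmeasurableB f g : cmeasurable f -> cmeasurable g ->
  cmeasurable (fun x => f x - g x).
Proof.
move=> mf mg; rewrite (_ : (fun _ => _) = fun x => f x + -1 * g x).
  by apply: cmeasurableD => //; apply: cmeasurableM => //; exact: cmeasurable_cst.
by apply/funext => x; rewrite mulN1r.
Qed.

Lemma cmeasurableX f n : cmeasurable f -> cmeasurable (fun x => f x ^+ n).
Proof.
move=> cf; elim: n => [|n IH]; first exact: cmeasurable_cst.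
by under eq_fun do rewrite exprS; exact: cmeasurableM.
Qed.

Lemma cmeasurable_conj f : cmeasurable f -> cmeasurable (fun x => (f x)^*).
Proof.
have E x : (f x)^* = (complex.Re (f x) -i* complex.Im (f x))%C by case: (f x).
move=> [f1 f2]; split; first by under eq_fun do rewrite E /=.
by under eq_fun do rewrite E /=; exact: measurable_funN.
Qed.

Lemma cmeasurable_sum (I : Type) (r : seq I) (F : I -> T -> R[i]) :
  (forall i, cmeasurable (F i)) -> cmeasurable (fun x => \sum_(i <- r) F i x).
Proof.
move=> H; elim: r => [|i r IH].
  by under eq_fun do rewrite big_nil; exact: cmeasurable_cst.
by under eq_fun do rewrite big_cons; exact: cmeasurableD.
Qed.

Lemma measurable_sqrtr D (h : T -> R) : measurable_fun D h -> (forall x, 0 <= h x) ->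
  measurable_fun D (fun x => Num.sqrt (h x)).
Proof.
move=> mh h0; under eq_fun do rewrite -powR12_sqrt//.
exact: (measurableT_comp (measurable_powR _)).
Qed.

Lemma measurable_invr D (h : T -> R) : measurable_fun D h -> (forall x, 0 <= h x) ->
  measurable_fun D (fun x => (h x)^-1).
Proof.
move=> mh h0; under eq_fun do rewrite -powR_inv1//.
exact: (measurableT_comp (measurable_powR _)).
Qed.

Lemma cmeasurable_cabs f : cmeasurable f -> measurable_fun setT (fun x => cabs (f x)).
Proof.
move=> [f1 f2]; under eq_fun do rewrite cabsE.
apply: measurable_sqrtr => [|x]; last by rewrite addr_ge0 ?sqr_ge0.
by apply: measurable_funD; exact: measurable_funX.
Qed.

End ComplexMeasurable.

Section Coordinates.
Variable R : realType.
Local Notation mR := (measurableTypeR R).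

Lemma cmeasurable_cz1 : cmeasurable (@cz1 R).
Proof.
split; first exact: (measurableT_comp measurable_fst measurable_fst).
exact: (measurableT_comp measurable_snd measurable_fst).
Qed.

Lemma cmeasurable_cz2 : cmeasurable (@cz2 R).
Proof.
split; first exact: (measurableT_comp measurable_fst measurable_snd).
exact: (measurableT_comp measurable_snd measurable_snd).
Qed.

Lemma measurable_Hk k : measurable (@Hk R k).
Proof.
have m1 : measurable_fun [set: C2 R] (fun p => cabs (cz1 p) ^+ k).
  by apply: measurable_funX; apply: cmeasurable_cabs; exact: cmeasurable_cz1.
have m2 : measurable_fun [set: C2 R] (fun p => cabs (cz2 p)).
  by apply: cmeasurable_cabs; exact: cmeasurable_cz2.
have m3 := measurable_fun_ltr m1 m2.
have m5 : measurable_fun [set: C2 R] (fun=> 1 : R) by exact: measurable_cst.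
have m4 := measurable_fun_ltr m2 m5.
rewrite (_ : Hk k = [set p | cabs (cz1 p) ^+ k < cabs (cz2 p)] `&` [set p | cabs (cz2 p) < 1]).
  apply: measurableI.
    by rewrite -[X in measurable X]setTI; exact: (m3 _ [set true]).
  by rewrite -[X in measurable X]setTI; exact: (m4 _ [set true]).
by apply/seteqP; split => p /=; [move=> /andP[]|move=> [? ?]; apply/andP].
Qed.

End Coordinates.

(** * The mean value inequality on the Hartogs triangle *)

Section LocalBound.
Variable R : realType.
Local Notation mR := (measurableTypeR R).
Local Notation leb := (@lebesgue_measure R).
Implicit Types (f : R[i] -> R[i]) (alpha zeta z : R[i]).

(** Stated so that it iterates: [Psi] is first the integrand on a slice, then the inner integral as
    a function of z2, with m absorbing the constant of the first application. *)
Lemma mean_value_square_weighted f (p : R[i]) (r m : R) (Psi : mR * mR -> \bar R) : 0 < r -> 0 <= m ->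
  (forall q, square p r q -> hol1 f (q.1 +i* q.2)%C) ->
  measurable_fun setT Psi -> (forall q, 0 <= Psi q)%E ->
  (forall q, square p r q -> (m * cabs (f (q.1 +i* q.2)%C))%:E <= Psi q)%E ->
  ((m * cabs (f p) * (r ^+ 2 / 8))%:E <= \int[leb \x leb]_q Psi q)%E.
Proof.
move=> r0 m0 hf mPsi Psi0 fPsi.
have mQ := measurable_square p r.
have mf : measurable_fun (square p r) (fun q : mR * mR => (cabs (f (q.1 +i* q.2)%C))%:E).
  apply/measurable_EFinP.
  by apply: ccont2_measurable => // q /hf; exact: hol_ccont.
apply: (@le_trans _ _ (\int[leb \x leb]_(q in square p r) Psi q)%E); last exact: ge0_subset_integral.
apply: (@le_trans _ _ (\int[leb \x leb]_(q in square p r) (m * cabs (f (q.1 +i* q.2)%C))%:E)%E); last first.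
  apply: ge0_le_integral => //.
  - by move=> q _; rewrite lee_fin mulr_ge0 ?cabs_ge0.
  - by under eq_fun do rewrite EFinM; exact: measurable_funeM.
  - exact: measurable_funTS.
under eq_integral do rewrite EFinM.
rewrite ge0_integralZl ?lee_fin//; last by move=> q _; rewrite lee_fin cabs_ge0.
rewrite -mulrA EFinM lee_wpmul2l ?lee_fin//.
rewrite EFinM muleC.
apply: (@le_trans _ _ ((r ^+ 2 / 8)%:E * ((8 / r ^+ 2)%:E *
    \int[leb \x leb]_(q in square p r) (cabs (f (q.1 +i* q.2)%C))%:E))%E).
  by rewrite lee_wpmul2l ?mean_value_square// lee_fin divr_ge0 ?exprn_ge0 ?ltW.
rewrite muleA -EFinM (_ : r ^+ 2 / 8 * (8 / r ^+ 2) = 1) ?mul1e//.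
by field; rewrite gt_eqF.
Qed.

Definition pt z1 z2 : C2 R := ((complex.Re z1, complex.Im z1), (complex.Re z2, complex.Im z2)).

Lemma cz1_pt z1 z2 : cz1 (pt z1 z2) = z1. Proof. by case: z1. Qed.
Lemma cz2_pt z1 z2 : cz2 (pt z1 z2) = z2. Proof. by case: z2. Qed.
Lemma pt_cz (p : C2 R) : pt (cz1 p) (cz2 p) = p. Proof. by case: p => [[? ?] [? ?]]. Qed.

Lemma hol_comp_pt (h : C2 R -> R[i]) (f g : R[i] -> R[i]) z :
  hol (@cz1 R) (@cz2 R) h (pt (f z) (g z)) -> hol1 f z -> hol1 g z ->
  hol1 (fun x => h (pt (f x) (g x))) z.
Proof.
move=> hh hf hg; apply: (@hol_comp R (C2 R) (@cz1 R) (@cz2 R) h (fun x => pt (f x) (g x))) => //.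
  by rewrite [X in hol _ _ X](_ : _ = f)//; apply/funext => x; rewrite cz1_pt.
by rewrite [X in hol _ _ X](_ : _ = g)//; apply/funext => x; rewrite cz2_pt.
Qed.

(* [w = (beta * eta, eta ^ k)] with [eta = zeta * r] close to [zeta] and [beta]
   close to [alpha] relatively to the distance of [alpha] to the unit circle. *)
Definition near_pt (k : nat) (eps : R) alpha zeta (w : C2 R) := exists r : R[i],
  [/\ r ^+ k = cz2 w / zeta ^+ k, cabs (r - 1) <= eps,
     cabs (cz2 w - zeta ^+ k) <= eps * (1 - cabs zeta) * cabs zeta ^+ k &
     cabs (cz1 w - alpha * zeta * r) <= eps * (1 - cabs alpha) * cabs zeta].

Lemma near_pt_Hk k eps alpha zeta w : (0 < k)%N -> eps <= 1 / 4 ->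
  cabs alpha < 1 -> 0 < cabs zeta < 1 -> near_pt k eps alpha zeta w -> Hk k w.
Proof.
move=> k0 e4 a1 /andP[z0 z1] [r [rk r1 w2 w1]].
have zn : zeta != 0 by rewrite -cabs_gt0.
have zk : 0 < cabs zeta ^+ k by rewrite exprn_gt0.
have rl : 3 / 4 <= cabs r.
  by have := cabs_tri 1 r 0; rewrite !subr0 cabs1 (cabsC 1); lra.
have w2E : cz2 w = (r * zeta) ^+ k by rewrite exprMn rk divfK// expf_neq0.
apply/andP; split.
  rewrite w2E cabsX ltrXn2r ?cabs_ge0// -?lt0n ?k0//= cabsM.
  have := cabs_tri (cz1 w) (alpha * zeta * r) 0; rewrite !subr0 !cabsM => H.
  apply: (le_lt_trans H); apply: (le_lt_trans (lerD w1 (lexx _))).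
  have : eps * (1 - cabs alpha) < cabs r * (1 - cabs alpha).
    by rewrite ltr_pM2r ?subr_gt0//; lra.
  by rewrite -(ltr_pM2r z0); lra.
have := cabs_tri (cz2 w) (zeta ^+ k) 0; rewrite !subr0 cabsX => H.
apply: (le_lt_trans H); apply: (le_lt_trans (lerD w2 (lexx _))).
have zkx : cabs zeta ^+ k <= cabs zeta.
  by rewrite -{2}(expr1 (cabs zeta)) ler_wiXn2l// ltW.
have e1 : eps * (1 - cabs zeta) <= 1 - cabs zeta.
  by rewrite ler_piMl ?subr_ge0 ?ltW//; lra.
have := ler_wpM2r (ltW zk) e1.
(* |z2| is at most |zeta|^k (2 - |zeta|), hence at most |zeta| (2 - |zeta|) = 1 - (1 - |zeta|)^2. *)
have := ler_wpM2l (_ : 0 <= 2 - cabs zeta) zkx; rewrite subr_ge0 => /(_ _)/wrap[]; first lra.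
have : 0 < (1 - cabs zeta) ^+ 2 by rewrite exprn_gt0// subr_gt0.
by rewrite expr2; lra.
Qed.

(** The polydisc is sheared. Moving z2 by a fraction of its modulus can move the boundary |z1| =
    |z2|^(1/k) by more than the gap governed by 1 - |alpha|, so the centre [P1] in z1 follows a
    holomorphic k-th root of z2. The mean value inequality is applied to h^2 in z1 for fixed z2, and
    then to h^2 along the holomorphic curve z2 to ([P1] z2, z2). *)
Lemma local_bound k (eps : R) : (0 < k)%N -> 0 < eps <= 1 / 4 -> exists2 c : R, 0 < c &
  forall alpha zeta (h : C2 R -> R[i]) (W : C2 R -> R) (m : R),
  cabs alpha < 1 -> 0 < cabs zeta < 1 -> holomorphic_on (Hk k) h ->
  measurable_fun (Hk k) W -> (forall w, Hk k w -> 0 <= W w) -> 0 <= m ->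
  (forall w, near_pt k eps alpha zeta w -> m <= W w) ->
  ((c * m * ((1 - cabs alpha) * (1 - cabs zeta) * cabs zeta ^+ k.+1) ^+ 2 *
    cabs (h (pt (alpha * zeta) (zeta ^+ k))) ^+ 2)%:E <=
   \int[@dV R]_(w in Hk k) (W w * cabs (h w) ^+ 2)%:E)%E.
Proof.
move=> k0 /andP[e0 e4].
have [c c0 [rho [rho1 Hrho]]] := @local_root R k eps k0 e0.
(* A point of a square of half side s is within 2 s of the centre, hence the halves: eps / 2 yields
   [near_pt], and c / 2 keeps the argument of [rho] in its domain. The constant below is the product
   of the two factors kap^2 / 8. *)
set kap := Num.min (eps / 2) (c / 2).
have kap0 : 0 < kap by rewrite lt_min !divr_gt0.
have [kap1 kap2] : kap <= eps / 2 /\ kap <= c / 2 by rewrite !ge_min !lexx orbT.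
exists (kap ^+ 4 / 64); first by rewrite divr_gt0// exprn_gt0.
move=> alpha zeta h W m a1 /[dup] z01 /andP[z0 z1] hh mW W0 m0 mw.
have zn : zeta != 0 by rewrite -cabs_gt0.
have zkn : zeta ^+ k != 0 by rewrite expf_neq0.
have zk : 0 < cabs zeta ^+ k by rewrite exprn_gt0.
set r1 := kap * (1 - cabs alpha) * cabs zeta.
set r2 := kap * (1 - cabs zeta) * cabs zeta ^+ k.
have r10 : 0 < r1 by rewrite !mulr_gt0// subr_gt0.
have r20 : 0 < r2 by rewrite !mulr_gt0// subr_gt0.
pose Psi := (fun w => (W w * cabs (h w) ^+ 2)%:E) \_ (Hk k).
have mPsi : measurable_fun setT Psi.
  apply/(measurable_restrictT _ (@measurable_Hk R k))/measurable_EFinP.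
  apply: measurable_funM => //; apply: measurable_funX; apply: hol_measurable => //.
  exact: measurable_Hk.
have Psi0 w : (0 <= Psi w)%E.
  rewrite /Psi patchE; case: ifPn => // /set_mem wH.
  by rewrite lee_fin mulr_ge0 ?sqr_ge0// W0.
have sq z (s : R) (q : mR * mR) : square z s q -> cabs ((q.1 +i* q.2)%C - z) <= 2 * s.
  by case: z => a b [/= h1 h2]; rewrite (le_trans (cabs_ReIm _))//=; lra.
pose P1 w2 := alpha * zeta * rho (w2 / zeta ^+ k).
have D2 z : cabs (z - zeta ^+ k) <= 2 * r2 -> cabs (z / zeta ^+ k - 1) < c.
  move=> H; have -> : z / zeta ^+ k - 1 = (z - zeta ^+ k) / zeta ^+ k by field.
  rewrite cabs_div cabsX ltr_pdivrMr// (le_lt_trans H)// /r2 mulrA ltr_pM2r//.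
  by have := mulr_gt0 kap0 z0; lra.
have nearB (q q2 : mR * mR) : square (zeta ^+ k) r2 q2 -> square (P1 (q2.1 +i* q2.2)%C) r1 q ->
    near_pt k eps alpha zeta (q, q2).
  move=> /sq h2 /sq h1; have [rk r1' _] := Hrho _ (D2 _ h2).
  exists (rho ((q2.1 +i* q2.2)%C / zeta ^+ k)); split => //.
    rewrite (le_trans h2)// /r2 mulrA ler_wpM2r ?(ltW zk)// mulrA ler_wpM2r ?subr_ge0 ?(ltW z1)//; lra.
  rewrite (le_trans h1)// /r1 mulrA ler_wpM2r ?(ltW z0)// mulrA ler_wpM2r ?subr_ge0 ?(ltW a1)//; lra.
have HkB q q2 : square (zeta ^+ k) r2 q2 -> square (P1 (q2.1 +i* q2.2)%C) r1 q -> Hk k (q, q2).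
  by move=> h2 h1; exact: (near_pt_Hk k0 e4 a1 z01 (nearB _ _ h2 h1)).
pose G (w2 : mR * mR) := (\int[@leb2 R]_w1 Psi (w1, w2))%E.
have stepA (q2 : mR * mR) : square (zeta ^+ k) r2 q2 ->
    ((m * cabs (h (pt (P1 (q2.1 +i* q2.2)%C) (q2.1 +i* q2.2)%C) ^+ 2) * (r1 ^+ 2 / 8))%:E <= G q2)%E.
  move=> q2s.
  apply: (@mean_value_square_weighted (fun z => h (pt z (q2.1 +i* q2.2)%C) ^+ 2) _ _ _ (fun w1 => Psi (w1, q2))) => //.
  - move=> q qs; apply: holX; apply: (@hol_comp_pt h (fun z => z) (fun=> (q2.1 +i* q2.2)%C)).
    + by apply: hh; have := HkB _ _ q2s qs; case: (q) (q2) => [? ?] [? ?].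
    + exact: hol1_id.
    + exact: hol_cst.
  - exact: measurableT_comp.
  - move=> q qs; rewrite /Psi patchE mem_set; last exact: HkB.
    have -> : pt (q.1 +i* q.2)%C (q2.1 +i* q2.2)%C = (q, q2) by case: (q) (q2) => [? ?] [? ?].
    rewrite lee_fin cabsX ler_wpM2r ?sqr_ge0//; apply: mw; exact: nearB.
have cent p (s : R) : 0 < s -> square p s (complex.Re p, complex.Im p).
  by move=> s0; split; rewrite subrr normr0 ltW.
have eqC z : (complex.Re z +i* complex.Im z)%C = z by case: z.
have m1 : 0 <= m * (r1 ^+ 2 / 8) by rewrite mulr_ge0// divr_ge0// sqr_ge0.
have := @mean_value_square_weighted (fun z => h (pt (P1 z) z) ^+ 2) (zeta ^+ k) r2 (m * (r1 ^+ 2 / 8)) G r20 m1.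
have E1 : P1 (zeta ^+ k) = alpha * zeta by rewrite /P1 divff// rho1 mulr1.
rewrite E1 => H.
have IE : (\int[@dV R]_(w in Hk k) (W w * cabs (h w) ^+ 2)%:E = \int[@leb2 R]_q G q)%E.
  by rewrite integral_dV_mkcond integral_dV.
rewrite IE.
have -> : kap ^+ 4 / 64 * m * ((1 - cabs alpha) * (1 - cabs zeta) * cabs zeta ^+ k.+1) ^+ 2 *
    cabs (h (pt (alpha * zeta) (zeta ^+ k))) ^+ 2 =
    m * (r1 ^+ 2 / 8) * cabs (h (pt (alpha * zeta) (zeta ^+ k)) ^+ 2) * (r2 ^+ 2 / 8).
  by rewrite (cabsX (h _)) (exprS (cabs zeta)) /r1 /r2; field.
apply: H.
- move=> q2 q2s; apply: holX.
  have h1 : hol1 P1 (q2.1 +i* q2.2)%C.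
    apply: holM; first exact: hol_cst.
    have [_ _ hr] := Hrho _ (D2 _ (sq _ _ _ q2s)).
    apply: (@hol_comp R R[i] idfun (fun=> 0) rho (fun z => z / zeta ^+ k)) => //.
      by apply: holM; [exact: hol1_id|exact: hol_cst].
    exact: hol_cst.
  apply: (@hol_comp_pt h P1 (fun z => z)) => //; last exact: hol1_id.
  by apply: hh; have := HkB _ _ q2s (cent _ _ r10); case: (q2) => [? ?].
- exact: measurable_fun_fubini_tonelli_G.
- by move=> q2; apply: integral_ge0.
- move=> q2 q2s; rewrite mulrAC; exact: stepA.
Qed.

End LocalBound.

(** * Lower bounds for the kernels *)

Section Lipschitz.
Variables (R : realType) (T : Type) (D : set T) (dd : T -> T -> R).
Hypothesis dd0 : forall x y, 0 <= dd x y.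
Implicit Types f g : T -> R[i].

(** One constant bounds both the values and the increments, so that the class is closed under
    products. *)
Definition lipb f := exists2 L : R, 0 <= L & forall x, D x -> cabs (f x) <= L /\
  forall y, D y -> cabs (f x - f y) <= L * dd x y.

Lemma lipb_cst a : lipb (fun=> a).
Proof.
exists (cabs a) => [|x _]; first exact: cabs_ge0.
by split => // y _; rewrite subrr cabs0 mulr_ge0 ?cabs_ge0.
Qed.

Lemma lipbD f g : lipb f -> lipb g -> lipb (fun x => f x + g x).
Proof.
move=> [L L0 HL] [M M0 HM]; exists (L + M) => [|x Dx]; first exact: addr_ge0.
have [l1 l2] := HL _ Dx; have [m1 m2] := HM _ Dx; split => [|y Dy].
  by rewrite (le_trans (cabsD _ _))// lerD.
by rewrite opprD addrACA (le_trans (cabsD _ _))// mulrDl lerD ?l2 ?m2.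
Qed.

Lemma lipbM f g : lipb f -> lipb g -> lipb (fun x => f x * g x).
Proof.
move=> [L L0 HL] [M M0 HM]; exists (2 * (L * M)) => [|x Dx].
  by rewrite !mulr_ge0.
have [l1 l2] := HL _ Dx; have [m1 m2] := HM _ Dx; split => [|y Dy].
  have : cabs (f x * g x) <= L * M by rewrite cabsM ler_pM ?cabs_ge0.
  by have := mulr_ge0 L0 M0; lra.
have -> : f x * g x - f y * g y = f x * (g x - g y) + (f x - f y) * g y by ring.
rewrite (le_trans (cabsD _ _))// !cabsM.
have [m3 _] := HM _ Dy.
have := ler_pM (cabs_ge0 _) (cabs_ge0 _) l1 (m2 _ Dy).
have := ler_pM (cabs_ge0 _) (cabs_ge0 _) (l2 _ Dy) m3.
by move: (dd x y) => d; lra.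
Qed.

Lemma lipbX f n : lipb f -> lipb (fun x => f x ^+ n).
Proof.
move=> lf; elim: n => [|n IH]; first exact: lipb_cst.
by under eq_fun do rewrite exprS; exact: lipbM.
Qed.

Lemma lipb_sum (I : Type) (r : seq I) (F : I -> T -> R[i]) :
  (forall i, lipb (F i)) -> lipb (fun x => \sum_(i <- r) F i x).
Proof.
move=> H; elim: r => [|i r IH].
  by under eq_fun do rewrite big_nil; exact: lipb_cst.
by under eq_fun do rewrite big_cons; exact: lipbD.
Qed.

End Lipschitz.

(** * The two kernels in the variables s, t, u *)

Section Kernels.
Variable R : realType.
Implicit Types (s t u a b : R[i]) (z w : C2 R) (k : nat).

(* [t^-1] times the numerator of the Bergman kernel, with [u = s ^ k / t]. *)
Definition Ek k s t u := pk k s * (t + u) + qk k s.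

Definition polydisc : set (R[i] * R[i] * R[i]) :=
  [set x | [/\ cabs x.1.1 <= 1, cabs x.1.2 <= 1 & cabs x.2 <= 1]].
Definition dist3 (x y : R[i] * R[i] * R[i]) : R :=
  cabs (x.1.1 - y.1.1) + cabs (x.1.2 - y.1.2) + cabs (x.2 - y.2).

Lemma dist3_ge0 x y : 0 <= dist3 x y.
Proof. by rewrite !addr_ge0 ?cabs_ge0. Qed.

(** Boundedness controls [Kk] by [Pk] everywhere. The Lipschitz part carries [Ek_ge1] from
    nonnegative arguments to nearby complex ones, the source of the lower bound for [Kk] off the
    diagonal. *)
Lemma Ek_lipb k : lipb polydisc dist3 (fun x => Ek k x.1.1 x.1.2 x.2).
Proof.
have l1 : lipb polydisc dist3 (fun x => x.1.1).
  exists 1 => // x [h1 h2 h3]; split => // y _; rewrite mul1r /dist3 -addrA lerDl.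
  by rewrite addr_ge0 ?cabs_ge0.
have l2 : lipb polydisc dist3 (fun x => x.1.2).
  exists 1 => // x [h1 h2 h3]; split => // y _; rewrite mul1r /dist3.
  by rewrite addrAC lerDr addr_ge0 ?cabs_ge0.
have l3 : lipb polydisc dist3 (fun x => x.2).
  exists 1 => // x [h1 h2 h3]; split => // y _; rewrite mul1r /dist3 lerDr.
  by rewrite addr_ge0 ?cabs_ge0.
have d0 := dist3_ge0.
apply: lipbD => //; last first.
  apply: lipb_sum => // j; apply: lipbM => //; last exact: lipbX.
  apply: lipbD => //; first exact: lipb_cst.
  by apply: lipbM => //; [exact: lipb_cst|exact: lipbX].
apply: lipbM => //; last exact: lipbD.
apply: lipb_sum => // j; apply: lipbM => //; [exact: lipb_cst|exact: lipbX].
Qed.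

(** All coefficients are nonnegative, and the term j = 1 of [qk] contributes the constant 1. *)
Lemma Ek_ge1 k s t u : (0 < k)%N -> 0 <= s -> 0 <= t -> 0 <= u -> 1 <= cabs (Ek k s t u).
Proof.
move=> k0 s0 t0 u0.
have p0 : 0 <= pk k s by apply: sumr_ge0 => j _; rewrite mulr_ge0 ?ler0n ?exprn_ge0.
have q1 : 1 <= qk k s.
  rewrite /qk big_ltn//= exp1n expr0 mulr1 -addrA lerDl addr_ge0//.
    by rewrite mulr_ge0 ?ler0n ?exprn_ge0.
  by apply: sumr_ge0 => j _; rewrite mulr_ge0 ?exprn_ge0// addr_ge0 ?ler0n// mulr_ge0 ?ler0n ?exprn_ge0.
have E1 : 1 <= Ek k s t u by rewrite (le_trans q1)// /Ek lerDr mulr_ge0// addr_ge0.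
by rewrite -lecR -norm_cabs ger0_norm// (le_trans ler01).
Qed.

Lemma oneBX_le (x : R) n : 0 <= x -> x <= 1 -> 1 - x ^+ n <= n%:R * (1 - x).
Proof.
move=> x0 x1; elim: n => [|n IH]; first by rewrite expr0 subrr mul0r.
have : 0 <= n%:R * (1 - x) * (1 - x) by rewrite !mulr_ge0 ?ler0n ?subr_ge0.
by rewrite exprS -natr1; have := ler_wpM2l x0 IH; lra.
Qed.

Lemma oneB_neq0 s : cabs s < 1 -> 1 - s != 0.
Proof.
by move=> s1; rewrite subr_eq0; apply/eqP => E; move: s1; rewrite -E cabs1 ltxx.
Qed.

Definition sk z w := cz1 z * (cz1 w)^*.
Definition tk z w := cz2 z * (cz2 w)^*.
Definition uk k z w := sk z w ^+ k / tk z w.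

Lemma HkP k z : Hk k z -> cabs (cz1 z) ^+ k < cabs (cz2 z) /\ cabs (cz2 z) < 1.
Proof. by move=> /andP[]. Qed.

Lemma Hk_cz2 k z : Hk k z -> 0 < cabs (cz2 z).
Proof. by move=> /HkP[h _]; rewrite (le_lt_trans _ h)// exprn_ge0 ?cabs_ge0. Qed.

Lemma Hk_cz1 k z : (0 < k)%N -> Hk k z -> cabs (cz1 z) < 1.
Proof.
move=> k0 /HkP[h1 h2]; rewrite ltNge; apply/negP => H.
by have := exprn_ege1 k H; lra.
Qed.

Lemma tk_neq0 k z w : Hk k z -> Hk k w -> tk z w != 0.
Proof.
move=> /Hk_cz2 hz /Hk_cz2 hw.
by rewrite -cabs_gt0 /tk cabsM cabs_conj mulr_gt0.
Qed.

Lemma cabs_tk k z w : Hk k z -> Hk k w -> cabs (tk z w) < 1.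
Proof.
move=> /HkP[_ hz] /HkP[_ hw]; rewrite /tk cabsM cabs_conj.
by rewrite mulr_ilt1 ?cabs_ge0.
Qed.

Lemma cabs_uk k z w : Hk k z -> Hk k w -> cabs (uk k z w) < 1.
Proof.
move=> Hz Hw; rewrite /uk /sk /tk cabs_div cabsX !cabsM !cabs_conj exprMn.
have [hz _] := HkP Hz; have [hw _] := HkP Hw.
rewrite ltr_pdivrMr ?mulr_gt0 ?(Hk_cz2 Hz) ?(Hk_cz2 Hw)// mul1r.
by rewrite ltr_pM ?exprn_ge0 ?cabs_ge0.
Qed.

Lemma cabs_sk k z w : (0 < k)%N -> Hk k z -> Hk k w -> cabs (sk z w) < 1.
Proof.
move=> k0 /(Hk_cz1 k0) hz /(Hk_cz1 k0) hw; rewrite /sk cabsM cabs_conj.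
by rewrite mulr_ilt1 ?cabs_ge0.
Qed.

Lemma PkE k z w : Hk k z -> Hk k w ->
  Pk k z w = (tk z w * (1 - tk z w) ^+ 2 * (1 - uk k z w) ^+ 2)^-1.
Proof.
move=> Hz Hw; have t0 := tk_neq0 Hz Hw.
rewrite /Pk -/(sk z w) -/(tk z w).
have -> : tk z w - sk z w ^+ k = tk z w * (1 - uk k z w).
  by rewrite /uk mulrBr mulr1 mulrCA divff// mulr1.
have t1 := oneB_neq0 (cabs_tk Hz Hw); have u1 := oneB_neq0 (cabs_uk Hz Hw).
by field; rewrite t0 t1 u1.
Qed.

Lemma KkE k z w : (0 < k)%N -> Hk k z -> Hk k w ->
  Kk k z w = Pk k z w * Ek k (sk z w) (tk z w) (uk k z w) / ((k%:R * pi ^+ 2)%:C)%C.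
Proof.
move=> k0 Hz Hw; have t0 := tk_neq0 Hz Hw.
rewrite /Kk /Pk -/(sk z w) -/(tk z w).
have -> : pk k (sk z w) * tk z w ^+ 2 + qk k (sk z w) * tk z w + sk z w ^+ k * pk k (sk z w) =
   tk z w * Ek k (sk z w) (tk z w) (uk k z w).
  by rewrite /Ek /uk; field.
rewrite -complexr0; set c := (_ +i* 0)%C; move: (Ek _ _ _ _) (sk _ _ ^+ k) => E v.
by rewrite !invfM; ring.
Qed.

Definition diagP k w : R := (cabs (cz2 w) ^+ 2 * (1 - cabs (cz2 w) ^+ 2) ^+ 2 *
  (1 - cabs (cz1 w) ^+ (2 * k) / cabs (cz2 w) ^+ 2) ^+ 2)^-1.

Lemma kpi_gt0 k : (0 < k)%N -> 0 < k%:R * pi ^+ 2 :> R.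
Proof. by move=> k0; rewrite mulr_gt0 ?ltr0n// exprn_gt0// pi_gt0. Qed.

Lemma diag_uk k w : uk k w w = ((cabs (cz1 w) ^+ (2 * k) / cabs (cz2 w) ^+ 2)%:C)%C.
Proof.
by rewrite /uk /sk /tk !mulc_conj exprM -rmorphXn /= -fmorphV -rmorphM.
Qed.

Lemma PkwwE k w : Hk k w -> Pk k w w = ((diagP k w)%:C)%C.
Proof.
move=> Hw; rewrite PkE// diag_uk /tk mulc_conj /diagP.
by rewrite !(rmorphXn, rmorphM, rmorphB, rmorph1, fmorphV) /=.
Qed.

Lemma diag_u_lt1 k w : Hk k w -> 0 <= cabs (cz1 w) ^+ (2 * k) / cabs (cz2 w) ^+ 2 < 1.
Proof.
move=> Hw; have := cabs_uk Hw Hw; rewrite diag_uk cabs_real ger0_norm.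
  by move=> ->; rewrite andbT divr_ge0 ?exprn_ge0 ?cabs_ge0.
by rewrite divr_ge0 ?exprn_ge0 ?cabs_ge0.
Qed.

Lemma diagP_gt0 k w : Hk k w -> 0 < diagP k w.
Proof.
move=> Hw; have /andP[_ u1] := diag_u_lt1 Hw; have [_ t1] := HkP Hw.
have t2 : cabs (cz2 w) ^+ 2 < 1 by rewrite expr_lt1 ?cabs_ge0.
by rewrite invr_gt0 !mulr_gt0 ?exprn_gt0 ?subr_gt0 ?(Hk_cz2 Hw).
Qed.

(** On the diagonal s, t and u are nonnegative reals, so the factor [Ek] is real, at least 1, and
    bounded on the polydisc. *)
Lemma ReKk_bounds k : (0 < k)%N -> exists2 M : R, 0 < M & forall w, Hk k w ->
  diagP k w / (k%:R * pi ^+ 2) <= complex.Re (Kk k w w) <= M * diagP k w.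
Proof.
move=> k0; have [L L0 HL] := Ek_lipb k.
exists ((L + 1) / (k%:R * pi ^+ 2)) => [|w Hw].
  by rewrite divr_gt0 ?kpi_gt0// ltr_wpDl.
have sp : 0 <= sk w w by rewrite /sk mulc_conj ler0c exprn_ge0 ?cabs_ge0.
have tp : 0 <= tk w w by rewrite /tk mulc_conj ler0c exprn_ge0 ?cabs_ge0.
have up : 0 <= uk k w w.
  by rewrite diag_uk ler0c; case/andP: (diag_u_lt1 Hw).
have E1 := Ek_ge1 k0 sp tp up.
have [E2 _] := HL (sk w w, tk w w, uk k w w) (And3 (ltW (cabs_sk k0 Hw Hw)) (ltW (cabs_tk Hw Hw)) (ltW (cabs_uk Hw Hw))).
have Er : Ek k (sk w w) (tk w w) (uk k w w) = ((cabs (Ek k (sk w w) (tk w w) (uk k w w)))%:C)%C.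
  rewrite -norm_cabs ger0_norm// /Ek addr_ge0//.
    rewrite mulr_ge0 ?addr_ge0//; apply: sumr_ge0 => j _; rewrite mulr_ge0 ?ler0n ?exprn_ge0//.
  apply: sumr_ge0 => j _; rewrite mulr_ge0 ?exprn_ge0// addr_ge0 ?ler0n// mulr_ge0 ?ler0n ?exprn_ge0//.
rewrite KkE// PkwwE// Er -fmorphV -!rmorphM /=.
have D0 := diagP_gt0 Hw; have kp := kpi_gt0 k0.
apply/andP; split; first by rewrite ler_pM2r ?invr_gt0// ler_peMr// ltW.
have -> : (L + 1) / (k%:R * pi ^+ 2) * diagP k w = diagP k w * (L + 1) / (k%:R * pi ^+ 2).
  by ring.
rewrite ler_wpM2r ?invr_ge0 ?(ltW kp)// ler_wpM2l ?(ltW D0)//.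
by move: E2 => /= E2; lra.
Qed.

Lemma cabs_Kk_le k : (0 < k)%N -> exists2 M : R, 0 < M & forall z w, Hk k z -> Hk k w ->
  cabs (Kk k z w) <= M * cabs (Pk k z w).
Proof.
move=> k0; have [L L0 HL] := Ek_lipb k; have kp := kpi_gt0 k0.
exists ((L + 1) / (k%:R * pi ^+ 2)) => [|z w Hz Hw].
  by rewrite divr_gt0// ltr_wpDl.
have [E2 _] := HL (sk z w, tk z w, uk k z w) (And3 (ltW (cabs_sk k0 Hz Hw)) (ltW (cabs_tk Hz Hw)) (ltW (cabs_uk Hz Hw))).
rewrite KkE// cabs_div cabsM cabs_real gtr0_norm// [leRHS]mulrC -mulrA ler_wpM2l ?cabs_ge0//.
by rewrite ler_wpM2r ?invr_ge0 ?(ltW kp)//; move: E2 => /= E2; lra.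
Qed.

Lemma cabs_subXX a b k : cabs a <= 1 -> cabs b <= 1 ->
  cabs (a ^+ k - b ^+ k) <= k%:R * cabs (a - b).
Proof.
move=> a1 b1; rewrite subrXX cabsM mulrC ler_wpM2r ?cabs_ge0//.
rewrite (le_trans (cabs_sum _ _ _))// -[k in k%:R]card_ord -sumr_const.
apply: ler_sum => i _; rewrite cabsM !cabsX.
by rewrite mulr_ile1 ?exprn_ge0 ?cabs_ge0// exprn_ile1 ?cabs_ge0.
Qed.

Lemma near_ptP k (eps : R) a b w : (0 < k)%N -> 0 < eps <= 1 / 4 ->
  cabs a < 1 -> 0 < cabs b < 1 -> near_pt k eps a b w ->
  exists x y : R[i], [/\ cz1 w = x * y, cz2 w = y ^+ k, y != 0,
    cabs (x - a) <= 2 * eps * (1 - cabs a) & cabs (y - b) <= eps * cabs b].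
Proof.
move=> k0 /andP[e0 e4] a1 /andP[b0 b1] [r [rk r1 w2 w1]].
have bn : b != 0 by rewrite -cabs_gt0.
have rl : 3 / 4 <= cabs r.
  by have := cabs_tri 1 r 0; rewrite !subr0 cabs1 (cabsC 1); lra.
have rn : r != 0 by rewrite -cabs_gt0; lra.
exists (cz1 w / (b * r)), (b * r); split.
- by rewrite divfK// mulf_neq0.
- by rewrite exprMn rk mulrC divfK// expf_neq0.
- by rewrite mulf_neq0.
- have -> : cz1 w / (b * r) - a = (cz1 w - a * b * r) / (b * r) by field; rewrite rn bn.
  rewrite cabs_div cabsM ler_pdivrMr ?mulr_gt0//; last by rewrite (lt_le_trans _ rl)//; lra.
  rewrite (le_trans w1)//.
  have A0 : 0 <= eps * (1 - cabs a) * cabs b.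
    by rewrite !mulr_ge0 ?(ltW e0) ?(ltW b0)// subr_ge0 ltW.
  have := ler_wpM2l A0 rl.
  rewrite (_ : 2 * eps * (1 - cabs a) * (cabs b * cabs r) =
    2 * (eps * (1 - cabs a) * cabs b * cabs r)); last by ring.
  by move: A0; set X := eps * _ * _; lra.
- have -> : b * r - b = b * (r - 1) by ring.
  by rewrite cabsM mulrC ler_wpM2r ?(ltW b0).
Qed.

Lemma pt_Hk k a b : (0 < k)%N -> cabs a < 1 -> 0 < cabs b < 1 -> Hk k (pt (a * b) (b ^+ k)).
Proof.
move=> k0 a1 /andP[b0 b1]; rewrite /Hk /= cz1_pt cz2_pt cabsX cabsM exprMn.
have lt1 (c : R) : 0 <= c -> c < 1 -> c ^+ k < 1.
  by move=> c0 c1; rewrite exprn_ilt1// -lt0n.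
by rewrite gtr_pMl ?exprn_gt0// !lt1 ?cabs_ge0.
Qed.

Lemma uk_pt k a b w x y : b != 0 -> y != 0 -> cz1 w = x * y -> cz2 w = y ^+ k ->
  uk k (pt (a * b) (b ^+ k)) w = (a * x^* ) ^+ k.
Proof.
move=> b0 y0 w1 w2; rewrite /uk /sk /tk cz1_pt cz2_pt w1 w2.
have yc : y^* != 0 by rewrite conjC_eq0.
rewrite rmorphM rmorphXn /= -exprMn -expr_div_n; congr (_ ^+ _).
by field; rewrite b0 yc.
Qed.

(** The factor |w2|^2 cancels between |P(z, w)|^2 and P(w, w), and u = (a conj(x))^k makes |1 - u|
    at most of the order 1 - |a|. Only the factor in t is left open: [T1] bounds 1 - t from above at
    (z, w), and [T2] bounds 1 - |w2|^2 from below. They are later taken of order 1 - |b| near z and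
    constant over the ring. *)
Lemma Pk_lower k a b w x y (T1 T2 : R) : (0 < k)%N -> cabs a < 1 -> 0 < cabs b < 1 ->
  Hk k w -> cz1 w = x * y -> cz2 w = y ^+ k -> y != 0 ->
  cabs (x - a) <= (1 - cabs a) / 2 ->
  cabs (1 - tk (pt (a * b) (b ^+ k)) w) <= T1 ->
  0 < T2 -> T2 <= 1 - cabs (cz2 w) ^+ 2 ->
  diagP k w * (T2 ^+ 2 / (4 * (3 * k%:R) ^+ 4 * T1 ^+ 4 * (cabs b ^+ k * (1 - cabs a)) ^+ 2)) <=
    cabs (Pk k (pt (a * b) (b ^+ k)) w) ^+ 2.
Proof.
move=> k0 a1 b01 Hw w1 w2 y0 xa T1t T20 T2w; have [b0 b1] := andP b01.
have bn : b != 0 by rewrite -cabs_gt0.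
have Hz := pt_Hk k0 a1 b01.
set z := pt _ _ in Hz T1t *.
have A0 : 0 < 1 - cabs a by rewrite subr_gt0.
have K1 : 1 <= k%:R :> R by rewrite ler1n.
have tE : cabs (tk z w) = cabs b ^+ k * cabs (cz2 w).
  by rewrite /tk cabsM cabs_conj cz2_pt cabsX.
have w20 := Hk_cz2 Hw.
have x1 : cabs x <= 1.
  by have := cabs_tri x a 0; rewrite !subr0; lra.
have uE := uk_pt a bn y0 w1 w2 : uk k z w = _.
have x1' : cabs (a * x^* ) <= 1 by rewrite cabsM cabs_conj mulr_ile1 ?cabs_ge0// ltW.
have U : cabs (1 - uk k z w) <= 3 * k%:R * (1 - cabs a).
  rewrite uE -(expr1n _ k) (le_trans (cabs_subXX _ _ _))// ?cabs1//.
  rewrite mulrAC mulrC ler_wpM2r ?ler0n//.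
  (* The two summands are at most 2 (1 - |a|) and (1 - |a|) / 2, hence the constant 3; the power k
     costs the factor k. *)
  have -> : 1 - a * x^* = (1 - a * a^* ) + a * (a - x)^* by rewrite rmorphB /=; ring.
  rewrite (le_trans (cabsD _ _))// cabsM cabs_conj mulc_conj.
  rewrite -(rmorph1 (real_complex R)) -rmorphB cabs_real ger0_norm; last first.
    by rewrite subr_ge0 exprn_ile1 ?cabs_ge0 ?ltW.
  have -> : 1 - cabs a ^+ 2 = (1 + cabs a) * (1 - cabs a) by ring.
  have := ler_wpM2r (ltW A0) (_ : 1 + cabs a <= 2).
  have := ler_pM (cabs_ge0 a) (cabs_ge0 (a - x)) (ltW a1) (lexx _).
  by rewrite (cabsC a); lra.
have vE : cabs (cz1 w) ^+ (2 * k) / cabs (cz2 w) ^+ 2 = cabs x ^+ (2 * k).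
  rewrite w1 w2 cabsM cabsX exprMn -exprM (mulnC k) mulfK// expf_neq0//.
  by rewrite cabs_eq0.
have V : (1 - cabs a) / 2 <= 1 - cabs (cz1 w) ^+ (2 * k) / cabs (cz2 w) ^+ 2.
  rewrite vE.
  have : cabs x ^+ (2 * k) <= cabs x ^+ 1 by rewrite ler_wiXn2l ?cabs_ge0// muln_gt0.
  by rewrite expr1; have := cabs_tri x a 0; rewrite !subr0; lra.
have t1 : 0 < cabs (1 - tk z w).
  have := cabs_tri 1 (tk z w) 0; rewrite !subr0 cabs1.
  by have := cabs_tk Hz Hw; lra.
have u1 : 0 < cabs (1 - uk k z w).
  have := cabs_tri 1 (uk k z w) 0; rewrite !subr0 cabs1.
  by have := cabs_uk Hz Hw; lra.
have T10 : 0 < T1 by rewrite (lt_le_trans t1).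
set A := 1 - cabs a in A0 U V xa *.
have zk : 0 < cabs b ^+ k by rewrite exprn_gt0.
have kk : 0 < 3 * k%:R :> R by lra.
rewrite PkE// cabsV (cabsM (_ * _)) (cabsM (tk _ _)) !(cabsX _ 2) tE.
have D1 : diagP k w <= (cabs (cz2 w) ^+ 2 * T2 ^+ 2 * (A / 2) ^+ 2)^-1.
  have A2 : 0 < A / 2 by lra.
  have V0 := lt_le_trans A2 V; have W0 := lt_le_trans T20 T2w.
  rewrite lef_pV2 ?posrE ?mulr_gt0 ?exprn_gt0//.
  have sq2 (c d : R) : 0 < c -> c <= d -> c ^+ 2 <= d ^+ 2.
    by move=> c0 cd; rewrite lerXn2r ?nnegrE ?(ltW c0)// (le_trans (ltW c0)).
  apply: ler_pM; [by apply: mulr_ge0; exact: sqr_ge0|exact: sqr_ge0| |exact: sq2].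
  by apply: ler_wpM2l; [exact: sqr_ge0|exact: sq2].
apply: (@le_trans _ _ ((cabs (cz2 w) ^+ 2 * T2 ^+ 2 * (A / 2) ^+ 2)^-1 *
   (T2 ^+ 2 / (4 * (3 * k%:R) ^+ 4 * T1 ^+ 4 * (cabs b ^+ k * A) ^+ 2)))).
  apply: ler_wpM2r => //; apply: divr_ge0; first exact: sqr_ge0.
  rewrite mulr_ge0 ?sqr_ge0// mulr_ge0 ?exprn_ge0 ?(ltW T10)// mulr_ge0 ?exprn_ge0 ?(ltW kk)//.
have -> : (cabs (cz2 w) ^+ 2 * T2 ^+ 2 * (A / 2) ^+ 2)^-1 *
   (T2 ^+ 2 / (4 * (3 * k%:R) ^+ 4 * T1 ^+ 4 * (cabs b ^+ k * A) ^+ 2)) =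
   ((cabs b ^+ k * cabs (cz2 w) * T1 ^+ 2 * (3 * k%:R * A) ^+ 2)^-1) ^+ 2.
  field; rewrite !gt_eqF//; lra.
move: (3 * k%:R) kk U => q kk U.
have p1 : 0 < cabs b ^+ k * cabs (cz2 w) * T1 ^+ 2 * (q * A) ^+ 2.
  by apply: mulr_gt0; rewrite ?exprn_gt0// !mulr_gt0// exprn_gt0.
have p2 : 0 < cabs b ^+ k * cabs (cz2 w) * cabs (1 - tk z w) ^+ 2 * cabs (1 - uk k z w) ^+ 2.
  by apply: mulr_gt0; rewrite ?exprn_gt0// !mulr_gt0// exprn_gt0.
rewrite lerXn2r ?nnegrE ?invr_ge0 ?(ltW p1) ?(ltW p2)// lef_pV2 ?posrE//.
have sq2 (c d : R) : 0 < c -> c <= d -> c ^+ 2 <= d ^+ 2.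
  by move=> c0 cd; rewrite lerXn2r ?nnegrE ?(ltW c0)// (le_trans (ltW c0)).
apply: ler_pM; [|exact: sqr_ge0| |exact: sq2].
  by apply: mulr_ge0; [rewrite mulr_ge0 ?ltW|exact: sqr_ge0].
by apply: ler_wpM2l; [rewrite mulr_ge0 ?ltW|exact: sq2].
Qed.

Definition kernel_weight (M : C2 R -> C2 R -> R[i]) k z w : R :=
  cabs (M z w) ^+ 2 / complex.Re (Kk k w w).

(** In both regimes (s, t, u) is close to a nonnegative real triple, so that [Ek] stays at least
    1/2. For w near z the triple is that of the pair (z, z). For small b and w over the ring it is
    (0, 0, |a|^(2k)): s and t are small with b, whereas u = (a conj(x))^k involves neither b nor
    b'. *)
Lemma kernel_lower k : (0 < k)%N -> exists eps c e0 : R,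
  [/\ 0 < eps <= 1 / 4, 0 < c, 0 < e0 <= 1 / 8 &
  forall a b w, cabs a < 1 -> 0 < cabs b < 1 -> Hk k w ->
  forall M : C2 R -> C2 R -> R[i], M = Pk k \/ M = Kk k ->
  (near_pt k eps a b w -> c / (cabs b ^+ k * (1 - cabs b) * (1 - cabs a)) ^+ 2 <=
     kernel_weight M k (pt (a * b) (b ^+ k)) w) /\
  (cabs b <= e0 -> forall b', 1 / 4 <= cabs b' <= 1 / 2 -> near_pt k eps a b' w ->
     c / (cabs b ^+ k * (1 - cabs a)) ^+ 2 <=
     kernel_weight M k (pt (a * b) (b ^+ k)) w)].
Proof.
move=> k0; have [L L0 HL] := Ek_lipb k; have [M0 M00 HM0] := ReKk_bounds k0.
have K1 : 1 <= k%:R :> R by rewrite ler1n.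
have kp := kpi_gt0 k0.
(* For w near z the variables s, t and u move by at most 5 eps, eps and 2 k eps; with the Lipschitz
   constant L this changes [Ek] by at most 1/4. *)
set eps := Num.min (1 / 4) (1 / (4 * (L + 1) * (6 + 2 * k%:R))).
have L10 : 0 < 4 * (L + 1) * (6 + 2 * k%:R) by rewrite mulr_gt0//; lra.
have eps0 : 0 < eps by rewrite lt_min; apply/andP; split; [lra|rewrite divr_gt0].
have [eps4 epsL] : eps <= 1 / 4 /\ eps <= 1 / (4 * (L + 1) * (6 + 2 * k%:R)).
  by rewrite !ge_min !lexx orbT.
have epsL' : L * ((6 + 2 * k%:R) * eps) <= 1 / 4.
  move: epsL; rewrite ler_pdivlMr// => H.
  have : 0 <= (6 + 2 * k%:R) * eps by rewrite mulr_ge0 ?(ltW eps0)//; lra.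
  by lra.
(* Over the ring |s| and |t| are at most e0, which accounts for another change of at most 1/4. The
   bound 1/8 is the radius up to which [removable_bound] will be applied. *)
set e0 := Num.min (1 / 8) (1 / (8 * (L + 1))).
have L20 : 0 < 8 * (L + 1) by lra.
have e00 : 0 < e0 by rewrite lt_min; apply/andP; split; [lra|rewrite divr_gt0].
have [e08 e0L] : e0 <= 1 / 8 /\ e0 <= 1 / (8 * (L + 1)) by rewrite !ge_min !lexx orbT.
have e0L' : L * (2 * e0) <= 1 / 4 by move: e0L; rewrite ler_pdivlMr// => H; lra.
set kp' := k%:R * pi ^+ 2 in kp.
(* A lower bound for |M| / |P|: 1 if M is [Pk], and 1/2 divided by k pi^2 if M is [Kk]. *)
set m := Num.min 1 (1 / (2 * kp')).
have m0 : 0 < m by rewrite lt_min ltr01 divr_gt0// mulr_gt0.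
set q := 3 * k%:R : R.
have q0 : 0 < q by rewrite /q; lra.
have q1 : 1 <= q by rewrite /q; lra.
(* The constants of [Pk_lower] for T1 = q (1 - |b|), T2 = 3/4 (1 - |b|), and in [c2] for T1 = 2, T2
   = 3/8. *)
set c1 := 9 / 16 / (4 * q ^+ 4 * q ^+ 4).
set c2 := 9 / 64 / (4 * q ^+ 4 * 2 ^+ 4).
have c10 : 0 < c1 by rewrite !divr_gt0 ?mulr_gt0 ?exprn_gt0 ?ltr0n.
have c20 : 0 < c2 by rewrite !divr_gt0 ?mulr_gt0 ?exprn_gt0 ?ltr0n.
set c := Num.min c1 c2 * m ^+ 2 / M0.
exists eps, c, e0; split; [by rewrite eps0| |by rewrite e00|].
  by rewrite !mulr_gt0 ?invr_gt0 ?exprn_gt0// lt_min c10.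
move=> a b w a1 b01 Hw M HM; have [b0 b1] := andP b01.
have Hz := pt_Hk k0 a1 b01.
set z := pt _ _ in Hz *.
have A0 : 0 < 1 - cabs a by rewrite subr_gt0.
have bn : b != 0 by rewrite -cabs_gt0.
have zk : 0 < cabs b ^+ k by rewrite exprn_gt0.
have D0 := diagP_gt0 Hw.
have [_ RK] := andP (HM0 _ Hw).
have RK0 : 0 < complex.Re (Kk k w w).
  by have [RK0 _] := andP (HM0 _ Hw); rewrite (lt_le_trans _ RK0)// divr_gt0.
have MP : 1 / 2 <= cabs (Ek k (sk z w) (tk z w) (uk k z w)) -> m * cabs (Pk k z w) <= cabs (M z w).
  move=> E2; case: HM => ->.
    by rewrite ler_piMl ?cabs_ge0// ge_min lexx.
  rewrite KkE// cabs_div cabsM cabs_real gtr0_norm// mulrC -mulrA ler_wpM2l ?cabs_ge0//.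
  apply: (@le_trans _ _ (1 / (2 * kp'))); first by rewrite ge_min lexx orbT.
  by rewrite invfM mulrA ler_wpM2r ?invr_ge0 ?(ltW kp)//.
have fin (c3 X : R) : 0 < X -> 0 < c3 -> Num.min c1 c2 <= c3 ->
    1 / 2 <= cabs (Ek k (sk z w) (tk z w) (uk k z w)) ->
    diagP k w * (c3 / X) <= cabs (Pk k z w) ^+ 2 -> c / X <= kernel_weight M k z w.
  move=> X0 c30 c3c E2 H; rewrite /kernel_weight ler_pdivlMr//.
  have mp := MP E2.
  apply: (@le_trans _ _ (m ^+ 2 * cabs (Pk k z w) ^+ 2)); last first.
    by rewrite -exprMn lerXn2r ?nnegrE ?cabs_ge0// mulr_ge0 ?cabs_ge0 ?(ltW m0).
  apply: (@le_trans _ _ (m ^+ 2 * (diagP k w * (c3 / X)))); last first.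
    by rewrite ler_wpM2l ?sqr_ge0.
  apply: (@le_trans _ _ (c / X * (M0 * diagP k w))).
    rewrite ler_wpM2l// divr_ge0 ?(ltW X0)// divr_ge0 ?(ltW M00)// mulr_ge0 ?sqr_ge0//.
    by rewrite le_min !ltW.
  rewrite (_ : c / X * (M0 * diagP k w) = m ^+ 2 * (diagP k w * (Num.min c1 c2 / X))).
    by rewrite ler_wpM2l ?sqr_ge0// ler_wpM2l ?(ltW D0)// ler_wpM2r ?invr_ge0 ?(ltW X0).
  by rewrite /c; field; rewrite !gt_eqF.
have Efin (s0 t0 : R[i]) : 0 <= s0 -> 0 <= t0 -> cabs s0 <= 1 -> cabs t0 <= 1 ->
    L * (cabs (sk z w - s0) + cabs (tk z w - t0) + cabs (uk k z w - (a * a^* ) ^+ k)) <= 1 / 2 ->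
    1 / 2 <= cabs (Ek k (sk z w) (tk z w) (uk k z w)).
  move=> s00 t00 s01 t01 H.
  have u00 : 0 <= (a * a^* ) ^+ k by rewrite exprn_ge0// mul_conjC_ge0.
  have u01 : cabs ((a * a^* ) ^+ k) <= 1.
    by rewrite cabsX exprn_ile1 ?cabs_ge0// cabsM cabs_conj mulr_ile1 ?cabs_ge0 ?ltW.
  have E1 := Ek_ge1 k0 s00 t00 u00.
  have [_ E2] := HL (sk z w, tk z w, uk k z w) (And3 (ltW (cabs_sk k0 Hz Hw)) (ltW (cabs_tk Hz Hw)) (ltW (cabs_uk Hz Hw))).
  have := E2 (s0, t0, (a * a^* ) ^+ k) (And3 s01 t01 u01).
  rewrite /dist3 /= => E3; have {H}E3 := le_trans E3 H.
  have := cabs_tri (Ek k s0 t0 ((a * a^* ) ^+ k)) (Ek k (sk z w) (tk z w) (uk k z w)) 0.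
  by rewrite !subr0 (cabsC (Ek k s0 _ _)); move: E1 E3; clear; lra.
have e14 : 0 < eps <= 1 / 4 by rewrite eps0.
have qE : q = 3 * k%:R by [].
have c1E : c1 = 9 / 16 / (4 * q ^+ 4 * q ^+ 4) by [].
have c2E : c2 = 9 / 64 / (4 * q ^+ 4 * 2 ^+ 4) by [].
have c1m : Num.min c1 c2 <= c1 by rewrite ge_min lexx.
have c2m : Num.min c1 c2 <= c2 by rewrite ge_min lexx orbT.
clearbody c; clear HL HM0 HM MP RK RK0 epsL e0L L10 L20 m0 M00 kp m.
clearbody q c1 c2 eps e0 kp'.
have bb : 0 < 1 - cabs b by rewrite subr_gt0.
have fin1 : 1 / 2 <= cabs (Ek k (sk z w) (tk z w) (uk k z w)) ->
    diagP k w * ((3 / 4 * (1 - cabs b)) ^+ 2 / (4 * (3 * k%:R) ^+ 4 * (q * (1 - cabs b)) ^+ 4 *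
      (cabs b ^+ k * (1 - cabs a)) ^+ 2)) <= cabs (Pk k z w) ^+ 2 ->
    c / (cabs b ^+ k * (1 - cabs b) * (1 - cabs a)) ^+ 2 <= kernel_weight M k z w.
  move=> E2 PL; apply: (fin c1) => //; first by rewrite exprn_gt0// !mulr_gt0.
  rewrite (le_trans _ PL)// ler_wpM2l ?(ltW D0)// le_eqVlt; apply/orP; left; apply/eqP.
  by rewrite c1E -qE; field; rewrite !gt_eqF.
have fin2 : 1 / 2 <= cabs (Ek k (sk z w) (tk z w) (uk k z w)) ->
    diagP k w * ((3 / 8) ^+ 2 / (4 * (3 * k%:R) ^+ 4 * 2 ^+ 4 *
      (cabs b ^+ k * (1 - cabs a)) ^+ 2)) <= cabs (Pk k z w) ^+ 2 ->
    c / (cabs b ^+ k * (1 - cabs a)) ^+ 2 <= kernel_weight M k z w.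
  move=> E2 PL; apply: (fin c2) => //; first by rewrite exprn_gt0// !mulr_gt0.
  rewrite (le_trans _ PL)// ler_wpM2l ?(ltW D0)// le_eqVlt; apply/orP; left; apply/eqP.
  by rewrite c2E -qE; field; rewrite !gt_eqF.
clear fin c1E c2E c10 c20 c1m c2m.
have hub x y : cz1 w = x * y -> cz2 w = y ^+ k -> y != 0 -> cabs (x - a) <= 2 * eps * (1 - cabs a) ->
    cabs (uk k z w - (a * a^* ) ^+ k) <= 2 * k%:R * eps /\ cabs x <= 1 /\ cabs (x - a) <= (1 - cabs a) / 2
    /\ cabs (x - a) <= 2 * eps.
  move=> w1 w2 y0 xa.
  have xa2 : cabs (x - a) <= (1 - cabs a) / 2.
    by rewrite (le_trans xa)// mulrC ler_wpM2l ?(ltW A0)//; move: eps4; clear; lra.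
  have x1 : cabs x <= 1.
    by have := cabs_tri x a 0; rewrite !subr0; move: xa2 A0; clear; lra.
  have xa3 : cabs (x - a) <= 2 * eps.
    by rewrite (le_trans xa)// ler_piMr ?mulr_ge0 ?(ltW eps0)//; rewrite lerBlDr lerDl cabs_ge0.
  split=> //; rewrite (uk_pt a bn y0 w1 w2) (le_trans (cabs_subXX _ _ _))//.
  - by rewrite cabsM cabs_conj mulr_ile1 ?cabs_ge0// ltW.
  - by rewrite cabsM cabs_conj mulr_ile1 ?cabs_ge0// ltW.
  rewrite -mulrA mulrCA ler_wpM2l ?ler0n// -mulrBr -rmorphB cabsM cabs_conj.
  by rewrite (le_trans _ xa3)// ler_piMl ?cabs_ge0// ltW.
split.
  move=> nr; have [x [y [w1 w2 y0 xa yb]]] := near_ptP k0 e14 a1 b01 nr.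
  have [ub [x1 [xa2 xa3]]] := hub _ _ w1 w2 y0 xa.
  case: nr => r [_ _ w2b _].
  have zk1 : cabs b ^+ k <= 1 by rewrite exprn_ile1 ?cabs_ge0// ltW.
  have tb : cabs (cz2 w - b ^+ k) <= eps * (1 - cabs b).
    by rewrite (le_trans w2b)// ler_piMr// mulr_ge0 ?(ltW eps0) ?(ltW bb).
  have tb' : cabs (cz2 w - b ^+ k) <= eps.
    by rewrite (le_trans tb)// ler_piMr ?(ltW eps0)//; rewrite lerBlDr lerDl cabs_ge0.
  have tE : tk z w = b ^+ k * (cz2 w)^* by rewrite /tk cz2_pt.
  have tt : cabs (tk z w - b ^+ k * (b ^+ k)^* ) <= cabs (cz2 w - b ^+ k).
    rewrite tE -mulrBr -rmorphB cabsM cabs_conj ler_piMl ?cabs_ge0//.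
    by rewrite cabsX.
  have E2 : 1 / 2 <= cabs (Ek k (sk z w) (tk z w) (uk k z w)).
    apply: (Efin ((a * b) * (a * b)^* ) (b ^+ k * (b ^+ k)^* )); rewrite ?mul_conjC_ge0//.
    - by rewrite cabsM cabs_conj cabsM mulr_ile1 ?mulr_ge0 ?cabs_ge0// mulr_ile1 ?cabs_ge0// ltW.
    - by rewrite cabsM cabs_conj cabsX mulr_ile1 ?exprn_ge0 ?cabs_ge0.
    have ss : cabs (sk z w - (a * b) * (a * b)^* ) <= 5 * eps.
      rewrite /sk cz1_pt w1 -mulrBr -rmorphB cabsM cabs_conj.
      apply: (@le_trans _ _ (cabs (x * y - a * b))).
        by rewrite ler_piMl ?cabs_ge0// cabsM mulr_ile1 ?cabs_ge0// ltW.
      have -> : x * y - a * b = (x - a) * y + a * (y - b) by ring.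
      rewrite (le_trans (cabsD _ _))// !cabsM.
      have yb' : cabs (y - b) <= eps by rewrite (le_trans yb)// ler_piMr ?(ltW eps0)// ltW.
      have y2 : cabs y <= 2 by have := cabs_tri y b 0; rewrite !subr0; move: yb' b1 eps4; clear; lra.
      have := ler_pM (cabs_ge0 _) (cabs_ge0 _) xa3 y2.
      have := ler_pM (cabs_ge0 _) (cabs_ge0 _) (ltW a1) yb'.
      by clear; lra.
    apply: (@le_trans _ _ (1 / 4)); last by clear; lra.
    by rewrite (le_trans _ epsL')// ler_wpM2l//; move: ss (le_trans tt tb') ub; clear; lra.
  have T1 : cabs (1 - tk z w) <= q * (1 - cabs b).
    have -> : 1 - tk z w = (1 - b ^+ k * (b ^+ k)^* ) - (tk z w - b ^+ k * (b ^+ k)^* ) by ring.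
    rewrite (le_trans (cabsB _ _))//.
    have : cabs (1 - b ^+ k * (b ^+ k)^* ) <= 2 * k%:R * (1 - cabs b).
      rewrite mulc_conj -(rmorph1 (real_complex R)) -rmorphB cabs_real cabsX -exprM.
      rewrite ger0_norm ?subr_ge0 ?exprn_ile1 ?cabs_ge0 ?(ltW b1)//.
      by rewrite (le_trans (oneBX_le _ (cabs_ge0 b) (ltW b1)))// natrM (mulrC 2).
    have := le_trans tt tb; have := ler_wpM2r (ltW bb) K1.
    by move: bb (ler_wpM2r (ltW bb) eps4); rewrite qE; clear; lra.
  have T2 : 3 / 4 * (1 - cabs b) <= 1 - cabs (cz2 w) ^+ 2.
    have [_ w21] := HkP Hw.
    have : cabs (cz2 w) ^+ 2 <= cabs (cz2 w) by rewrite expr2 ler_piMl ?cabs_ge0// ltW.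
    have := cabs_tri (cz2 w) (b ^+ k) 0; rewrite !subr0 cabsX.
    have : cabs b ^+ k <= cabs b by rewrite -{2}(expr1 (cabs b)) ler_wiXn2l// ltW.
    by move: tb bb (ler_wpM2r (ltW bb) eps4); clear; lra.
  have T20 : 0 < 3 / 4 * (1 - cabs b) by rewrite mulr_gt0// divr_gt0.
  have PL := Pk_lower k0 a1 b01 Hw w1 w2 y0 xa2 T1 T20 T2.
  exact: fin1.
move=> be0 b' /andP[b'1 b'2] nr.
have b'01 : 0 < cabs b' < 1 by apply/andP; move: b'1 b'2; clear; split; lra.
have [x [y [w1 w2 y0 xa yb]]] := near_ptP k0 e14 a1 b'01 nr.
have [ub [x1 [xa2 xa3]]] := hub _ _ w1 w2 y0 xa.
have y1 : cabs y <= 5 / 8.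
  have := cabs_tri y b' 0; rewrite !subr0.
  have : eps * cabs b' <= 1 / 8.
    by move: (ler_pM (ltW eps0) (cabs_ge0 b') eps4 b'2); clear; lra.
  by move: yb b'2; clear; lra.
have w25 : cabs (cz2 w) <= 5 / 8.
  rewrite w2 cabsX; have : cabs y ^+ k <= cabs y ^+ 1.
    by rewrite ler_wiXn2l ?cabs_ge0//; move: y1; clear; lra.
  by rewrite expr1; move: y1; clear; lra.
have bk : cabs b ^+ k <= cabs b by rewrite -{2}(expr1 (cabs b)) ler_wiXn2l// ltW.
have tl : cabs (tk z w) <= e0.
  rewrite /tk cz2_pt cabsM cabs_conj cabsX.
  by move: (ler_pM (ltW zk) (cabs_ge0 (cz2 w)) (le_trans bk be0) w25) e00; clear; lra.
have sl : cabs (sk z w) <= e0.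
  rewrite /sk cz1_pt cabsM cabs_conj w1 !cabsM.
  have y11 : cabs y <= 1 by move: y1; clear; lra.
  have := ler_pM (mulr_ge0 (cabs_ge0 a) (cabs_ge0 b)) (mulr_ge0 (cabs_ge0 x) (cabs_ge0 y))
    (ler_pM (cabs_ge0 a) (cabs_ge0 b) (ltW a1) be0) (ler_pM (cabs_ge0 x) (cabs_ge0 y) x1 y11).
  by rewrite !mulr1 mul1r.
have E2 : 1 / 2 <= cabs (Ek k (sk z w) (tk z w) (uk k z w)).
  apply: (Efin 0 0); rewrite ?cabs0 ?subr0 ?ler01//.
  have : L * (cabs (sk z w) + cabs (tk z w)) <= L * (2 * e0) by rewrite ler_wpM2l//; move: sl tl; clear; lra.
  have : L * cabs (uk k z w - (a * a^* ) ^+ k) <= L * ((6 + 2 * k%:R) * eps) by rewrite ler_wpM2l//; move: ub eps0; clear; lra.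
  by rewrite !mulrDr; move: e0L' epsL'; clear; lra.
have T1 : cabs (1 - tk z w) <= 2.
  by rewrite (le_trans (cabsB _ _))// cabs1; move: (cabs_tk Hz Hw); clear; lra.
have T2 : 3 / 8 <= 1 - cabs (cz2 w) ^+ 2.
  have : cabs (cz2 w) ^+ 2 <= cabs (cz2 w) by rewrite expr2 ler_piMl ?cabs_ge0//; move: w25; clear; lra.
  by move: w25; clear; lra.
have T20 : 0 < 3 / 8 :> R by rewrite divr_gt0.
have PL := Pk_lower k0 a1 b01 Hw w1 w2 y0 xa2 T1 T20 T2.
exact: fin2.
Qed.

End Kernels.

(** * Pointwise domination by the kernel transform *)

Section KernelMeasurable.
Variables (R : realType) (d : measure_display) (T : measurableType d).
Implicit Types f g : T -> R[i].

Lemma measurable_fun_invr D (h : T -> R) : measurable_fun D h ->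
  measurable_fun D (fun x => (h x)^-1).
Proof.
move=> mh; have E x : (h x)^-1 = h x * (h x ^+ 2)^-1.
  have [->|h0] := eqVneq (h x) 0; first by rewrite invr0 mul0r.
  by field.
under eq_fun do rewrite E; apply: measurable_funM => //.
by apply: measurable_invr => [|x]; [exact: measurable_funX|exact: sqr_ge0].
Qed.

Lemma cmeasurableV f : cmeasurable f -> cmeasurable (fun x => (f x)^-1).
Proof.
move=> mf; have E x : (f x)^-1 = (f x)^* * ((cabs (f x) ^+ 2)^-1%:C)%C.
  have [->|h0] := eqVneq (f x) 0; first by rewrite invr0 rmorph0 mul0r.
  apply: (mulfI h0); rewrite divff// mulrA mulc_conj -rmorphM divff ?rmorph1//.
  by rewrite expf_neq0// cabs_eq0.
rewrite (_ : (fun _ => _) = fun x => (f x)^* * ((cabs (f x) ^+ 2)^-1%:C)%C); last exact/funext.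
apply: cmeasurableM; first exact: cmeasurable_conj.
split; last exact: measurable_cst.
by apply: measurable_fun_invr; apply: measurable_funX; exact: cmeasurable_cabs.
Qed.

Lemma cmeasurable_comp d' (T' : measurableType d') (F : T' -> R[i]) (g : T -> T') :
  cmeasurable F -> measurable_fun setT g -> cmeasurable (F \o g).
Proof. by move=> [f1 f2] mg; split; [exact: (measurableT_comp f1)|exact: (measurableT_comp f2)]. Qed.

Lemma cmeasurable_kernel k (M : C2 R -> C2 R -> R[i]) (f g : T -> C2 R) :
  M = Pk k \/ M = Kk k -> measurable_fun setT f -> measurable_fun setT g ->
  cmeasurable (fun x => M (f x) (g x)).
Proof.
move=> HM mf mg.
have ms : cmeasurable (fun x => cz1 (f x) * (cz1 (g x))^* ).
  have m0 := @cmeasurable_cz1 R; apply: cmeasurableM; first exact: (cmeasurable_comp m0).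
  by apply: cmeasurable_conj; exact: (cmeasurable_comp m0).
have mt : cmeasurable (fun x => cz2 (f x) * (cz2 (g x))^* ).
  have m0 := @cmeasurable_cz2 R; apply: cmeasurableM; first exact: (cmeasurable_comp m0).
  by apply: cmeasurable_conj; exact: (cmeasurable_comp m0).
have mden : cmeasurable (fun x => (1 - cz2 (f x) * (cz2 (g x))^* ) ^+ 2 *
    (cz2 (f x) * (cz2 (g x))^* - (cz1 (f x) * (cz1 (g x))^* ) ^+ k) ^+ 2).
  apply: cmeasurableM; apply: cmeasurableX; apply: cmeasurableB => //; last exact: cmeasurableX.
case: HM => ->; rewrite /Pk /Kk /=.
  by apply: cmeasurableM; [exact: mt|exact: cmeasurableV].
have mp : cmeasurable (fun x => pk k (cz1 (f x) * (cz1 (g x))^* )).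
  apply: cmeasurable_sum => j; apply: cmeasurableM; [exact: cmeasurable_cst|exact: cmeasurableX].
have mq : cmeasurable (fun x => qk k (cz1 (f x) * (cz1 (g x))^* )).
  apply: cmeasurable_sum => j; apply: cmeasurableM; last exact: cmeasurableX.
  apply: cmeasurableD; first exact: cmeasurable_cst.
  by apply: cmeasurableM; [exact: cmeasurable_cst|exact: cmeasurableX].
apply: cmeasurableM; last first.
  apply: cmeasurableV; under eq_fun do rewrite -mulrA.
  by apply: cmeasurableM => //; exact: cmeasurable_cst.
apply: cmeasurableD; last by apply: cmeasurableM => //; exact: cmeasurableX.
by apply: cmeasurableD; apply: cmeasurableM => //; exact: cmeasurableX.
Qed.

Lemma measurable_kernel_weight k (M : C2 R -> C2 R -> R[i]) (f g : T -> C2 R) :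
  M = Pk k \/ M = Kk k -> measurable_fun setT f -> measurable_fun setT g ->
  measurable_fun setT (fun x => kernel_weight M k (f x) (g x)).
Proof.
move=> HM mf mg; apply: measurable_funM.
  by apply: measurable_funX; apply: cmeasurable_cabs; exact: (cmeasurable_kernel HM).
apply: measurable_fun_invr.
by case: (@cmeasurable_kernel k (Kk k) g g (or_intror erefl) mg mg).
Qed.

End KernelMeasurable.

(** * The weighted sub-mean-value estimate *)

Section SubMeanValue.
Variable R : realType.
Implicit Types (a b : R[i]) (z w : C2 R).

Lemma kernel_weight_ge0 k (M : C2 R -> C2 R -> R[i]) z w : (0 < k)%N -> Hk k w ->
  0 <= kernel_weight M k z w.
Proof.
move=> k0 Hw; have [M0 M00 /(_ _ Hw)/andP[H _]] := @ReKk_bounds R k k0.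
rewrite divr_ge0 ?sqr_ge0// (le_trans _ H)// divr_ge0 ?(ltW (kpi_gt0 _ k0))//.
exact/ltW/diagP_gt0.
Qed.

Lemma Hk_pt k z : (0 < k)%N -> Hk k z -> exists a b,
  [/\ cabs a < 1, 0 < cabs b < 1 & z = pt (a * b) (b ^+ k)].
Proof.
move=> k0 Hz; have [z1 z2] := HkP Hz; have z20 := Hk_cz2 Hz.
set b := k.-root (cz2 z); have bk : b ^+ k = cz2 z by exact: rootCK.
have b0 : b != 0.
  apply/eqP => b0; move: z20; rewrite -bk b0 expr0n.
  by rewrite (negbTE (_ : k != 0%N)) ?cabs0 ?ltxx// -lt0n.
have bk1 : cabs b ^+ k < 1 by rewrite -cabsX bk.
have b1 : cabs b < 1.
  by rewrite ltNge; apply/negP => /(exprn_ege1 k); rewrite leNgt bk1.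
exists (cz1 z / b), b; split.
- rewrite cabs_div ltr_pdivrMr ?cabs_gt0// mul1r.
  rewrite ltNge; apply/negP => H; move: z1; rewrite ltNge -bk cabsX => /negP; apply.
  by rewrite lerXn2r ?nnegrE ?cabs_ge0.
- by rewrite cabs_gt0 b0.
- by rewrite divfK// bk pt_cz.
Qed.

Lemma measurable_cz2_lt (r : R) : measurable [set w : C2 R | cabs (cz2 w) < r].
Proof.
have m2 : measurable_fun [set: C2 R] (fun p => cabs (cz2 p)).
  by apply: cmeasurable_cabs; exact: cmeasurable_cz2.
have := measurable_fun_ltr m2 (measurable_cst (r : R)).
by move=> /(_ measurableT [set true] I); rewrite setTI.
Qed.

(** Applied to the whole norm, [local_bound] would only bound x F(x) near x = 0. The small mass of
    |h|^2 over small |z2|, obtained by dominated convergence, makes x F(x) tend to 0, as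
    [removable_bound] demands. *)
Lemma A2_tail k (h : C2 R -> R[i]) (eta : R) : A2 k h -> 0 < eta ->
  exists2 delta : R, 0 < delta &
  (\int[@dV R]_(w in Hk k) ((\1_[set w | (cabs (cz2 w) < delta)%R] w : R) * cabs (h w) ^+ 2)%:E < eta%:E)%E.
Proof.
move=> [hh hf] eta0.
have mH := @measurable_Hk R k.
have mh : measurable_fun (Hk k) (fun w => cabs (h w)) by exact: hol_measurable.
pose g w := (cabs (h w) ^+ 2)%:E.
pose f_ (n : nat) w := ((\1_[set w | (cabs (cz2 w) < n.+1%:R^-1)%R] w : R) * cabs (h w) ^+ 2)%:E.
have mg : measurable_fun (Hk k) g.
  by apply/measurable_EFinP; exact: measurable_funX.
have mf_ n : measurable_fun (Hk k) (f_ n).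
  apply/measurable_EFinP; apply: measurable_funM; last exact: measurable_funX.
  by apply: measurable_funTS; apply: measurable_indic; exact: measurable_cz2_lt.
have ff : {ae (@leb4 R), forall x, Hk k x -> f_ ^~ x @ \oo --> 0%E}.
  apply: aeW => x Hx; apply: cvg_near_cst.
  have x0 := Hk_cz2 Hx.
  near=> n; rewrite /f_ indicE memNset ?mul0r//= => xn.
  move: xn; rewrite ltNge => /negP; apply; apply: ltW.
  by near: n; exact: near_infty_natSinv_lt (PosNum x0).
have ig : (@leb4 R).-integrable (Hk k) g.
  apply/integrableP; split; first exact: mg.
  rewrite (_ : (\int[_]_(x in _) _ = \int[@leb4 R]_(x in Hk k) g x)%E); first exact: hf.
  by apply: eq_integral => x _; rewrite gee0_abs// lee_fin sqr_ge0.
have fg : {ae (@leb4 R), forall x n, Hk k x -> (`|f_ n x| <= g x)%E}.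
  apply: aeW => x n Hx; rewrite /f_ /g gee0_abs ?lee_fin; last first.
    by rewrite mulr_ge0 ?sqr_ge0.
  by rewrite ler_piMl ?sqr_ge0// indicE lern1 leq_b1.
have [_ _] := dominated_convergence mH mf_ (@measurable_cst _ _ _ _ _ 0%E) ff ig fg.
rewrite integral0 => /fine_cvgP [fn].
move=> /cvgrPdist_lt /(_ _ eta0) Hn.
have [n _ /(_ n (leqnn n)) [H1 H2]] := filterI fn Hn.
exists (n.+1%:R^-1); first by rewrite invr_gt0 ltr0n.
rewrite dVE; move: H1 H2 => /=; case: integral => // r _ /=.
by rewrite sub0r normrN lte_fin; exact: le_lt_trans (ler_norm _).
Unshelve. all: by end_near. Qed.

Lemma kernel_submean k (M : C2 R -> C2 R -> R[i]) : (0 < k)%N -> M = Pk k \/ M = Kk k ->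
  exists2 C : R, 0 < C & forall h z, A2 k h -> Hk k z ->
  ((cabs (h z) ^+ 2)%:E <=
   C%:E * \int[@dV R]_(w in Hk k) (kernel_weight M k z w * cabs (h w) ^+ 2)%:E)%E.
Proof.
move=> k0 HM; have [eps [c [e0 [e4 c0 /andP[e00 e08] KL]]]] := @kernel_lower R k k0.
have [cl cl0 LB] := @local_bound R k eps k0 e4.
(* For small b, one factor 64 is the square of the 8 in [removable_bound], the other comes from (1 -
   |x|) |x| being at least 1/8 on the ring. For the other b, e0^2 in the denominator absorbs
   |b|^2. *)
set C := 64 ^+ 2 / (cl * c * e0 ^+ 2).
have C0 : 0 < C by rewrite divr_gt0 ?mulr_gt0 ?exprn_gt0.
exists C => // h z hA Hz; have [hh hf] := hA.
have [a [b [a1 b01 zE]]] := Hk_pt k0 Hz; have [b0 b1] := andP b01.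
have A0 : 0 < 1 - cabs a by rewrite subr_gt0.
have B0 : 0 < 1 - cabs b by rewrite subr_gt0.
have zk : 0 < cabs b ^+ k by rewrite exprn_gt0.
set W := kernel_weight M k z.
have mW : measurable_fun (Hk k) W.
  apply: measurable_funTS.
  by apply: (@measurable_kernel_weight R _ _ k M (fun=> z) id) => //; exact: measurable_cst.
have W0 w : Hk k w -> 0 <= W w by exact: kernel_weight_ge0.
set I := (integral _ _ _).
have I0 : (0 <= I)%E.
  by rewrite /I dVE; apply: integral_ge0 => w Hw; rewrite lee_fin mulr_ge0 ?sqr_ge0 ?W0.
have hz0 : 0 <= cabs (h z) ^+ 2 by exact: sqr_ge0.
(* The lower bound of the weight times the volume of the polydisc around z is of the order |b|^2,
   which is harmless as long as |b| exceeds e0. *)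
have [be0|be0] := ltP e0 (cabs b).
  set m := c / (cabs b ^+ k * (1 - cabs b) * (1 - cabs a)) ^+ 2.
  have m0 : 0 <= m by rewrite divr_ge0 ?(ltW c0) ?sqr_ge0.
  have near w : near_pt k eps a b w -> m <= W w.
    move=> nw; have Hw := near_pt_Hk k0 (proj2 (andP e4)) a1 b01 nw.
    by rewrite /W zE; have [/(_ nw)] := KL a b w a1 b01 Hw M HM.
  have := LB a b h W m a1 b01 hh mW W0 m0 near; rewrite -zE -/I => H.
  have {H}H : ((cl * c * cabs b ^+ 2 * cabs (h z) ^+ 2)%:E <= I)%E.
    apply: le_trans H; rewrite lee_fin le_eqVlt; apply/orP; left; apply/eqP.
    by rewrite /m (exprS (cabs b) k); field; rewrite !gt_eqF.
  apply: (@le_trans _ _ (C%:E * (cl * c * cabs b ^+ 2 * cabs (h z) ^+ 2)%:E)%E); last first.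
    by rewrite lee_wpmul2l// lee_fin ltW.
  rewrite -EFinM lee_fin -[X in X <= _]mul1r.
  rewrite (_ : C * (cl * c * cabs b ^+ 2 * cabs (h z) ^+ 2) =
    (64 ^+ 2 * (cabs b / e0) ^+ 2) * cabs (h z) ^+ 2); last first.
    by rewrite /C; field; rewrite !gt_eqF.
  rewrite ler_wpM2r//.
  have : 1 <= (cabs b / e0) ^+ 2 by rewrite exprn_ege1// ler_pdivlMr// mul1r ltW.
  by move: (_ ^+ 2) => x; clear; lra.
have [|Ifin] := eqVneq I +oo%E.
  by move=> ->; rewrite gt0_muley ?leey// lte_fin.
have If : I \is a fin_num by rewrite ge0_fin_numE// ltey.
rewrite -(fineK If) -EFinM lee_fin; set J := fine I.
have J0 : 0 <= J by exact: fine_ge0.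
(* The pullback of h times the Jacobian of (a, b) to (a b, b^k), up to the factor k, on the slice of
   fixed a. *)
pose F x := x ^+ k * h (pt (a * x) (x ^+ k)).
have HF (x : R[i]) : x != 0 -> cabs x < 1 -> hol1 F x.
  move=> x0 x1; apply: holM; first by apply: holX; exact: hol1_id.
  apply: (@hol_comp_pt R h (fun x => a * x) (fun x => x ^+ k)).
  - by apply: hh; apply: pt_Hk => //; rewrite cabs_gt0 x0.
  - by apply: holM; [exact: hol_cst|exact: hol1_id].
  - by apply: holX; exact: hol1_id.
set m := c / (cabs b ^+ k * (1 - cabs a)) ^+ 2.
have m0 : 0 <= m by rewrite divr_ge0 ?(ltW c0) ?sqr_ge0.
(* [local_bound] is centred at the point with coordinates (a, x), x in the ring, but the weight is
   that of z; its lower bound [m] carries |b|^(-2k), which becomes the factor |b|^(2k) on the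
   right. *)
have ring_bound (x : R[i]) : 1 / 4 <= cabs x <= 1 / 2 ->
    cabs (F x) ^+ 2 <= 64 * J * (cabs b ^+ k) ^+ 2 / (cl * c).
  move=> /[dup] x42 /andP[x4 x2].
  have x01 : 0 < cabs x < 1 by apply/andP; split; move: x4 x2; clear; lra.
  have near w : near_pt k eps a x w -> m <= W w.
    move=> nw; have Hw := near_pt_Hk k0 (proj2 (andP e4)) a1 x01 nw.
    rewrite /W zE; have [_ KL2] := KL a b w a1 b01 Hw M HM.
    exact: (KL2 be0 x x42 nw).
  have := LB a x h W m a1 x01 hh mW W0 m0 near; rewrite -/I -(fineK If) lee_fin -/J.
  rewrite (_ : cl * m * ((1 - cabs a) * (1 - cabs x) * cabs x ^+ k.+1) ^+ 2 *
     cabs (h (pt (a * x) (x ^+ k))) ^+ 2 =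
     cl * c / (cabs b ^+ k) ^+ 2 * ((1 - cabs x) * cabs x) ^+ 2 * cabs (F x) ^+ 2); last first.
    by rewrite /m /F cabsM cabsX (exprS (cabs x) k); field; rewrite !gt_eqF.
  move=> H; have Q0 : 0 < cl * c / (cabs b ^+ k) ^+ 2.
    by rewrite !mulr_gt0// invr_gt0 exprn_gt0.
  have : 1 / 64 <= ((1 - cabs x) * cabs x) ^+ 2.
    have : 1 / 8 <= (1 - cabs x) * cabs x.
      have : 0 <= (cabs x - 1/4) * (1/2 - cabs x) by rewrite mulr_ge0 ?subr_ge0.
      by move: x4 x2; clear; lra.
    move: ((1 - cabs x) * _) => y y8; have : (1 / 8) ^+ 2 <= y ^+ 2.
      by rewrite lerXn2r ?nnegrE//; move: y8; clear; lra.
    by rewrite expr_div_n expr1n -natrX.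
  move: (((1 - cabs x) * _) ^+ 2) H => y H y64.
  have {}H : cl * c / (cabs b ^+ k) ^+ 2 * (1 / 64) * cabs (F x) ^+ 2 <= J.
    by rewrite (le_trans _ H)// ler_wpM2r ?sqr_ge0// ler_wpM2l// ltW.
  rewrite (_ : _ / (cl * c) = 64 * J / (cl * c / (cabs b ^+ k) ^+ 2)); last first.
    by field; rewrite !gt_eqF.
  rewrite ler_pdivlMr// mulrC; move: H; move: (_ / (_ ^+ 2)) (cabs (F x) ^+ 2) => p q.
  by clear; lra.
set M2 := 64 * J * (cabs b ^+ k) ^+ 2 / (cl * c).
have M20 : 0 <= M2.
  apply: divr_ge0; last by apply: mulr_ge0; exact: ltW.
  by apply: mulr_ge0; [exact: mulr_ge0|exact: sqr_ge0].
have M2s : Num.sqrt M2 ^+ 2 = M2 by rewrite sqr_sqrtr.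
have r2 (x : R[i]) : rect (- (1/4)) (1/4) (- (1/4)) (1/4) x -> cabs x <= 1 / 2.
  move=> /andP[/andP[? ?] /andP[? ?]]; rewrite (le_trans (cabs_ReIm _))//.
  have h1 : `|complex.Re x| <= 1/4 by rewrite ler_norml; apply/andP.
  have h2 : `|complex.Im x| <= 1/4 by rewrite ler_norml; apply/andP.
  by move: h1 h2; clear; lra.
have FB : cabs (F b) <= 8 * Num.sqrt M2.
  (* With r = 1/4 the square lies in |x| <= 1/2 and its part outside |x| < 1/4 lies in the ring,
     while |b| <= e0 <= 1/8 = r / 2. *)
  apply: (@removable_bound R F (1/4)) => //.
  - by move=> x /r2 x2 x0; apply: HF => //; move: x2; clear; lra.
  - move=> e E0.
    (* [local_bound] is used with the indicator of |z2| < delta as weight. Points near (a, x) have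
       |z2| at most 2 |x|^k, hence below delta when |x| < delta / 2, and (1 - |x|)^2 is at least
       1/4; this fixes [eta]. *)
    have eta0 : 0 < e ^+ 2 * (cl * (1 - cabs a) ^+ 2 * (1 / 4)) by rewrite !mulr_gt0 ?exprn_gt0.
    have [delta d0 Hd] := A2_tail hA eta0.
    exists (Num.min (1/2) (delta / 2)) => [|x x0]; first by rewrite lt_min !divr_gt0.
    rewrite lt_min => /andP[x2 xd].
    have x01 : 0 < cabs x < 1 by apply/andP; split; [rewrite cabs_gt0|move: x2; clear; lra].
    have near w : near_pt k eps a x w -> (1 : R) <= \1_[set w | (cabs (cz2 w) < delta)%R] w.
      case=> r [_ _ w2 _]; rewrite indicE mem_set//=.
      have := cabs_tri (cz2 w) (x ^+ k) 0; rewrite !subr0 cabsX => H.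
      have xk : cabs x ^+ k <= cabs x.
        by rewrite -{2}(expr1 (cabs x)) ler_wiXn2l ?cabs_ge0//; move: x2; clear; lra.
      have : eps * (1 - cabs x) * cabs x ^+ k <= 1 * cabs x ^+ k.
        rewrite ler_wpM2r ?exprn_ge0 ?cabs_ge0//.
        have [ep0 ep4] := andP e4; rewrite mulr_ile1 ?(ltW ep0)//; move: ep4 x2 (cabs_ge0 x); clear; lra.
      by move: H w2 xk xd; clear; lra.
    have mI : measurable_fun (Hk k) (\1_[set w | (cabs (cz2 w) < delta)%R] : C2 R -> R).
      by apply: measurable_funTS; apply: measurable_indic; exact: measurable_cz2_lt.
    have := LB a x h _ 1 a1 x01 hh mI (fun _ _ => ler0n _ _) ler01 near.
    move=> /le_lt_trans/(_ Hd); rewrite lte_fin mulr1.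
    rewrite (_ : cl * ((1 - cabs a) * (1 - cabs x) * cabs x ^+ k.+1) ^+ 2 *
       cabs (h (pt (a * x) (x ^+ k))) ^+ 2 =
      cl * (1 - cabs a) ^+ 2 * ((1 - cabs x) ^+ 2) * (cabs x * cabs (F x)) ^+ 2); last first.
      by rewrite /F cabsM cabsX (exprS (cabs x) k); ring.
    move=> H; have x4 : 1 / 4 <= (1 - cabs x) ^+ 2.
      have : (1 / 2) ^+ 2 <= (1 - cabs x) ^+ 2 by rewrite lerXn2r// ?nnegrE; move: x2; clear; lra.
      by rewrite expr_div_n expr1n -natrX.
    rewrite -ler_sqr ?nnegrE ?mulr_ge0 ?cabs_ge0 ?(ltW E0)//.
    have Q0 : 0 < cl * (1 - cabs a) ^+ 2 * (1 / 4) by rewrite !mulr_gt0 ?exprn_gt0.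
    rewrite -(ler_pM2r Q0) (le_trans _ (ltW H))// mulrC ler_wpM2r ?sqr_ge0//.
    by rewrite ler_wpM2l// mulr_ge0 ?sqr_ge0 ?ltW.
  - move=> x /r2 x2 x4; rewrite -ler_sqr ?nnegrE ?cabs_ge0 ?sqrtr_ge0// M2s.
    by apply: ring_bound; rewrite x4.
  - by rewrite -cabs_gt0.
  - by rewrite (le_trans be0)//; move: e08; clear; lra.
have : cabs (F b) ^+ 2 <= 64 * M2.
  have := FB; rewrite -ler_sqr ?nnegrE ?cabs_ge0 ?mulr_ge0 ?sqrtr_ge0//.
  by rewrite exprMn M2s -natrX.
rewrite /F -zE cabsM exprMn cabsX /M2 => H.
have zk2 : 0 < (cabs b ^+ k) ^+ 2 by rewrite exprn_gt0.
rewrite -(ler_pM2l zk2) (le_trans H)//.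
rewrite (_ : 64 * _ = (cabs b ^+ k) ^+ 2 * (64 ^+ 2 / (cl * c) * J)); last first.
  by field; rewrite !gt_eqF.
rewrite ler_wpM2l ?(ltW zk2)// ler_wpM2r//.
rewrite ler_wpM2l// lef_pV2 ?posrE ?mulr_gt0 ?exprn_gt0//.
rewrite ler_piMr ?mulr_ge0 ?ltW// exprn_ilt1//; move: e08 e00; clear; lra.
Qed.

End SubMeanValue.

(** * The norms of the kernels *)

Section Lorentz.
Variable R : realType.
Local Notation mR := (measurableTypeR R).
Local Notation leb := (@lebesgue_measure R).
Implicit Types (a d : R) (p : R[i]).

Lemma integral_oneDsqr : (\int[leb]_x ((@oneDsqr R x)^-1)%:E = (pi : R)%:E)%E.
Proof.
have := @ge0_symfun_integralT R (fun x => (oneDsqr x)^-1).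
move=> ->.
- rewrite -set_itvcy integral0y_oneDsqr -EFinM; congr EFin; by field.
- by move=> x; rewrite invr_ge0 (le_trans ler01)// oneDsqr_ge1.
- exact: continuous_oneDsqrV.
- by move=> x /=; rewrite /oneDsqr sqrrN.
Qed.

Lemma integral_lorentz a d : 0 < d ->
  (\int[leb]_x ((d ^+ 2 + (x - a) ^+ 2)^-1)%:E = (pi / d)%:E)%E.
Proof.
move=> d0; pose F (x : R) := (x - a) * d^-1.
have dF (x : R) : is_derive x 1 F d^-1.
  rewrite /F; apply: is_derive_eq.
  by rewrite subr0 scaler0 add0r /GRing.scale /= mulr1.
have dFE : derive1 F = cst d^-1.
  by apply/funext => x; rewrite derive1E; have [_ ->] := dF x.
have dn : d != 0 by rewrite gt_eqF.
have ndF : {homo F : x y / x < y} by move=> x y xy; rewrite ltr_pM2r ?invr_gt0// ltrD2r.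
have := @increasing_ge0_integration_by_substitutionT R F (fun x => (oneDsqr x)^-1) ndF.
rewrite dFE => /(_ (fun=> cvg_cst _) (is_cvg_cst _) (is_cvg_cst _)) H.
have {}H : (\int[leb]_x ((oneDsqr x)^-1)%:E =
  \int[leb]_x ((oneDsqr (F x))^-1 * d^-1)%:E)%E.
  apply: H.
  - by move=> x; have [] := dF x.
  - apply: (@gt0_cvgMlNy R _ _ d^-1 (fun x => x - a)); rewrite ?invr_gt0//.
    exact: cvg_addrr_Ny.
  - apply: (@gt0_cvgMly R _ _ d^-1 (fun x => x - a)); rewrite ?invr_gt0//.
    exact: cvg_addrr.
  - exact: continuous_oneDsqrV.
  - by move=> x; rewrite invr_ge0 (le_trans ler01)// oneDsqr_ge1.
have mL : measurable_fun setT (fun x : mR => (oneDsqr (F x))^-1 * d^-1).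
  apply: measurable_funM => //; apply: (measurableT_comp (f := fun x : R => (oneDsqr x)^-1)).
    by apply: continuous_measurable_fun; exact: continuous_oneDsqrV.
  by apply: measurable_funM => //; apply: measurable_funB.
transitivity (\int[leb]_x ((d^-1)%:E * ((oneDsqr (F x))^-1 * d^-1)%:E))%E.
  apply: eq_integral => x _; rewrite -EFinM; congr EFin; rewrite /oneDsqr /F expr_div_n.
  have : 0 < d ^+ 2 + (x - a) ^+ 2 by rewrite ltr_pwDl ?exprn_gt0 ?sqr_ge0.
  move/gt_eqF => h; have : d ^+ 2 + (x - a) ^+ 2 != 0 by rewrite h.
  by move=> h2; field; rewrite dn h2.
rewrite ge0_integralZl//; last 3 first.
- exact/measurable_EFinP.
- by move=> x _; rewrite lee_fin mulr_ge0 ?invr_ge0 ?(ltW d0).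
- by rewrite lee_fin invr_ge0 ltW.
by rewrite -H integral_oneDsqr -EFinM mulrC.
Qed.

Definition cpt (q : mR * mR) : R[i] := (q.1 +i* q.2)%C.

Lemma cmeasurable_cpt : cmeasurable cpt.
Proof. by split; [exact: measurable_fst|exact: measurable_snd]. Qed.

(** (d^2 + x^2 + y^2)^2 is at least (d^2 + x^2)(d^2 + y^2), so the planar integral is dominated by a
    product of two integrals over the line, at the right order d^(-2). *)
Lemma integral_planar_lorentz p d : 0 < d ->
  (\int[@leb2 R]_q (((d ^+ 2 + cabs (cpt q - p) ^+ 2) ^+ 2)^-1)%:E <= ((pi / d) ^+ 2)%:E)%E.
Proof.
move=> d0; case: p => a b.
pose L (c x : R) := (d ^+ 2 + (x - c) ^+ 2)^-1.
have L0 c x : 0 <= L c x by rewrite invr_ge0 addr_ge0 ?sqr_ge0.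
have mL c : measurable_fun setT (fun x : mR => L c x).
  apply: measurable_fun_invr; apply: measurable_funD => //; apply: measurable_funX.
  exact: measurable_funB.
have m2 : measurable_fun setT (fun q : mR * mR => (L a q.1 * L b q.2)%:E).
  apply/measurable_EFinP; apply: measurable_funM.
    by apply: (measurableT_comp (mL a)); exact: measurable_fst.
  by apply: (measurableT_comp (mL b)); exact: measurable_snd.
apply: (@le_trans _ _ (\int[@leb2 R]_q (L a q.1 * L b q.2)%:E)%E).
  apply: ge0_le_integral => //.
  - by move=> q _; rewrite lee_fin invr_ge0 sqr_ge0.
  - apply/measurable_EFinP; apply: measurable_fun_invr; apply: measurable_funX.
    apply: measurable_funD => //; apply: measurable_funX; apply: cmeasurable_cabs.
    by apply: cmeasurableB; [exact: cmeasurable_cpt|exact: cmeasurable_cst].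
  - move=> q _; rewrite lee_fin /L -invfM.
    have h c x : 0 < d ^+ 2 + (x - c) ^+ 2 by rewrite ltr_pwDl ?exprn_gt0 ?sqr_ge0.
    rewrite cabs2E /= lef_pV2 ?posrE ?mulr_gt0 ?h ?exprn_gt0 ?ltr_pwDl ?exprn_gt0 ?addr_ge0 ?sqr_ge0//.
    move: (sqr_ge0 d) (sqr_ge0 (q.1 - a)) (sqr_ge0 (q.2 - b)).
    move: (d ^+ 2) ((_ - a) ^+ 2) ((_ - b) ^+ 2) => u v w u0 v0 w0.
    by have := mulr_ge0 u0 v0; have := mulr_ge0 u0 w0; have := mulr_ge0 v0 w0;
       have := mulr_ge0 v0 v0; have := mulr_ge0 w0 w0; lra.
rewrite [leLHS](_ : _ = \int[leb]_x \int[leb]_y (L a x * L b y)%:E)%E; last first.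
  by apply: fubini_tonelli1 => // q; rewrite lee_fin mulr_ge0.
rewrite [leLHS](_ : _ = \int[leb]_x ((pi / d)%:E * (L a x)%:E))%E; last first.
  apply: eq_integral => x _; under eq_integral do rewrite EFinM.
  rewrite ge0_integralZl ?lee_fin//; last 2 first.
  - exact/measurable_EFinP.
  - by move=> y _; rewrite lee_fin.
  by rewrite integral_lorentz// muleC.
rewrite ge0_integralZl//; last 3 first.
- exact/measurable_EFinP.
- by move=> y _; rewrite lee_fin.
- by rewrite lee_fin divr_ge0 ?pi_ge0 ?ltW.
by rewrite integral_lorentz// -EFinM expr2.
Qed.

End Lorentz.

(** * Integrals of Cauchy factors over discs *)

Section DiscIntegrals.
Variable R : realType.
Local Notation mR := (measurableTypeR R).
Implicit Types (p z : R[i]) (q : mR * mR).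

Lemma measurable_cpt_lt (r : R) : measurable [set q : mR * mR | cabs (cpt q) < r].
Proof.
have m2 : measurable_fun [set: mR * mR] (fun q => cabs (cpt q)).
  by apply: cmeasurable_cabs; exact: cmeasurable_cpt.
have := measurable_fun_ltr m2 (measurable_cst (r : R)).
by move=> /(_ measurableT [set true] I); rewrite setTI.
Qed.

(* [p] is the pole [g^-1] when it is close to the disc of radius [rho], else [0]. *)
Lemma cauchy_factor_lower g (rho : R) : 0 < rho -> cabs g * rho < 1 ->
  exists p, forall z, cabs z < rho ->
  ((1 - cabs g * rho) * rho) ^+ 2 + cabs (z - p) ^+ 2 <= 8 * rho ^+ 2 * cabs (1 - g * z) ^+ 2.
Proof.
move=> r0 b1; set b := cabs g * rho in b1 *.
have b0 : 0 <= b by rewrite mulr_ge0 ?cabs_ge0 ?ltW.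
have low z : cabs z < rho -> 1 - b <= cabs (1 - g * z).
  move=> zr; have := cabs_tri 1 (g * z) 0; rewrite !subr0 cabs1 cabsM.
  have := ler_wpM2l (cabs_ge0 g) (ltW zr); rewrite -/b.
  by lra.
have rr : 0 <= rho ^+ 2 by exact: sqr_ge0.
have sq1 : (1 - b) ^+ 2 <= 1.
  by rewrite expr_le1 ?subr_ge0 ?(ltW b1)// lerBlDr lerDl.
have [b2|b2] := lerP b (1 / 2).
  exists 0 => z zr; rewrite subr0.
  have h1 : cabs z ^+ 2 <= rho ^+ 2 by rewrite lerXn2r ?nnegrE ?cabs_ge0 ?ltW.
  have h2 : 1 / 4 <= cabs (1 - g * z) ^+ 2.
    have : (1 / 2) ^+ 2 <= cabs (1 - g * z) ^+ 2.
      by rewrite lerXn2r ?nnegrE ?cabs_ge0//; have := low _ zr; lra.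
    by rewrite expr_div_n expr1n -natrX.
  have := ler_wpM2r rr h2; have := ler_wpM2r rr sq1.
  by rewrite exprMn; lra.
have g0 : g != 0.
  by rewrite -cabs_gt0 -(pmulr_lgt0 _ r0); rewrite -/b; lra.
exists g^-1 => z zr.
have -> : z - g^-1 = - ((1 - g * z) / g) by field.
rewrite cabsN cabs_div exprMn.
set X := cabs (1 - g * z); have X0 : 0 <= X by exact: cabs_ge0.
have h1 : (1 - b) ^+ 2 <= X ^+ 2.
  by rewrite lerXn2r ?nnegrE ?subr_ge0 ?(ltW b1)//; exact: low.
have h2 : (cabs g)^-1 <= 2 * rho.
  rewrite -[leLHS]mul1r ler_pdivrMr ?cabs_gt0//; have : b = rho * cabs g by rewrite mulrC.
  by lra.
have h3 : ((cabs g)^-1) ^+ 2 <= (2 * rho) ^+ 2.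
  have r2 : 0 <= 2 * rho by rewrite mulr_ge0 ?ltW.
  by rewrite lerXn2r ?nnegrE ?r2 ?invr_ge0 ?cabs_ge0.
have := ler_wpM2l (sqr_ge0 X) h3; have := ler_wpM2r rr h1.
have := mulr_ge0 (sqr_ge0 X) rr.
rewrite !exprMn; move: (X ^+ 2) (rho ^+ 2) => u v.
by rewrite (_ : 2 ^+ 2 = 4) -?natrX//; lra.
Qed.

(** A Forelli-Rudin estimate, uniform as |g| rho tends to 1. [cauchy_factor_lower] replaces the
    integrand by a Lorentz density of width d = (1 - |g| rho) rho, which can be integrated over the
    whole plane; the bound is (8 rho^2)^2 (pi / d)^2. *)
Lemma integral_cauchy_factor g (rho : R) : 0 < rho -> cabs g * rho < 1 ->
  (\int[@leb2 R]_(q in [set q | (cabs (cpt q) < rho)%R]) ((cabs (1 - g * cpt q) ^+ 4)^-1)%:E <=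
   (64 * pi ^+ 2 * rho ^+ 2 / (1 - cabs g * rho) ^+ 2)%:E)%E.
Proof.
move=> r0 b1; have [p Hp] := cauchy_factor_lower r0 b1.
set b := cabs g * rho in b1 Hp *; set d := (1 - b) * rho in Hp.
have bb : 0 < 1 - b by rewrite subr_gt0.
have d0 : 0 < d by rewrite mulr_gt0.
pose L q := ((d ^+ 2 + cabs (cpt q - p) ^+ 2) ^+ 2)^-1.
have mL : measurable_fun setT L.
  apply: measurable_fun_invr; apply: measurable_funX; apply: measurable_funD => //.
  apply: measurable_funX; apply: cmeasurable_cabs.
  by apply: cmeasurableB; [exact: cmeasurable_cpt|exact: cmeasurable_cst].
have L0 q : 0 <= L q by rewrite invr_ge0 sqr_ge0.
have C0 : 0 <= (8 * rho ^+ 2) ^+ 2 by exact: sqr_ge0.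
apply: (@le_trans _ _ (\int[@leb2 R]_(q in [set q | (cabs (cpt q) < rho)%R])
   (((8 * rho ^+ 2) ^+ 2)%:E * (L q)%:E))%E).
  apply: ge0_le_integral => //.
  - exact: measurable_cpt_lt.
  - by move=> q _; rewrite lee_fin invr_ge0 exprn_ge0 ?cabs_ge0.
  - apply/measurable_EFinP/measurable_funTS; apply: measurable_fun_invr.
    apply: measurable_funX; apply: cmeasurable_cabs.
    apply: cmeasurableB; first exact: cmeasurable_cst.
    by apply: cmeasurableM; [exact: cmeasurable_cst|exact: cmeasurable_cpt].
  - by apply: measurable_funeM; apply/measurable_EFinP/measurable_funTS.
  - move=> q /= qr; rewrite lee_fin /L; have := Hp _ qr.
    have s0 : 0 < d ^+ 2 + cabs (cpt q - p) ^+ 2 by rewrite ltr_pwDl ?exprn_gt0 ?sqr_ge0.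
    have r2 : 0 < 8 * rho ^+ 2 by rewrite mulr_gt0 ?exprn_gt0.
    set s := d ^+ 2 + _ in s0 *; set X := cabs _ => H.
    have X0 : 0 < X ^+ 2 by rewrite -(pmulr_rgt0 _ r2) (lt_le_trans s0).
    rewrite (_ : X ^+ 4 = (X ^+ 2) ^+ 2); last by rewrite -exprM.
    rewrite -exprVn -(exprVn s) -exprMn; move: (X ^+ 2) X0 H => Y Y0 H.
    have r1 : 0 <= 8 * rho ^+ 2 / s by rewrite divr_ge0 ?ltW.
    rewrite lerXn2r ?nnegrE ?r1 ?invr_ge0 ?(ltW Y0)//.
    by rewrite -[leLHS]mul1r ler_pdivrMr// mulrAC ler_pdivlMr// mul1r.
rewrite ge0_integralZl//; last 3 first.
- exact: measurable_cpt_lt.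
- by apply/measurable_EFinP/measurable_funTS.
- by move=> q _; rewrite lee_fin.
apply: (@le_trans _ _ (((8 * rho ^+ 2) ^+ 2)%:E * ((pi / d) ^+ 2)%:E)%E).
  rewrite lee_wpmul2l ?lee_fin// (le_trans _ (integral_planar_lorentz p d0))//.
  apply: ge0_subset_integral => //.
  - exact: measurable_cpt_lt.
  - exact/measurable_EFinP.
  - by move=> q _; rewrite lee_fin.
rewrite -EFinM lee_fin le_eqVlt; apply/orP; left; apply/eqP.
by rewrite /d; field; rewrite !gt_eqF.
Qed.

End DiscIntegrals.

(** * Comparison of 1 - x^k with linear factors *)

Section RootsOfUnity.
Variable R : realType.
Implicit Types (om x : R[i]).

Lemma prim_root_exists k : (0 < k)%N -> exists om, k.-primitive_root om.
Proof.
pose p : {poly R[i]} := 'X^k - 1; have [r Dp] := closed_field_poly_normal p.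
move=> k0; rewrite (monicP _) ?monicXnsubC // scale1r in Dp.
have rn1 : all k.-unity_root r by apply/allP => z; rewrite -root_prod_XsubC -Dp.
have sz_r : (k < (size r).+1)%N by rewrite -(size_prod_XsubC r id) -Dp size_XnsubC.
have [|z] := hasP (cyclic.has_prim_root k0 rn1 _ sz_r); last by exists z.
by rewrite -separable.separable_prod_XsubC -Dp cyclotomic.separable_Xn_sub_1 // pnatr_eq0 -lt0n.
Qed.

(* The geometric sums [(1 - x ^ k) / (1 - om ^ j x)] add up to [k], so one of them
   has modulus at least 1. *)
Lemma closest_root k om x : (0 < k)%N -> k.-primitive_root om ->
  exists j : 'I_k, cabs (1 - om ^+ j * x) <= cabs (1 - x ^+ k).
Proof.
move=> k0 om_prim; have omk : om ^+ k = 1 by exact: prim_expr_order.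
pose S (j : 'I_k) := \sum_(n < k) (om ^+ j * x) ^+ n.
have HS (j : 'I_k) : 1 - x ^+ k = (1 - om ^+ j * x) * S j.
  have := subrX1 (om ^+ j * x) k.
  rewrite exprMn -exprM mulnC exprM omk expr1n mul1r -/(S j) => H.
  by rewrite -opprB H -mulNr opprB.
have sumS : \sum_(j < k) S j = k%:R.
  rewrite exchange_big /= (bigD1 (Ordinal k0))//= [X in _ + X]big1 ?addr0.
    by under eq_bigr do rewrite expr0; rewrite sumr_const card_ord.
  move=> n n0; under eq_bigr do rewrite exprMn -exprM mulnC exprM.
  rewrite -mulr_suml.
  have : (om ^+ n - 1) * \sum_(j < k) (om ^+ n) ^+ j = 0.
    by rewrite -subrX1 -exprM mulnC exprM omk expr1n subrr.
  move/eqP; rewrite mulf_eq0 subr_eq0 -(prim_order_dvd om_prim) => /orP[|/eqP->].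
    have n1 : (0 < n)%N by rewrite lt0n; apply: contra n0 => /eqP n00; apply/eqP/val_inj.
    by move=> /(dvdn_leq n1); rewrite leqNgt ltn_ord.
  by rewrite mul0r.
have [/existsP[j Hj]|] := boolP [exists j, 1 <= cabs (S j)].
  by exists j; rewrite (HS j) cabsM ler_peMr ?cabs_ge0.
rewrite negb_exists => /forallP H.
have : cabs (\sum_(j < k) S j) < k%:R.
  apply: (le_lt_trans (cabs_sum _ _ _)).
  rewrite -[k in k%:R]card_ord -sumr_const; apply: ltr_sum.
    by apply/hasP; exists (Ordinal k0) => //; exact: mem_index_enum.
  by move=> j _; rewrite ltNge H.
by rewrite sumS cabs_nat ltxx.
Qed.

Lemma prim_root_cabs k om : (0 < k)%N -> k.-primitive_root om -> cabs om = 1.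
Proof.
move=> k0 /prim_expr_order omk; have : cabs om ^+ k = 1 by rewrite -cabsX omk cabs1.
by move/eqP; rewrite pexpr_eq1 ?cabs_ge0// => /eqP.
Qed.

End RootsOfUnity.

(** * Integrability at the puncture *)

Section PuncturedDisc.
Variable R : realType.
Local Notation mR := (measurableTypeR R).
Local Notation leb := (@lebesgue_measure R).
Implicit Types (q : mR * mR).

Lemma disc_measure_le (r : R) : 0 < r ->
  (@leb2 R [set q | (cabs (cpt q) < r)%R] <= (4 * r ^+ 2)%:E)%E.
Proof.
move=> r0; pose A : set mR := `[- r, r]%classic.
have mA : measurable A by exact: measurable_itv.
apply: (@le_trans _ _ (@leb2 R (A `*` A))).
  apply: le_measure; rewrite ?inE.
  - exact: measurable_cpt_lt.
  - exact: measurableX.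
  - move=> [x y] /= xy; split; rewrite /A /= in_itv /= -ler_norml.
      by rewrite (le_trans (cabs_Re (x +i* y)%C) (ltW xy)).
    by rewrite (le_trans (cabs_Im (x +i* y)%C) (ltW xy)).
rewrite [leLHS](_ : _ = (leb A * leb A)%E).
  rewrite lebesgue_measure_itv /= lte_fin gt0_cp// -EFinB -EFinM lee_fin le_eqVlt.
  by apply/orP; left; apply/eqP; ring.
by rewrite /leb2 product_measure1E.
Qed.

Definition punctured_disc : set (mR * mR) := [set q | 0 < cabs (cpt q) < 1].

Lemma measurable_punctured_disc : measurable punctured_disc.
Proof.
have m2 : measurable_fun [set: mR * mR] (fun q => cabs (cpt q)).
  by apply: cmeasurable_cabs; exact: cmeasurable_cpt.
rewrite (_ : punctured_disc = [set q | 0 < cabs (cpt q)] `&` [set q | cabs (cpt q) < 1]).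
  apply: measurableI; last exact: measurable_cpt_lt.
  have := measurable_fun_ltr (measurable_cst (0 : R)) m2.
  by move=> /(_ measurableT [set true] I); rewrite setTI.
by apply/seteqP; split => p /=; [move=> /andP[]|move=> [? ?]; apply/andP].
Qed.

(** For 2^-(n+1) <= |q| < 2^-n the integrand is at most a^n 4^(n+1) with a = 2^-r, and the disc of
    radius 2^-n has area at most 4 * 4^-n. The sum is dominated by a geometric series with terms 16
    a^n, so any positive r repairs the divergence of |q|^(-2). *)
Lemma integral_punctured_disc (r : R) : 0 < r -> exists2 S : R, 0 < S &
  (\int[@leb2 R]_(q in punctured_disc)
     (cabs (cpt q) `^ r / cabs (cpt q) ^+ 2)%:E <= S%:E)%E.
Proof.
move=> r0; set a := (2^-1 : R) `^ r.
have a0 : 0 < a by rewrite powR_gt0.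
have a1 : a < 1.
  have <- : (1 : R) `^ r = 1 by rewrite powR1.
  by rewrite gt0_ltr_powR ?nnegrE ?invr_ge0// invf_lt1// ltr1n.
exists (16 / (1 - a)); first by rewrite divr_gt0// subr_gt0.
have mD := measurable_punctured_disc.
have mc : measurable_fun [set: mR * mR] (fun q => cabs (cpt q)).
  by apply: cmeasurable_cabs; exact: cmeasurable_cpt.
pose B n : set (mR * mR) := [set q | cabs (cpt q) < 2^-1 ^+ n].
pose c n : R := a ^+ n * 4 * 4 ^+ n.
have c0 n : 0 <= c n by rewrite !mulr_ge0 ?exprn_ge0 ?(ltW a0).
pose g n q : \bar R := ((c n)%:E * (\1_(B n) q)%:E)%E.
have mB n : measurable (B n) by exact: measurable_cpt_lt.
have g0 n q : (0 <= g n q)%E by rewrite mule_ge0// lee_fin.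
have mg n : measurable_fun punctured_disc (g n).
  apply: measurable_funeM; apply/measurable_EFinP/measurable_funTS.
  exact: measurable_indic.
have fg q : punctured_disc q -> ((cabs (cpt q) `^ r / cabs (cpt q) ^+ 2)%:E <= \sum_(0 <= n <oo) g n q)%E.
  move=> /andP[q0 q1].
  have ex : exists m, 2^-1 ^+ m <= cabs (cpt q).
    exists (Num.bound (cabs (cpt q))^-1).
    rewrite exprVn -[leRHS]invrK lef_pV2 ?posrE ?exprn_gt0 ?invr_gt0//.
    apply: (le_trans (ltW (archi_boundP _))); first by rewrite invr_ge0 ltW.
    by rewrite -natrX ler_nat ltnW// ltn_expl.
  (* [cpt q] lies in the dyadic shell of index [n]. *)
  case: (ex_minnP ex) => -[|n] Hn Hmin; first by move: Hn; rewrite expr0 leNgt q1.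
  have Hq : cabs (cpt q) < 2^-1 ^+ n.
    by rewrite ltNge; apply/negP => /Hmin; rewrite ltnn.
  apply: (@le_trans _ _ (g n q)); last first.
    apply: le_trans (nneseries_lim_ge n.+1 _) => //.
    by rewrite big_nat_recr//= leeDr// sume_ge0.
  rewrite /g indicE mem_set//= mule1 lee_fin /c -mulrA.
  apply: ler_pM.
  - exact: powR_ge0.
  - by rewrite invr_ge0 sqr_ge0.
  - rewrite /a -powR_mulrn ?powR_ge0// -powRrM mulrC powRrM powR_mulrn ?invr_ge0//.
    by apply: ge0_ler_powR; rewrite ?nnegrE ?cabs_ge0 ?exprn_ge0 ?invr_ge0 ?(ltW r0) ?(ltW Hq).
  - have h4 : 0 < 2^-1 ^+ n.+1 :> R by rewrite exprn_gt0// invr_gt0.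
    apply: (@le_trans _ _ ((2^-1 ^+ n.+1) ^+ 2)^-1).
      by rewrite lef_pV2 ?posrE ?exprn_gt0// lerXn2r ?nnegrE ?cabs_ge0// ltW.
    rewrite -exprS exprVn exprVn invrK -exprM mulnC exprM.
    by rewrite (_ : 2 ^+ 2 = 4 :> R)// -natrX.
apply: (@le_trans _ _ (\int[@leb2 R]_(q in punctured_disc) (\sum_(0 <= n <oo) g n q)%E)%E).
  apply: ge0_le_integral => //.
  - by move=> q _; rewrite lee_fin divr_ge0 ?powR_ge0 ?sqr_ge0.
  - apply/measurable_EFinP/measurable_funTS; apply: measurable_funM.
      exact: (measurableT_comp (measurable_powR _)).
    by apply: measurable_fun_invr; exact: measurable_funX.
  - exact: ge0_emeasurable_sum.
rewrite integral_nneseries//.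
apply: lime_le; first by apply: is_cvg_nneseries => n _ _; exact: integral_ge0.
apply: nearW => N.
apply: (@le_trans _ _ (\sum_(0 <= n < N) (16 * a ^+ n)%:E)%E).
  apply: lee_sum => n _; rewrite /g ge0_integralZl//; last 2 first.
  - by apply/measurable_EFinP/measurable_funTS; exact: measurable_indic.
  - by rewrite lee_fin.
  rewrite integral_indic//.
  apply: (@le_trans _ _ ((c n)%:E * (4 * (2^-1 ^+ n) ^+ 2)%:E)%E).
    rewrite lee_wpmul2l ?lee_fin//.
    apply: (le_trans _ (disc_measure_le _)); last by rewrite exprn_gt0 ?invr_gt0.
    apply: (@le_measure _ _ _ (@leb2 R)); rewrite ?inE.
    - exact: measurableI.
    - exact: mB.
    - exact: subIsetl.
  rewrite -EFinM lee_fin le_eqVlt; apply/orP; left; apply/eqP.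
  have E4 : 4 ^+ n = (2 ^+ n) ^+ 2 :> R.
    by rewrite -exprM mulnC exprM (_ : 2 ^+ 2 = 4 :> R)// -natrX.
  rewrite /c E4 exprVn.
  have h : (2 : R) ^+ n != 0 by rewrite expf_neq0.
  by field.
rewrite sumEFin lee_fin -mulr_sumr ler_wpM2l//.
rewrite big_mkord -[leRHS]mul1r ler_pdivlMr ?subr_gt0//.
have := subrX1 a N; rewrite mulrC => E.
have -> : (\sum_(i < N) a ^+ i) * (1 - a) = 1 - a ^+ N.
  by rewrite -[1 - a]opprB mulrN -E opprB.
by rewrite lerBlDr lerDl exprn_ge0 ?ltW.
Qed.

End PuncturedDisc.

(** * The square norm of the kernels in the first variable *)

Section KernelNorm.
Variable R : realType.
Local Notation mR := (measurableTypeR R).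
Implicit Types (a b g : R[i]) (q x y : mR * mR) (z w : C2 R).

(** By [closest_root] the integrand is at most one of the k functions |1 - c_j q|^(-4), hence at
    most their sum; each [c j] satisfies |c_j| |g| = |a|, so the k integrals obey the same bound. *)
Lemma integral_power_factor k a g : (0 < k)%N -> cabs a < 1 -> g != 0 ->
  (\int[@leb2 R]_(q in [set q | (cabs (cpt q) < cabs g)%R])
     ((cabs (1 - (cpt q / g * a) ^+ k) ^+ 4)^-1)%:E <=
   (k%:R * (64 * pi ^+ 2 * cabs g ^+ 2 / (1 - cabs a) ^+ 2))%:E)%E.
Proof.
move=> k0 a1 g0; have [om om_prim] := @prim_root_exists R k k0.
have om1 := prim_root_cabs k0 om_prim.
have g0' : 0 < cabs g by rewrite cabs_gt0.
have mD := @measurable_cpt_lt R (cabs g).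
pose c (j : 'I_k) := om ^+ j * a / g.
have cE j : cabs (c j) * cabs g = cabs a.
  by rewrite cabs_div divfK ?gt_eqF// cabsM cabsX om1 expr1n mul1r.
have mF (h : mR * mR -> R[i]) : cmeasurable h ->
    measurable_fun [set: mR * mR] (fun q => ((cabs (1 - h q) ^+ 4)^-1)%:E).
  move=> mh; apply/measurable_EFinP; apply: measurable_fun_invr; apply: measurable_funX.
  by apply: cmeasurable_cabs; apply: cmeasurableB => //; exact: cmeasurable_cst.
have mc := @cmeasurable_cpt R.
have mL (j : 'I_k) : measurable_fun [set: mR * mR] (fun q => ((cabs (1 - c j * cpt q) ^+ 4)^-1)%:E).
  by apply: mF; apply: cmeasurableM => //; exact: cmeasurable_cst.
apply: (@le_trans _ _ (\int[@leb2 R]_(q in [set q | (cabs (cpt q) < cabs g)%R])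
    (\sum_(j < k) ((cabs (1 - c j * cpt q) ^+ 4)^-1)%:E))%E).
  apply: ge0_le_integral => //.
  - by move=> q _; rewrite lee_fin invr_ge0 exprn_ge0 ?cabs_ge0.
  - apply: measurable_funTS; apply: mF; apply: cmeasurableX.
    apply: cmeasurableM; last exact: cmeasurable_cst.
    by apply: cmeasurableM; last exact: cmeasurable_cst.
  - by apply: emeasurable_sum => j; exact: measurable_funTS.
  - move=> q /= qg; have [j Hj] := closest_root (cpt q / g * a) k0 om_prim.
    rewrite (bigD1 j)//= (@le_trans _ _ ((cabs (1 - c j * cpt q) ^+ 4)^-1)%:E)//; last first.
      by rewrite leeDl// sume_ge0// => i _; rewrite lee_fin invr_ge0 exprn_ge0 ?cabs_ge0.
    have E : c j * cpt q = om ^+ j * (cpt q / g * a) by rewrite /c; ring.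
    rewrite lee_fin E; have pos : 0 < cabs (1 - om ^+ j * (cpt q / g * a)).
      have := cabs_tri 1 (om ^+ j * (cpt q / g * a)) 0; rewrite !subr0 cabs1.
      rewrite cabsM cabsX om1 expr1n mul1r cabsM cabs_div.
      have : cabs (cpt q) / cabs g * cabs a < 1.
        rewrite mulr_ilt1 ?divr_ge0 ?cabs_ge0// ltr_pdivrMr// ?mul1r//.
      by lra.
    rewrite lef_pV2 ?posrE ?exprn_gt0 ?(lt_le_trans pos)//.
    by rewrite lerXn2r ?nnegrE ?cabs_ge0.
rewrite ge0_integral_sum//; last 2 first.
- by move=> j; exact: measurable_funTS.
- by move=> j q _; rewrite lee_fin invr_ge0 exprn_ge0 ?cabs_ge0.
rewrite [leRHS](_ : _ = (\sum_(j < k) (64 * pi ^+ 2 * cabs g ^+ 2 / (1 - cabs a) ^+ 2)%:E)%E); last first.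
  by rewrite sumEFin sumr_const card_ord mulr_natl.
apply: lee_sum => j _; rewrite -(cE j).
by apply: integral_cauchy_factor; rewrite // cE.
Qed.

(** The two singularities are separated at |q| = 1/2: inside, the Cauchy factor is at most 16;
    outside, the power weight is at most 4. *)
Lemma integral_weighted_factor (r : R) : 0 < r -> exists2 C : R, 0 < C &
  forall g, cabs g < 1 ->
  (\int[@leb2 R]_(q in @punctured_disc R)
     (cabs (cpt q) `^ r / cabs (cpt q) ^+ 2 / cabs (1 - g * cpt q) ^+ 4)%:E <=
   (C / (1 - cabs g) ^+ 2)%:E)%E.
Proof.
move=> r0; have [S S0 HS] := @integral_punctured_disc R r r0.
exists (4 * (64 * pi ^+ 2) + 16 * S) => [|g g1].
  by rewrite addr_gt0 ?mulr_gt0 ?pi_gt0.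
have mD := @measurable_punctured_disc R.
have mc : measurable_fun [set: mR * mR] (fun q => cabs (cpt q)).
  by apply: cmeasurable_cabs; exact: cmeasurable_cpt.
pose f q := cabs (cpt q) `^ r / cabs (cpt q) ^+ 2.
pose L q := (cabs (1 - g * cpt q) ^+ 4)^-1.
have f0 q : 0 <= f q by rewrite divr_ge0 ?powR_ge0 ?sqr_ge0.
have L0 q : 0 <= L q by rewrite invr_ge0 exprn_ge0 ?cabs_ge0.
have mf : measurable_fun setT f.
  apply: measurable_funM; first exact: (measurableT_comp (measurable_powR _)).
  by apply: measurable_fun_invr; exact: measurable_funX.
have mL : measurable_fun setT L.
  apply: measurable_fun_invr; apply: measurable_funX; apply: cmeasurable_cabs.
  apply: cmeasurableB; first exact: cmeasurable_cst.
  by apply: cmeasurableM; [exact: cmeasurable_cst|exact: cmeasurable_cpt].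
have g10 : 0 < 1 - cabs g by rewrite subr_gt0.
apply: (@le_trans _ _ (\int[@leb2 R]_(q in @punctured_disc R) (4%:E * (L q)%:E + 16%:E * (f q)%:E))%E).
  apply: ge0_le_integral => //.
  - by move=> q _; rewrite lee_fin mulr_ge0 ?f0 ?L0.
  - by apply/measurable_EFinP/measurable_funTS; exact: measurable_funM.
  - apply: measurable_funTS; apply: emeasurable_funD; apply: measurable_funeM; exact/measurable_EFinP.
  - move=> q /andP[q0 q1]; rewrite -!EFinM -EFinD lee_fin -/(f q) -/(L q).
    have [q2|q2] := ltP (cabs (cpt q)) (1 / 2).
      apply: (@le_trans _ _ (16 * f q)); last by rewrite lerDr mulr_ge0.
      rewrite mulrC ler_wpM2r//.
      have H : 1 / 2 <= cabs (1 - g * cpt q).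
        have := cabs_tri 1 (g * cpt q) 0; rewrite !subr0 cabs1 cabsM.
        have := ler_pM (cabs_ge0 g) (cabs_ge0 (cpt q)) (ltW g1) (ltW q2); lra.
      have -> : 16 = ((1 / 2) ^+ 4)^-1 :> R by field.
      by rewrite lef_pV2 ?posrE ?exprn_gt0 ?(lt_le_trans _ H)// lerXn2r ?nnegrE ?cabs_ge0.
    apply: (@le_trans _ _ (4 * L q)); last by rewrite lerDl mulr_ge0.
    rewrite ler_wpM2r// /f.
    have -> : 4 = 1 * ((1 / 2) ^+ 2)^-1 :> R by field.
    apply: ler_pM; rewrite ?powR_ge0 ?invr_ge0 ?sqr_ge0//.
      have <- : (1 : R) `^ r = 1 by rewrite powR1.
      by apply: ge0_ler_powR; rewrite ?nnegrE ?cabs_ge0 ?(ltW r0) ?(ltW q1).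
    by rewrite lef_pV2 ?posrE ?exprn_gt0// lerXn2r ?nnegrE ?cabs_ge0.
rewrite ge0_integralD//; last 4 first.
- by move=> q _; rewrite -EFinM lee_fin mulr_ge0.
- by apply: measurable_funTS; apply: measurable_funeM; exact/measurable_EFinP.
- by move=> q _; rewrite -EFinM lee_fin mulr_ge0.
- by apply: measurable_funTS; apply: measurable_funeM; exact/measurable_EFinP.
rewrite !ge0_integralZl//; try by move=> q _; rewrite lee_fin.
- rewrite [leRHS](_ : _ = (4%:E * (64 * pi ^+ 2 / (1 - cabs g) ^+ 2)%:E +
      16%:E * (S / (1 - cabs g) ^+ 2)%:E)%E); last first.
    by rewrite -!EFinM -EFinD; congr EFin; ring.
  apply: leeD; rewrite lee_wpmul2l//.
    have := @integral_cauchy_factor R g 1 ltr01; rewrite mulr1 expr1n mulr1 => /(_ g1).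
    apply: le_trans; apply: ge0_subset_integral => //.
    - exact: measurable_cpt_lt.
    - by apply/measurable_EFinP/measurable_funTS.
    - by move=> q _; rewrite lee_fin.
    - by move=> q /andP[].
  rewrite (le_trans HS)// lee_fin.
  rewrite ler_peMr ?(ltW S0)// invf_ge1 ?exprn_gt0// expr_le1 ?(ltW g10)//.
  by rewrite lerBlDr lerDl cabs_ge0.
- by apply/measurable_EFinP/measurable_funTS.
- by apply/measurable_EFinP/measurable_funTS.
Qed.

(** The slice over z2 = y is a disc of radius |y|^(1/k). Integrating |1 - u|^(-4) over it gives the
    factor |y|^(2/k), which makes |t|^(-2) integrable at y = 0. The remaining integral in y is then
    of the order (1 - |w2|)^(-2), and the product is comparable to P(w, w). *)
Lemma kernel_norm_le k : (0 < k)%N -> exists2 C : R, 0 < C & forall w, Hk k w ->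
  (\int[@dV R]_(z in Hk k) (cabs (Pk k z w) ^+ 2)%:E <= (C * diagP k w)%:E)%E.
Proof.
move=> k0; have r0 : 0 < 2 / k%:R :> R by rewrite divr_gt0 ?ltr0n.
have [C1 C10 HC1] := @integral_weighted_factor _ r0.
have kR : 0 < k%:R :> R by rewrite ltr0n.
have pi2 : 0 < pi ^+ 2 :> R by rewrite exprn_gt0 ?pi_gt0.
have p0 := pi_gt0 R.
exists (k%:R * (64 * pi ^+ 2) * C1 * (16 * k%:R ^+ 2)) => [|w Hw].
  by rewrite !mulr_gt0.
have [a [b [a1 b01 wE]]] := Hk_pt k0 Hw; have [b0 b1] := andP b01.
have bn : b != 0 by rewrite -cabs_gt0.
have w1 : cz1 w = a * b by rewrite wE cz1_pt.
have w2 : cz2 w = b ^+ k by rewrite wE cz2_pt.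
have w21 : cabs (cz2 w) < 1 by have [] := HkP Hw.
have w20 := Hk_cz2 Hw.
have A0 : 0 < 1 - cabs a by rewrite subr_gt0.
pose Psi := (fun z => (cabs (Pk k z w) ^+ 2)%:E) \_ (Hk k).
have mPsi : measurable_fun setT Psi.
  apply/(measurable_restrictT _ (@measurable_Hk R k))/measurable_EFinP.
  apply: measurable_funTS; apply: measurable_funX; apply: cmeasurable_cabs.
  by apply: (@cmeasurable_kernel R _ _ k (Pk k) id (fun=> w)); [left|exact: measurable_id|exact: measurable_cst].
have Psi0 z : (0 <= Psi z)%E by rewrite /Psi patchE; case: ifPn => // _; rewrite lee_fin sqr_ge0.
rewrite integral_dV_mkcond -/Psi integral_dV//.
pose G y := (\int[@leb2 R]_x Psi (x, y))%E.
have mG : measurable_fun setT G by exact: measurable_fun_fubini_tonelli_G.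
have mD := @measurable_punctured_disc R.
pose f y := cabs (cpt y) `^ (2 / k%:R) / cabs (cpt y) ^+ 2 / cabs (1 - (cz2 w)^* * cpt y) ^+ 4.
have f0 y : 0 <= f y by rewrite !divr_ge0 ?powR_ge0 ?exprn_ge0 ?cabs_ge0.
pose K := k%:R * (64 * pi ^+ 2) / (1 - cabs a) ^+ 2 / cabs (cz2 w) ^+ 2.
have K0 : 0 <= K.
  have h : 0 <= k%:R * (64 * pi ^+ 2) :> R by rewrite !mulr_ge0 ?ltW.
  by apply: divr_ge0; [apply: divr_ge0|]; rewrite ?sqr_ge0.
have Gle y : punctured_disc y -> (G y <= K%:E * (f y)%:E)%E.
  move=> /andP[y0 y1].
  set g := k.-root (cpt y); have gk : g ^+ k = cpt y by exact: rootCK.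
  have gkR : cabs g ^+ k = cabs (cpt y) by rewrite -cabsX gk.
  have gn : g != 0.
    apply/eqP => gz; move: y0; rewrite -gk gz expr0n (negbTE (_ : k != 0%N)) ?cabs0 ?ltxx// -lt0n//.
  have g1 : cabs g < 1.
    by rewrite ltNge; apply/negP => /(exprn_ege1 k); rewrite gkR leNgt y1.
  have hE x : Hk k (x, y) <-> cabs (cpt x) < cabs g.
    rewrite /Hk /= /cz1 /cz2 /= -/(cpt x) -/(cpt y) y1 andbT -gkR.
    by rewrite ltr_pXn2r ?nnegrE ?cabs_ge0.
  pose Q := (cabs (cpt y) ^+ 2 * cabs (cz2 w) ^+ 2 * cabs (1 - (cz2 w)^* * cpt y) ^+ 4)^-1.
  have Q0 : 0 <= Q by rewrite invr_ge0 !mulr_ge0 ?exprn_ge0 ?cabs_ge0.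
  have mD2 := @measurable_cpt_lt R (cabs g).
  rewrite [leLHS](_ : _ = \int[@leb2 R]_(x in [set q | (cabs (cpt q) < cabs g)%R])
     (Q%:E * ((cabs (1 - (cpt x / g * a^* ) ^+ k) ^+ 4)^-1)%:E))%E; last first.
    rewrite [RHS]integral_mkcond; apply: eq_integral => x _; rewrite /Psi !patchE.
    have [xH|xH] := boolP (x \in _).
      move/set_mem/hE : xH => xH; rewrite mem_set// PkE//.
      have xE : (x, y) = pt (cpt x / g * g) (g ^+ k).
        by rewrite divfK// gk; case: (x) (y) => [? ?] [? ?].
      have -> : uk k (x, y) w = (cpt x / g * a^* ) ^+ k by rewrite xE (uk_pt _ gn bn w1 w2).
      have -> : tk (x, y) w = (cz2 w)^* * cpt y by rewrite /tk mulrC.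
      rewrite -EFinM; congr EFin; rewrite /Q cabsV 2!cabsM 2!cabsM !cabsX cabs_conj.
      by rewrite exprVn -invfM; congr (_^-1); ring.
    rewrite memNset// => /hE xH'; move/negP: xH; apply; exact: mem_set.
  have mc : measurable_fun [set: mR * mR] (fun x => ((cabs (1 - (cpt x / g * a^* ) ^+ k) ^+ 4)^-1)%:E).
    apply/measurable_EFinP; apply: measurable_fun_invr; apply: measurable_funX.
    apply: cmeasurable_cabs; apply: cmeasurableB; first exact: cmeasurable_cst.
    apply: cmeasurableX; apply: cmeasurableM; last exact: cmeasurable_cst.
    by apply: cmeasurableM; [exact: cmeasurable_cpt|exact: cmeasurable_cst].
  rewrite ge0_integralZl//; last 2 first.
  - exact: measurable_funTS.
  - by move=> x _; rewrite lee_fin invr_ge0 exprn_ge0 ?cabs_ge0.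
  have := @integral_power_factor k a^* g k0; rewrite cabs_conj => /(_ a1 gn) H.
  apply: (le_trans (lee_wpmul2l _ H)); first by rewrite lee_fin.
  rewrite -!EFinM lee_fin le_eqVlt; apply/orP; left; apply/eqP.
  have -> : cabs g ^+ 2 = cabs (cpt y) `^ (2 / k%:R).
    rewrite -gkR -!powR_mulrn ?cabs_ge0// -powRrM; congr powR.
    by field; rewrite gt_eqF.
  rewrite /Q /K /f; move: (powR _ _) => P.
  by rewrite !invfM; ring.
have E : (\int[@leb2 R]_y G y = \int[@leb2 R]_(y in @punctured_disc R) G y)%E.
  rewrite [RHS]integral_mkcond; apply: eq_integral => y _; rewrite patchE.
  case: ifPn => // yD; rewrite /G; apply: integral0_eq => x _.
  rewrite /Psi patchE memNset// => Hxy; move/negP: yD; apply; apply: mem_set.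
  by apply/andP; split; [exact: Hk_cz2 Hxy|have [] := HkP Hxy].
rewrite E.
have mf : measurable_fun setT f.
  have mc := @cmeasurable_cpt R; have mca := cmeasurable_cabs mc.
  apply: measurable_funM; last first.
    apply: measurable_fun_invr; apply: measurable_funX; apply: cmeasurable_cabs.
    apply: cmeasurableB; first exact: cmeasurable_cst.
    by apply: cmeasurableM => //; exact: cmeasurable_cst.
  apply: measurable_funM; first exact: (measurableT_comp (measurable_powR _)).
  by apply: measurable_fun_invr; exact: measurable_funX.
apply: (@le_trans _ _ (\int[@leb2 R]_(y in @punctured_disc R) (K%:E * (f y)%:E))%E).
  apply: ge0_le_integral => //.
  - by move=> y _; exact: integral_ge0.
  - exact: measurable_funTS.
  - by apply: measurable_funTS; apply: measurable_funeM; exact/measurable_EFinP.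
rewrite ge0_integralZl//; last 2 first.
- by apply/measurable_EFinP/measurable_funTS.
- by move=> y _; rewrite lee_fin.
have H := HC1 ((cz2 w)^* ); rewrite cabs_conj in H.
apply: (le_trans (lee_wpmul2l _ (H w21))); first by rewrite lee_fin.
rewrite -EFinM lee_fin.
have vE : cabs (cz1 w) ^+ (2 * k) / cabs (cz2 w) ^+ 2 = cabs a ^+ (2 * k).
  rewrite w1 w2 cabsM cabsX exprMn -exprM (mulnC k) mulfK// expf_neq0//.
  by rewrite cabs_eq0.
have D0 := diagP_gt0 Hw; have /andP[_ u1] := diag_u_lt1 Hw.
rewrite /diagP vE in D0 u1 *.
(* Up to the constants 4 k^2 and 4, whose product is the 16 k^2 in the bound, (1 - |a|)^(-2) and (1
   - |w2|)^(-2) are replaced by the corresponding factors of [diagP]. *)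
have := oneBX_le (2 * k) (cabs_ge0 a) (ltW a1); rewrite natrM.
set v := cabs a ^+ (2 * k) in u1 *; set t := cabs (cz2 w) in w20 w21 *; set A := 1 - cabs a in A0 *.
move=> hv; rewrite /K -/t -/A.
have U0 : 0 < 1 - v by rewrite subr_gt0.
have T0 : 0 < 1 - t by rewrite subr_gt0.
have T2 : 0 < 1 - t ^+ 2 by rewrite subr_gt0 expr_lt1 ?ltW.
have e1 : (A ^+ 2)^-1 <= 4 * k%:R ^+ 2 / (1 - v) ^+ 2.
  rewrite -[leLHS]mul1r ler_pdivrMr ?exprn_gt0// mulrAC ler_pdivlMr ?exprn_gt0// mul1r.
  have -> : 4 * k%:R ^+ 2 * A ^+ 2 = (2 * k%:R * A) ^+ 2 by ring.
  by rewrite lerXn2r ?nnegrE ?(ltW U0)// !mulr_ge0 ?ltW.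
have e2 : ((1 - t) ^+ 2)^-1 <= 4 / (1 - t ^+ 2) ^+ 2.
  rewrite -[leLHS]mul1r ler_pdivrMr ?exprn_gt0// mulrAC ler_pdivlMr ?exprn_gt0// mul1r.
  have -> : 4 * (1 - t) ^+ 2 = (2 * (1 - t)) ^+ 2 by ring.
  have : 0 <= 2 * (1 - t) by rewrite mulr_ge0 ?ltW.
  move=> h; rewrite lerXn2r ?nnegrE ?(ltW T2) ?h//.
  have -> : 1 - t ^+ 2 = (1 + t) * (1 - t) by ring.
  by rewrite ler_wpM2r ?(ltW T0)//; lra.
have := ler_pM (_ : 0 <= _) (_ : 0 <= _) e1 e2.
rewrite !invr_ge0 !sqr_ge0 => /(_ isT isT) e3.
have X0 : 0 <= k%:R * (64 * pi ^+ 2) * C1 / t ^+ 2.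
  by apply: divr_ge0; rewrite ?sqr_ge0// !mulr_ge0 ?ltW.
have := ler_wpM2l X0 e3.
rewrite (_ : _ * ((A ^+ 2)^-1 / _) = k%:R * (64 * pi ^+ 2) / A ^+ 2 / t ^+ 2 * (C1 / (1 - t) ^+ 2)); last by ring.
move/le_trans; apply; rewrite le_eqVlt; apply/orP; left; apply/eqP.
by rewrite !invfM; ring.
Qed.

Lemma hol_kernel k (M : C2 R -> C2 R -> R[i]) w : (0 < k)%N -> M = Pk k \/ M = Kk k ->
  Hk k w -> holomorphic_on (Hk k) (fun z => M z w).
Proof.
move=> k0 HM Hw z Hz; rewrite -/(hol (@cz1 R) (@cz2 R) _ z).
have hs : hol (@cz1 R) (@cz2 R) (fun z => cz1 z * (cz1 w)^* ) z.
  by apply: holM; [exact: hol_c1|exact: hol_cst].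
have ht : hol (@cz1 R) (@cz2 R) (fun z => cz2 z * (cz2 w)^* ) z.
  by apply: holM; [exact: hol_c2|exact: hol_cst].
have t0 := tk_neq0 Hz Hw; have t1 := oneB_neq0 (cabs_tk Hz Hw); have u1 := oneB_neq0 (cabs_uk Hz Hw).
have tu : tk z w - sk z w ^+ k != 0.
  have -> : tk z w - sk z w ^+ k = tk z w * (1 - uk k z w).
    by rewrite /uk mulrBr mulr1 mulrCA divff// mulr1.
  by rewrite mulf_neq0.
have hd : hol (@cz1 R) (@cz2 R) (fun z => (1 - cz2 z * (cz2 w)^* ) ^+ 2 *
    (cz2 z * (cz2 w)^* - (cz1 z * (cz1 w)^* ) ^+ k) ^+ 2) z.
  apply: holM; apply: holX; apply: holB => //; first exact: hol_cst.
  exact: holX.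
case: HM => ->; rewrite /Pk /Kk /=.
  by apply: holM => //; apply: holV => //; rewrite mulf_neq0 ?expf_neq0.
have hp : hol (@cz1 R) (@cz2 R) (fun z => pk k (cz1 z * (cz1 w)^* )) z.
  by apply: hol_sum => j; apply: holM; [exact: hol_cst|exact: holX].
have hq : hol (@cz1 R) (@cz2 R) (fun z => qk k (cz1 z * (cz1 w)^* )) z.
  apply: hol_sum => j; apply: holM; last exact: holX.
  by apply: holD; [exact: hol_cst|apply: holM; [exact: hol_cst|exact: holX]].
apply: holM.
  apply: holD; last by apply: holM => //; exact: holX.
  by apply: holD; apply: holM => //; exact: holX.
have kp := kpi_gt0 R k0.
apply: holV.
  rewrite -mulrA !mulf_neq0 ?expf_neq0// -cabs_gt0 complexr0 cabs_real.
  by rewrite gtr0_norm.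
under eq_fun do rewrite -mulrA.
by apply: holM => //; exact: hol_cst.
Qed.

End KernelNorm.

(** * Carleson measures *)

Section CarlesonKernel.
Variables (R : realType) (k : nat) (M : C2 R -> C2 R -> R[i]).
Hypotheses (k0 : (0 < k)%N) (HM : M = Pk k \/ M = Kk k).
Variable mu : {finite_measure set C2 R -> \bar R}.
Implicit Types (z w : C2 R).

Definition kernel_mass w : \bar R := (\int[mu]_(z in Hk k) (kernel_weight M k z w)%:E)%E.

Lemma kernel_bounded_carleson : Linfty_Hk k kernel_mass -> carleson k mu.
Proof.
move=> [_ [N HN]]; have [C C0 HC] := kernel_submean k0 HM.
(* The bound N may be zero or negative, while a Carleson constant has to be positive. *)
pose N' := `|N| + 1; have N'0 : 0 < N' by rewrite ltr_wpDl.
exists (C * N') => [|h hA]; first by rewrite mulr_gt0.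
have [hh hf] := hA; have mH := @measurable_Hk R k.
have mh : measurable_fun (Hk k) (fun w => cabs (h w) ^+ 2).
  by apply: measurable_funX; exact: hol_measurable.
pose H : C2 R -> R := (fun w => cabs (h w) ^+ 2) \_ (Hk k).
have mHH : measurable_fun setT H by exact/(measurable_restrictT _ mH).
have H0 w : 0 <= H w by rewrite /H patchE; case: ifPn => // _; exact: sqr_ge0.
(* Cut off to the domain in both variables, so that Tonelli's theorem applies on the whole product
   space. *)
pose Phi (p : C2 R * C2 R) := (\1_(Hk k) p.1 * kernel_weight M k p.1 p.2 * H p.2)%:E.
have Phi0 p : (0 <= Phi p)%E.
  rewrite lee_fin /H patchE; case: ifPn => [/set_mem pH|]; last by rewrite mulr0.
  apply: mulr_ge0; last exact: sqr_ge0.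
  by apply: mulr_ge0 => //; exact: kernel_weight_ge0.
have mI : measurable_fun setT (\1_(Hk k) : C2 R -> R) by exact: measurable_indic.
have mPhi : measurable_fun setT Phi.
  apply/measurable_EFinP; apply: measurable_funM; last first.
    by apply: (measurableT_comp mHH); exact: measurable_snd.
  apply: measurable_funM; first by apply: (measurableT_comp mI); exact: measurable_fst.
  apply: (@measurable_kernel_weight R _ _ k M fst snd) => //.
pose F z := (\int[@leb4 R]_w Phi (z, w))%E.
have mF : measurable_fun setT F by exact: measurable_fun_fubini_tonelli_F.
have F0 z : (0 <= F z)%E by exact: integral_ge0.
apply: (@le_trans _ _ (\int[mu]_(z in Hk k) (C%:E * F z))%E).
  apply: ge0_le_integral => //.
  - by move=> z _; rewrite lee_fin sqr_ge0.
  - exact/measurable_EFinP.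
  - by apply: measurable_funTS; exact: measurable_funeM.
  - move=> z Hz; apply: (le_trans (HC _ _ hA Hz)).
    rewrite lee_wpmul2l ?lee_fin ?(ltW C0)// integral_dV_mkcond dVE.
    rewrite le_eqVlt; apply/orP; left; apply/eqP; apply: eq_integral => w _.
    rewrite /Phi /= /H !patchE indicE (mem_set Hz) mul1r.
    by case: ifPn => //; rewrite mulr0.
apply: (@le_trans _ _ (\int[mu]_z (C%:E * F z))%E).
  apply: ge0_subset_integral => //; first exact: measurable_funeM.
  by move=> z _; rewrite mule_ge0// lee_fin ltW.
rewrite ge0_integralZl ?lee_fin ?(ltW C0)// EFinM -muleA lee_wpmul2l ?lee_fin ?(ltW C0)//.
have -> : (\int[mu]_z F z = \int[@leb4 R]_w \int[mu]_z Phi (z, w))%E.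
  exact: fubini_tonelli.
rewrite integral_dV_mkcond dVE.
have HE : (fun w => (cabs (h w) ^+ 2)%:E) \_ (Hk k) = (fun w => (H w)%:E).
  by apply/funext => w; rewrite /H !patchE; case: ifPn.
rewrite HE -ge0_integralZl//; last 3 first.
- exact/measurable_EFinP.
- by move=> w _; rewrite lee_fin.
- by rewrite lee_fin ltW.
(* The bound on the kernel mass holds only almost everywhere for [dV]; this suffices because w is
   now the outer variable of integration. *)
apply: ae_ge0_le_integral => //.
- by move=> w _; apply: integral_ge0.
- exact: measurable_fun_fubini_tonelli_G.
- by move=> w _; rewrite mule_ge0 ?lee_fin ?(ltW N'0).
- by apply: measurable_funeM; exact/measurable_EFinP.
have [A [mA A0 HA]] := HN; exists A; split => // w Hw; apply: HA => /= HNw; apply: Hw => _.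
have [wH|wH] := boolP (w \in Hk k); last first.
  rewrite /Phi /= /H patchE (negbTE wH) mule0 integral0_eq// => z _.
  by rewrite mulr0.
have wH' := set_mem wH; have := HNw wH'.
rewrite gee0_abs; last first.
  by apply: integral_ge0 => z _; rewrite lee_fin; exact: kernel_weight_ge0.
move=> HS; rewrite muleC [leLHS](_ : _ = (H w)%:E * kernel_mass w)%E; last first.
  have mw : measurable_fun setT (fun z => kernel_weight M k z w).
    by apply: (@measurable_kernel_weight R _ _ k M id (fun=> w)) => //; exact: measurable_cst.
  rewrite /kernel_mass -ge0_integralZl//; last 3 first.
  - by apply/measurable_EFinP; exact: measurable_funTS.
  - by move=> z _; rewrite lee_fin; exact: kernel_weight_ge0.
  - by rewrite lee_fin.
  rewrite [RHS]integral_mkcond; apply: eq_integral => z _; rewrite /Phi /= patchE indicE.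
  by case: ifPn => _; rewrite ?mul0r// mul1r -EFinM mulrC.
rewrite lee_wpmul2l ?lee_fin// (le_trans HS)// lee_fin /N'.
by rewrite (le_trans (ler_norm _))// lerDl.
Qed.

Lemma kernel_norm_bound : exists2 C : R, 0 < C & forall w, Hk k w ->
  (\int[@dV R]_(z in Hk k) (cabs (M z w) ^+ 2)%:E <= (C * diagP k w)%:E)%E.
Proof.
have [C C0 HC] := @kernel_norm_le R k k0; case: HM => ->; first by exists C.
have [L L0 HL] := @cabs_Kk_le R k k0.
exists (L ^+ 2 * C) => [|w Hw]; first by rewrite mulr_gt0 ?exprn_gt0.
have mH := @measurable_Hk R k.
have mker (M' : C2 R -> C2 R -> R[i]) : M' = Pk k \/ M' = Kk k ->
    measurable_fun (Hk k) (fun z => (cabs (M' z w) ^+ 2)%:E).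
  move=> HM'; apply/measurable_EFinP/measurable_funTS; apply: measurable_funX.
  apply: cmeasurable_cabs; apply: (@cmeasurable_kernel R _ _ k M' id (fun=> w)) => //.
apply: (@le_trans _ _ (\int[@leb4 R]_(z in Hk k) ((L ^+ 2)%:E * (cabs (Pk k z w) ^+ 2)%:E))%E).
  rewrite dVE; apply: ge0_le_integral => //.
  - by move=> z _; rewrite lee_fin sqr_ge0.
  - by apply: mker; right.
  - by apply: measurable_funeM; apply: mker; left.
  - move=> z Hz; rewrite -EFinM lee_fin -exprMn lerXn2r ?nnegrE ?cabs_ge0//; last exact: HL.
    by rewrite mulr_ge0 ?cabs_ge0 ?ltW.
rewrite ge0_integralZl//; last 3 first.
- by apply: mker; left.
- by move=> z _; rewrite lee_fin sqr_ge0.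
- by rewrite lee_fin sqr_ge0.
have -> : (L ^+ 2 * C * diagP k w)%:E = ((L ^+ 2)%:E * (C * diagP k w)%:E)%E.
  by rewrite -EFinM mulrA.
by apply: lee_wpmul2l; [rewrite lee_fin sqr_ge0|exact: HC].
Qed.

Lemma carleson_kernel_bounded : carleson k mu -> Linfty_Hk k kernel_mass.
Proof.
move=> [C C0 HC]; have mH := @measurable_Hk R k.
split.
  pose Phi (p : C2 R * C2 R) := (\1_(Hk k) p.1 * (kernel_weight M k p.1 p.2 * \1_(Hk k) p.2))%:E.
  have Phi0 p : (0 <= Phi p)%E.
    rewrite lee_fin !indicE; case: (boolP (p.2 \in _)) => [/set_mem pH|_]; last by rewrite !mulr0.
    apply: mulr_ge0 => //; rewrite mulr1; exact: kernel_weight_ge0.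
  have mI : measurable_fun setT (\1_(Hk k) : C2 R -> R) by exact: measurable_indic.
  have mPhi : measurable_fun setT Phi.
    apply/measurable_EFinP; apply: measurable_funM.
      by apply: (measurableT_comp mI); exact: measurable_fst.
    apply: measurable_funM; last by apply: (measurableT_comp mI); exact: measurable_snd.
    apply: (@measurable_kernel_weight R _ _ k M fst snd) => //.
  have mG : measurable_fun (Hk k) (fun w => \int[mu]_z Phi (z, w))%E.
    apply: measurable_funTS.
    exact: (@measurable_fun_fubini_tonelli_G _ _ _ _ R mu Phi mPhi Phi0).
  apply: eq_measurable_fun mG => w /set_mem Hw.
  rewrite /kernel_mass [RHS]integral_mkcond; apply: eq_integral => z _.
  rewrite /Phi patchE /= !indicE (mem_set Hw) mulr1.
  by case: ifPn => _; rewrite ?mul0r ?mul1r.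
have [C1 C10 HC1] := kernel_norm_bound; have [L L0 HL] := @ReKk_bounds R k k0.
have kp := kpi_gt0 R k0.
(* The Carleson inequality for M(., w) gives C C1 [diagP k w], and dividing by K(w, w), which is at
   least [diagP k w] over k pi^2, leaves this constant at every w of the domain. *)
exists (C * C1 * (k%:R * pi ^+ 2)); rewrite dVE; apply: (@aeW _ _ _ (@leb4 R)) => w Hw.
have D0 := diagP_gt0 Hw; have [K1 _] := andP (HL _ Hw).
have K0 : 0 < complex.Re (Kk k w w) by rewrite (lt_le_trans _ K1)// divr_gt0.
rewrite gee0_abs; last first.
  by apply: integral_ge0 => z _; rewrite lee_fin; exact: kernel_weight_ge0.
have mw : measurable_fun setT (fun z => cabs (M z w) ^+ 2).
  apply: measurable_funX; apply: cmeasurable_cabs.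
  by apply: (@cmeasurable_kernel R _ _ k M id (fun=> w)) => //; exact: measurable_cst.
have HA : A2 k (fun z => M z w).
  split; first exact: hol_kernel.
  by apply: (le_lt_trans (HC1 _ Hw)); rewrite ltry.
rewrite /kernel_mass /kernel_weight; under eq_integral do rewrite mulrC EFinM.
rewrite ge0_integralZl//; last 3 first.
- by apply/measurable_EFinP; exact: measurable_funTS.
- by move=> z _; rewrite lee_fin sqr_ge0.
- by rewrite lee_fin invr_ge0 ltW.
apply: (@le_trans _ _ (((complex.Re (Kk k w w))^-1)%:E * (C%:E * (C1 * diagP k w)%:E))%E).
  rewrite lee_wpmul2l ?lee_fin ?invr_ge0 ?(ltW K0)// (le_trans (HC _ HA))//.
  by rewrite lee_wpmul2l ?lee_fin ?(ltW C0)// HC1.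
rewrite -!EFinM lee_fin mulrC ler_pdivrMr// -2!mulrA ler_wpM2l ?(ltW C0)// -mulrA ler_wpM2l ?(ltW C10)//.
by rewrite mulrC -ler_pdivrMr.
Qed.

End CarlesonKernel.

Theorem theorem1p3 (R : realType) (k : nat) (mu : {finite_measure set C2 R -> \bar R}) :
  (0 < k)%N ->
  mu (~` Hk k) = 0%E ->
  [/\ (carleson k mu <-> Linfty_Hk k (Bmu k mu)),
      (Linfty_Hk k (Bmu k mu) <-> Linfty_Hk k (Tmu k mu)) &
      (carleson k mu <-> Linfty_Hk k (Tmu k mu))].
Proof.
move=> k0 _.
have B : carleson k mu <-> Linfty_Hk k (Bmu k mu).
  split; first exact: (carleson_kernel_bounded k0 (or_intror erefl)).
  exact: (kernel_bounded_carleson k0 (or_intror erefl)).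
have T : carleson k mu <-> Linfty_Hk k (Tmu k mu).
  split; first exact: (carleson_kernel_bounded k0 (or_introl erefl)).
  exact: (kernel_bounded_carleson k0 (or_introl erefl)).
by split; [exact: B|exact: (iff_trans (iff_sym B) T)|exact: T].
Qed.
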